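(* Consider, on $X=\mathbb T^d$ (periodic case) or $X=I^d$ (reflected case), the sequential random maps with additive noise described in the context, with all the noise hypotheses and the uniform differentiability condition stated there, and let $L_n^\varepsilon:L^1(X,m)\to L^1(X,m)$ be their annealed transfer operators, $L_n=L_n^0$. Then the following hold for $\varepsilon$ in a sufficiently small interval $[0,\varepsilon_0)$. (a) Each $L_n^\varepsilon$ is positive and preserves integrals (hence is a contraction of $L^1(X,m)$); there is an equivariant family of probability densities $\boldsymbol\mu^\varepsilon=(\mu_n^\varepsilon)_{n\in\mathbb Z}$, $\mu_{n+1}^\varepsilon=L_n^\varepsilon\mu_n^\varepsilon$, bounded in $L^1(X,m)$ uniformly in $n,\varepsilon$; there are $C\ge1$, $\rho\in(0,1)$ with $\|L_{n-1}^\varepsilon\cdots L_{k}^\varepsilon v\|_{L^1}\le C\rho^{n-k}\|v\|_{L^1}$ for all $k<n$, all $\varepsilon$, and all $v\in L^1(X,m)$ with $\int v\,dm=0$; and, with $\boldsymbol\mu=\boldsymbol\mu^0$ and $g_n:=\dot L_n\mu_n$, $\sup_n\|g_n\|_{L^1}<\infty$, $\sup_n\|\varepsilon^{-1}(L_n^\varepsilon\mu_n-L_n\mu_n)-g_n\|_{L^1}\to0$ and $\sup_n\|L_n^\varepsilon-L_n\|_{L^1\to L^1}\to0$ as $\varepsilon\to0$. (b) The limit $$\boldsymbol\eta=\lim_{\varepsilon\to0}\frac{\boldsymbol\mu^\varepsilon-\boldsymbol\mu^0}{\varepsilon}$$ exists in $\ell^\infty(\mathbb Z;L^1(X,m))$,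 and for every $n\in\mathbb Z$, $$\eta_n=g_{n-1}+\sum_{j=1}^\infty L_{n-1}L_{n-2}\cdots L_{n-j}\,g_{n-j-1},$$ where the series converges absolutely in $L^1(X,m)$, uniformly in $n$.
   Context: $m$ is normalized Lebesgue measure on $X$; $X=\mathbb T^d=(\mathbb R/\mathbb Z)^d$ or $X=I^d$ with $I=[a,b]$ compact, $\ell=b-a>0$. Reflection: $\mathcal R_I:\mathbb R\to I$, $\mathcal R_I(s)=a+\ell-\bigl|((s-a)\bmod 2\ell)-\ell\bigr|$, and $\mathcal R:\mathbb R^d\to I^d$ acts by $\mathcal R_I$ in each component. Noise kernel. Periodic case: $q\in W^{1,1}(\mathbb T^d)$, $q\ge0$, $\int q\,dm=1$, and $q\ge\alpha>0$ $m$-a.e.; $k_X(z,y):=q(y-z)$ for $z\in\mathbb T^d$. Reflected case: $q\in W^{1,1}(\mathbb R^d)$, $q\ge0$, $\int_{\mathbb R^d}q\,dx=1$; for $z\in\mathbb R^d$, $k_X(z,\cdot)$ is the density with respect to $m$ of $\mathcal R_*(q(\cdot-z)\,dx)$. Maps: $(f_n^\varepsilon)_{n\in\mathbb Z}$, $\varepsilon\in[0,\varepsilon_0)$, are measurable maps $X\to\mathbb T^d$ (periodic case) or $X\to\mathbb R^d$ (reflected case). In the reflected case the images of all $f_n^\varepsilon$, for all sufficiently small $\varepsilon$, lie in a fixed compact set $\mathcal K\subset\mathbb R^d$, and $\alpha:=\ell^d\operatorname{ess\,inf}_{z\in\mathcal K,\,y\in I^d}q(y-z)>0$. Uniform differentiability: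 there are measurable $\dot f_n:X\to\mathbb R^d$ and $r_n^\varepsilon:X\to\mathbb R^d$ with $$f_n^\varepsilon=f_n^0+\varepsilon\dot f_n+r_n^\varepsilon,\quad\sup_n\|\dot f_n\|_{L^\infty}<\infty,\quad\sup_n\frac{\|r_n^\varepsilon\|_{L^\infty}}{|\varepsilon|}\to0\ (\varepsilon\to0)$$ (in the torus case understood modulo $\mathbb Z^d$, via compatible lifts). Dynamics: with i.i.d. noise $\xi_n$ of density $q$, $X_{n+1}=f_n^\varepsilon(X_n)+\xi_n$ on $\mathbb T^d$, respectively $X_{n+1}=\mathcal R(f_n^\varepsilon(X_n)+\xi_n)$ on $I^d$. The annealed transfer operator is $$(L_n^\varepsilon\varphi)(y)=\int_X\varphi(x)\,k_X(f_n^\varepsilon(x),y)\,dm(x).$$ The map $z\mapsto k_X(z,\cdot)$ is continuously differentiable with values in $L^1(X,m)$; $D_1k_X(z,\cdot)[u]\in L^1(X,m)$ denotes its Fréchet derivative at $z$ in direction $u\in\mathbb R^d$: it equals $-\nabla q(\cdot-z)\cdot u$ in the periodic case and is the density of $\mathcal R_*[-\nabla q(\cdot-z)\cdot u\,dx]$ in the reflected case. Define $$(\dot L_n\varphi)(y)=\int_X\varphi(x)\,D_1k_X(f_n^0(x),y)[\dot f_n(x)]\,dm(x).$$ *)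

(* Defs.v *)
From HB Require Import structures.
From mathcomp Require Import all_boot all_order all_algebra.
From mathcomp Require Import all_classical all_reals all_analysis ess_sup_inf.

Set Implicit Arguments.
Unset Strict Implicit.
Unset Printing Implicit Defensive.

Import Order.TTheory GRing.Theory Num.Theory.
Import numFieldTopology.Exports numFieldNormedType.Exports.

Local Open Scope classical_set_scope.
Local Open Scope ring_scope.

(* R^d is 'rV[R]_d; the library gives it its (sup) norm and topology, and we
   add the product (= Borel) sigma-algebra. *)
Definition measure_rV_display : measure_display.
Proof. exact: default_measure_display. Qed.

Section measurable_rV.
Context (R : realType) (d : nat).

Let coors : 'I_d -> 'rV[R]_d -> R := fun i x => x 0 i.

Let rV_set0 : g_sigma_preimage coors set0.
Proof. exact: sigma_algebra0. Qed.

Let rV_setC A : g_sigma_preimage coors A -> g_sigma_preimage coors (~` A).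
Proof. exact: sigma_algebraC. Qed.

Let rV_bigcup (F : (set 'rV[R]_d)^nat) :
  (forall i, g_sigma_preimage coors (F i)) ->
  g_sigma_preimage coors (\bigcup_i (F i)).
Proof. exact: sigma_algebra_bigcup. Qed.

HB.instance Definition _ :=
  @isMeasurable.Build measure_rV_display
    'rV[R]_d (g_sigma_preimage coors) rV_set0 rV_setC rV_bigcup.

Lemma measurable_coord (i : 'I_d) :
  measurable_fun [set: 'rV[R]_d] (fun x : 'rV[R]_d => x 0 i).
Proof.
move=> _ Y mY; rewrite setTI; apply: sub_sigma_algebra => /=.
rewrite -bigcup_seq/=; exists i => /=; first by rewrite mem_index_enum.
by exists Y => //; rewrite setTI.
Qed.

Lemma measurable_rVP d1 (T1 : measurableType d1) (f : T1 -> 'rV[R]_d) :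
  (forall i, measurable_fun [set: T1] (fun x => f x 0 i)) ->
  measurable_fun [set: T1] f.
Proof.
move=> mf.
suff prefS : g_sigma_preimage (fun i x => f x 0 i) `<=` measurable.
  move=> _ A mA; apply: prefS.
  rewrite -[X in g_sigma_preimage X]/(fun i => coors i \o f).
  by rewrite g_sigma_preimage_comp; exists A.
apply: smallest_sub; first exact: sigma_algebra_measurable.
move=> A; rewrite -bigcup_seq/= => -[i _ [Y mY <-]].
exact: mf.
Qed.

End measurable_rV.

Section lebesgue_rV.
Context (R : realType).

Definition cons_rV d (p : R * 'rV[R]_d) : 'rV[R]_d.+1 :=
  row_mx (const_mx p.1 : 'rV_1) p.2.

Lemma measurable_cons_rV d : measurable_fun setT (@cons_rV d).
Proof.
apply: measurable_rVP => i.
case: (split_ordP (i : 'I_(1 + d))) => j ->.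
  rewrite (_ : (fun _ => _) = fst) //; apply/funext => p.
  by apply: etrans (row_mxEl _ _ _ _) _; rewrite mxE.
rewrite (_ : (fun _ => _) = (fun x : 'rV[R]_d => x 0 j) \o snd); last first.
  by apply/funext => p; exact: row_mxEr.
exact: measurableT_comp (measurable_coord j) _.
Qed.

HB.instance Definition _ d :=
  @isMeasurableFun.Build _ _ _ _ (@cons_rV d) (@measurable_cons_rV d).

Section prod_lebesgue.
Context (d : nat) (mu : {measure set 'rV[R]_d -> \bar R}).

Definition prod_lebesgue : set 'rV[R]_d.+1 -> \bar R :=
  pushforward ((@lebesgue_measure R) \x^ mu)%E (@cons_rV d).

Let prod_lebesgue0 : prod_lebesgue set0 = 0%E.
Proof. by apply: measure0; exact: measurable_cons_rV. Qed.

Let prod_lebesgue_ge0 A : (0 <= prod_lebesgue A)%E.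
Proof. by apply: measure_ge0; exact: measurable_cons_rV. Qed.

Let prod_lebesgue_sigma_additive : semi_sigma_additive prod_lebesgue.
Proof.
by apply: measure_semi_sigma_additive; exact: measurable_cons_rV.
Qed.

HB.instance Definition _ := isMeasure.Build _ _ _ prod_lebesgue
  prod_lebesgue0 prod_lebesgue_ge0 prod_lebesgue_sigma_additive.

End prod_lebesgue.

(* d-dimensional Lebesgue measure, as an iterated product. *)
Fixpoint lebesgue_rV (d : nat) : {measure set 'rV[R]_d -> \bar R} :=
  match d with
  | 0 => dirac (0 : 'rV[R]_0)
  | d'.+1 => prod_lebesgue (lebesgue_rV d')
  end.

End lebesgue_rV.
Arguments lebesgue_rV : clear implicits.

Section boxes.
Context (R : realType).

Definition rect d (A : 'I_d -> set R) : set 'rV[R]_d :=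
  [set x | forall i, A i (x 0 i)].

Lemma measurable_rect d (A : 'I_d -> set R) :
  (forall i, measurable (A i)) -> measurable (rect A).
Proof.
move=> mA.
rewrite (_ : rect A =
    \big[setI/setT]_(i < d) ((fun x : 'rV[R]_d => x 0 i) @^-1` A i)).
  apply: bigsetI_measurable => i _.
  by rewrite -[_ @^-1` _]setTI; exact: measurable_coord.
apply/seteqP; split => x.
  by move=> Ax; elim/big_ind : _ => //= i _; exact: Ax.
rewrite -bigcap_seq => Ax i; apply: (Ax i).
by rewrite /= mem_index_enum.
Qed.

Lemma lebesgue_rV_rect d (A : 'I_d -> set R) :
  (forall i, measurable (A i)) ->
  (lebesgue_rV R d (rect A) = \prod_(i < d) (@lebesgue_measure R) (A i))%E.
Proof.
elim: d A => [|d IH] A mA.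
  by rewrite big_ord0 /= diracE mem_set// => -[].
rewrite big_ord_recl /= /prod_lebesgue /pushforward.
rewrite (_ : _ @^-1` _ = A ord0 `*` rect (fun i => A (lift ord0 i))).
  rewrite product_measure2E; [|exact: mA|exact: measurable_rect].
  by rewrite IH.
have E0 (p : R * 'rV[R]_d) : cons_rV p 0 ord0 = p.1.
  rewrite (_ : ord0 = lshift d (ord0 : 'I_1)); last exact/val_inj.
  by apply: etrans (row_mxEl _ _ _ _) _; rewrite mxE.
have ES (p : R * 'rV[R]_d) i : cons_rV p 0 (lift ord0 i) = p.2 0 i.
  rewrite (_ : lift ord0 i = rshift 1 i); last exact/val_inj.
  exact: row_mxEr.
apply/seteqP; split => -[t x] /=.
  move=> Ap; split => [|i]; first by have := Ap ord0; rewrite E0.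
  by have := Ap (lift ord0 i); rewrite ES.
move=> [At Ax] i; case: (unliftP ord0 i) => [j|] ->.
  by rewrite ES; exact: Ax.
by rewrite E0.
Qed.

End boxes.

Section domains.
Context (R : realType) (d : nat).
Local Notation Rd := 'rV[R]_d.

(* A set of representatives of T^d = R^d / Z^d. *)
Definition unit_cell : set Rd := rect (fun=> `[0, 1[%classic).

Definition cube (a b : R) : set Rd := rect (fun=> `[a, b]%classic).

Lemma measurable_unit_cell : measurable unit_cell.
Proof. exact: measurable_rect. Qed.

Lemma measurable_cube a b : measurable (cube a b).
Proof. exact: measurable_rect. Qed.

(* The normalized Lebesgue measure m of X is carried by the ambient R^d: a
   function on X is a function on R^d whose values off X are irrelevant, since
   the complement of X is m-null. *)
Definition m_torus : {measure set Rd -> \bar R} :=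
  mrestr (lebesgue_rV R d) measurable_unit_cell.

(* Used for a < b only, where |b - a| is the length of [a, b]. *)
Definition m_cube a b : {measure set Rd -> \bar R} :=
  mscale (`|b - a|^-1 ^+ d)%:nng (mrestr (lebesgue_rV R d) (measurable_cube a b)).

Definition int_vec : set Rd := [set z | forall i, z 0 i \is a Num.int].

Definition eqmodZ (x y : Rd) : Prop := int_vec (x - y).

(* Functions on T^d are Z^d-periodic functions on R^d. *)
Definition periodic (T : Type) (h : Rd -> T) : Prop :=
  forall x z, int_vec z -> h (x + z) = h x.

Definition dot (u v : Rd) : R := \sum_(i < d) u 0 i * v 0 i.

Definition mod_real (s p : R) : R := s - p * (Num.floor (s / p))%:~R.

Definition reflect1 (a b s : R) : R :=
  a + (b - a) - `|mod_real (s - a) (2 * (b - a)) - (b - a)|.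

Definition reflection (a b : R) (x : Rd) : Rd :=
  \row_i reflect1 a b (x 0 i).

End domains.
Arguments unit_cell : clear implicits.
Arguments cube {R} d a b.
Arguments m_torus : clear implicits.
Arguments m_cube {R} d a b.

Section sobolev.
Context (R : realType) (d : nat).
Local Notation Rd := 'rV[R]_d.

Definition L1fun (m : {measure set Rd -> \bar R}) (v : Rd -> R) : Prop :=
  m.-integrable setT (EFin \o v).

Definition partial (i : 'I_d) (phi : Rd -> R) : Rd -> R :=
  fun x => 'D_(delta_mx 0 i) phi x.

Definition smooth (phi : Rd -> R) : Prop :=
  forall s : seq 'I_d,
    continuous (foldr partial phi s) /\
    forall i x, derivable (foldr partial phi s) x (delta_mx 0 i).

Definition compactly_supported (phi : Rd -> R) : Prop :=
  exists2 K : set Rd, compact K & forall x, ~ K x -> phi x = 0.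

(* [dq] is a weak gradient of [q] against the test functions [test]; [m] is
   Lebesgue measure on R^d, respectively on a cell of T^d. *)
Definition weak_gradient (m : {measure set Rd -> \bar R})
    (test : set (Rd -> R)) (q : Rd -> R) (dq : Rd -> Rd) : Prop :=
  forall phi, test phi -> forall i,
    \int[m]_x (q x * partial i phi x) = - \int[m]_x (dq x 0 i * phi x).

(* q \in W^{1,1}(R^d), with (a representative of) its gradient dq *)
Definition W11 (q : Rd -> R) (dq : Rd -> Rd) : Prop :=
  [/\ L1fun (lebesgue_rV R d) q,
      measurable_fun setT dq,
      forall i, L1fun (lebesgue_rV R d) (fun x => dq x 0 i) &
      weak_gradient (lebesgue_rV R d)
        [set phi | smooth phi /\ compactly_supported phi] q dq].

(* q \in W^{1,1}(T^d), with (a representative of) its gradient dq *)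
Definition W11_torus (q : Rd -> R) (dq : Rd -> Rd) : Prop :=
  [/\ periodic q /\ periodic dq,
      measurable_fun setT q /\ L1fun (m_torus R d) q,
      measurable_fun setT dq,
      forall i, L1fun (m_torus R d) (fun x => dq x 0 i) &
      weak_gradient (m_torus R d)
        [set phi | smooth phi /\ periodic phi] q dq].

End sobolev.

Section norms.
Context (R : realType) (d : nat) (m : {measure set 'rV[R]_d -> \bar R}).
Local Notation Rd := 'rV[R]_d.
Local Open Scope ereal_scope.

Definition L1norm (v : Rd -> R) : \bar R := 'N[m]_1[EFin \o v].

Definition Linfnorm (u : Rd -> Rd) : \bar R :=
  'N[m]_+oo[(EFin \o (fun x => `|u x|%R))].

Definition sup_over (I : Type) (F : I -> \bar R) : \bar R :=
  ereal_sup (range F).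

Definition L1opnorm (T : (Rd -> R) -> (Rd -> R)) : \bar R :=
  ereal_sup [set L1norm (T v) | v in [set v | L1fun m v /\ L1norm v <= 1]].

Definition prob_density (v : Rd -> R) : Prop :=
  [/\ L1fun m v, {ae m, forall x, (0 <= v x)%R} & (\int[m]_x v x = 1)%R].

End norms.

Section kernels.
Context (R : realType) (d : nat) (m : {measure set 'rV[R]_d -> \bar R}).
Local Notation Rd := 'rV[R]_d.

(* p is the density with respect to m of the push-forward under [rho] of the
   signed measure h(x) dx on R^d *)
Definition pushforward_density (rho : Rd -> Rd) (h p : Rd -> R) : Prop :=
  L1fun m p /\
  forall A : set Rd, measurable A ->
    \int[m]_(y in A) p y = \int[lebesgue_rV R d]_(x in rho @^-1` A) h x.

(* For each single z \in K the essential infimum over y is taken, so that the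
   condition 0 < alpha is meaningful even when K is Lebesgue-negligible. *)
Definition reflected_alpha (a b : R) (K : set Rd) (q : Rd -> R) : \bar R :=
  (((b - a) ^+ d)%:E *
   ereal_inf [set ess_inf (m_cube d a b) (fun y => (q (y - z)%R)%:E) | z in K])%E.

(* A kernel k z y, read as the curve z |-> k z of L^1(X, m), is of class C^1
   with Frechet derivative D z u at z in the direction u. *)
Definition L1_C1 (k : Rd -> Rd -> R) (D : Rd -> Rd -> Rd -> R) : Prop :=
  [/\ forall z, L1fun m (k z),
      forall z u, L1fun m (D z u),
      forall z (c : R) u v,
        {ae m, forall y, D z (c *: u + v) y = c * D z u y + D z v y},
      forall z : Rd,
        ((`|h|^-1)%:E * L1norm m (fun y => k (z + h) y - k z y - D z h y)%R)%E
          @[h --> (0 : Rd)^'] --> 0%E &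
      forall z : Rd,
        ereal_sup [set L1norm m (fun y => D z' u y - D z u y)
                  | u in [set u : Rd | `|u| <= 1]]
          @[z' --> z] --> 0%E].

Definition transfer (k : Rd -> Rd -> R) (F : Rd -> Rd) (phi : Rd -> R) : Rd -> R :=
  fun y => \int[m]_x (phi x * k (F x) y).

Definition transfer_dot (D : Rd -> Rd -> Rd -> R) (F Fdot : Rd -> Rd)
    (phi : Rd -> R) : Rd -> R :=
  fun y => \int[m]_x (phi x * D (F x) (Fdot x) y).

(* [cocycle L n j] is L_{n-1} L_{n-2} ... L_{n-j}. *)
Fixpoint cocycle (L : int -> (Rd -> R) -> (Rd -> R)) (n : int) (j : nat)
    (v : Rd -> R) : Rd -> R :=
  if j is j'.+1 then cocycle L n j' (L (n - j%:Z) v) else v.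

End kernels.

Section system.
Context (R : realType) (d : nat) (m : {measure set 'rV[R]_d -> \bar R}).
Local Notation Rd := 'rV[R]_d.

(* f^e_n = f^0_n + e fdot_n + r^e_n on X, for the equality [eqv] (equality in
   R^d, or modulo Z^d) *)
Definition uniformly_differentiable (X : set Rd) (eqv : Rd -> Rd -> Prop)
    (e0 : R) (f : int -> R -> Rd -> Rd) (fdot : int -> Rd -> Rd)
    (r : int -> R -> Rd -> Rd) : Prop :=
  [/\ forall n, measurable_fun setT (fdot n),
      forall n (e : R), 0 <= e < e0 -> measurable_fun setT (r n e),
      forall n (e : R) x, 0 <= e < e0 -> X x ->
        eqv (f n e x) (f n 0 x + e *: fdot n x + r n e x),
      (sup_over (fun n => Linfnorm m (fdot n)) < +oo)%E &
      (sup_over (fun n => (`|e|^-1)%:E * Linfnorm m (r n e))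
        @[e --> (0 : R)^'+] --> 0)%E].

Context (k : Rd -> Rd -> R) (D : Rd -> Rd -> Rd -> R).
Context (f : int -> R -> Rd -> Rd) (fdot : int -> Rd -> Rd).

Definition Lop (e : R) (n : int) : (Rd -> R) -> (Rd -> R) :=
  transfer m k (f n e).

Definition response_source (mu : R -> int -> Rd -> R) (n : int) : Rd -> R :=
  transfer_dot m D (f n 0) (fdot n) (mu 0 n).

Definition part_a (e1 : R) (mu : R -> int -> Rd -> R) : Prop :=
  let L := Lop in let g := response_source mu in
  [/\ forall n (e : R), 0 <= e < e1 -> forall phi, L1fun m phi ->
        [/\ L1fun m (L e n phi),
            {ae m, forall x, 0 <= phi x} -> {ae m, forall y, 0 <= L e n phi y},
            \int[m]_y L e n phi y = \int[m]_x phi x &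
            (L1norm m (L e n phi) <= L1norm m phi)%E],
      (forall n (e : R), 0 <= e < e1 ->
        prob_density m (mu e n) /\
        {ae m, forall y, mu e (n + 1) y = L e n (mu e n) y}) /\
      (exists B : R, forall n (e : R), 0 <= e < e1 -> (L1norm m (mu e n) <= B%:E)%E),
      (exists C rho : R, [/\ 1 <= C, 0 < rho < 1 &
        forall (n l : int) (e : R) v, l < n -> 0 <= e < e1 ->
          L1fun m v -> \int[m]_x v x = 0 ->
          (L1norm m (cocycle (L e) n `|n - l|%N v)
             <= (C * rho ^+ `|n - l|%N)%:E * L1norm m v)%E]),
      (forall n, L1fun m (g n)) /\
      (sup_over (fun n => L1norm m (g n)) < +oo)%E &
      (sup_over (fun n => L1norm m (fun y =>
          e^-1 * (L e n (mu 0 n) y - L 0 n (mu 0 n) y) - g n y)%R)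
        @[e --> (0 : R)^'+] --> 0)%E /\
      (sup_over (fun n => L1opnorm m (fun phi y => L e n phi y - L 0 n phi y)%R)
        @[e --> (0 : R)^'+] --> 0)%E].

Definition part_b (mu : R -> int -> Rd -> R) : Prop :=
  let g := response_source mu in
  let term (n : int) (j : nat) := cocycle (Lop 0) n j (g (n - j%:Z - 1)) in
  exists eta : int -> Rd -> R,
  [/\ (forall n, L1fun m (eta n)) /\
      (sup_over (fun n => L1norm m (eta n)) < +oo)%E,
      (sup_over (fun n => L1norm m (fun x =>
          e^-1 * (mu e n x - mu 0 n x) - eta n x)%R)
        @[e --> (0 : R)^'+] --> 0)%E,
      forall n,
        (L1norm m (fun x =>
            eta n x - (g (n - 1) x + \sum_(1 <= j < J.+1) term n j x))%R
          @[J --> \oo] --> 0)%E,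
      forall n j, L1fun m (term n j) &
      (forall n, (\sum_(1 <= j <oo) L1norm m (term n j) < +oo)%E) /\
      (sup_over (fun n => \sum_(J <= j <oo) L1norm m (term n j))
        @[J --> \oo] --> 0)%E].

(* z |-> k z is of class C^1 in L^1 with derivative D; (a) and (b) hold, for
   the same family of densities, on an interval [0, e1[. *)
Definition linear_response (e0 : R) : Prop :=
  L1_C1 m k D /\
  exists e1 : R, 0 < e1 <= e0 /\
  exists mu : R -> int -> Rd -> R, part_a e1 mu /\ part_b mu.

End system.

(* Main.v *)
From HB Require Import structures.
Require Import Defs.
From mathcomp Require Import all_boot all_order all_algebra.
From mathcomp Require Import all_classical all_reals all_analysis.
From mathcomp Require Import ess_sup_inf measurable_realfun.
From mathcomp Require Import ring lra.

Set Implicit Arguments.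
Unset Strict Implicit.
Unset Printing Implicit Defensive.

Import Order.TTheory GRing.Theory Num.Theory.
Import numFieldTopology.Exports numFieldNormedType.Exports.

Local Open Scope classical_set_scope.
Local Open Scope ring_scope.

(** Everything rests on one kernel-level fact: z |-> k z is a C^1 curve in L^1, with
estimates that do not depend on the base point z, and k z is bounded below by a
positive constant for every z that the maps reach.

Mixing.  A Markov kernel bounded below by alpha acts on functions of mean zero like
the kernel lowered by alpha, which is nonnegative and of mass 1 - alpha
([markov_contract]).  So cocycles contract mean-zero functions by (1 - alpha)^j,
uniformly in the time n and the parameter e.  The equivariant densities are the
limits of L_(n-1) ... L_(n-j) 1, a sequence whose increments are geometrically small
([exists_equivariant_limit]).

Response.  The source g_n has mean zero, because all kernels have mass one
([delta_Rint]); hence the series defining eta_n converges geometrically, and its sum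
satisfies eta_(n+1) = L_n eta_n + g_n.  Subtracting the equivariance relations shows
that the error of the difference quotient obeys a recursion with contraction factor
1 - alpha and a forcing term that tends to 0 uniformly in n
([difference_quotient_step]).  The error is bounded in n for fixed e, so iterating
the recursion bounds it by the forcing divided by alpha ([response_limit]).

Regularity of the noise.  For q in W^{1,1}, the remainder
q(x - h) - q(x) + h . dq(x) is paired with a test function phi.  The function
t |-> int q(x) phi(x + t h) dx is differentiable, the definition of the weak gradient
turns its derivative into an integral of dq, and the mean value theorem bounds the
pairing by translation differences of dq ([first_order_pairing]).  Translations are
continuous in L^1 because test functions are dense, and the L^1 norm is the supremum
over test functions bounded by 1; this gives o(|h|) in norm
([first_order_remainder]).  All this needs only translation invariance and enough
test functions, which Lebesgue measure on R^d and a fundamental cell of the torus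
have in common ([translation_setting]).

Reflection.  Passing to densities of push-forwards does not increase L^1 norms
([pushforward_nrm]), so the estimates for the translates of q are inherited by the
reflected kernel.  The lower bound is inherited because the reflection is the
identity on the cube ([pushforward_ge]). *)


(** * Integrable real functions and their L1 norm *)

Section L1_toolkit.
Context d (T : measurableType d) (R : realType) (m : {measure set T -> \bar R}).
Implicit Types f g h : T -> R.

Local Notation integ f := (m.-integrable setT (EFin \o f)).

(** Junk value 0 when the integral of |f| is infinite, whence the integrability hypotheses in the
lemmas on [nrm]. *)
Definition nrm f : R := \int[m]_x `|f x|.

Lemma ae_and (P Q : T -> Prop) : {ae m, forall x, P x} -> {ae m, forall x, Q x} ->
  {ae m, forall x, P x /\ Q x}.
Proof. exact: filterS2. Qed.

Lemma integ_measurable f : integ f -> measurable_fun setT f.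
Proof. by move=> /measurable_int/measurable_EFinP. Qed.

Lemma integD f g : integ f -> integ g -> integ (fun x => f x + g x).
Proof. by move=> If Ig; have := integrableD measurableT If Ig. Qed.

Lemma integB f g : integ f -> integ g -> integ (fun x => f x - g x).
Proof. by move=> If Ig; have := integrableB measurableT If Ig. Qed.

Lemma integZ c f : integ f -> integ (fun x => c * f x).
Proof. by move=> If; have := integrableZl measurableT c If. Qed.

Lemma integN f : integ f -> integ (fun x => - f x).
Proof. by move=> If; have := integrableN If. Qed.

Lemma integ0 : integ (fun=> 0).
Proof. exact: integrable0. Qed.

Lemma integ_sum (I : Type) (s : seq I) (F : I -> T -> R) :
  (forall i, integ (F i)) -> integ (fun x => \sum_(i <- s) F i x).
Proof.
move=> IF; elim: s => [|i s IH].
  by under [X in _ \o X]funext do rewrite big_nil; exact: integ0.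
by under [X in _ \o X]funext do rewrite big_cons; exact: integD.
Qed.

Lemma Rintegral_sum (I : Type) (s : seq I) (F : I -> T -> R) :
  (forall i, integ (F i)) ->
  \int[m]_x (\sum_(i <- s) F i x) = \sum_(i <- s) \int[m]_x F i x.
Proof.
move=> IF; elim: s => [|i s IH].
  by rewrite big_nil; under eq_Rintegral do rewrite big_nil; rewrite Rintegral_cst// mul0r.
rewrite big_cons -IH -RintegralD//; last exact: integ_sum.
by apply: eq_Rintegral => x _; rewrite big_cons.
Qed.

Lemma integ_abs f : integ f -> integ (fun x => `|f x|).
Proof. by move=> /integrable_norm. Qed.

Lemma ae_le_integ f g : measurable_fun setT f -> integ g ->
  {ae m, forall x, `|f x| <= g x} -> integ f.
Proof.
move=> mf Ig fg; apply/integrableP; split; first exact/measurable_EFinP.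
have /integrableP[mg goo] := integ_abs Ig.
refine (le_lt_trans _ goo); apply: ae_ge0_le_integral => //=.
- exact/measurable_EFinP/measurableT_comp.
- by apply/measurable_EFinP/measurableT_comp => //; move/measurable_EFinP: mg.
- apply: filterS fg => x fg _; rewrite lee_fin.
  by rewrite normr_id (le_trans fg)// ler_norm.
Qed.

Lemma ae_integ f g : measurable_fun setT f -> integ g ->
  {ae m, forall x, f x = g x} -> integ f.
Proof.
move=> mf Ig fg; apply: (ae_le_integ mf (integ_abs Ig)).
by apply: filterS fg => x ->.
Qed.

Lemma integ_bounded f g (B : R) : integ f -> measurable_fun setT g ->
  (forall x, `|g x| <= B) -> integ (fun x => f x * g x).
Proof.
move=> If mg gB.
have mf := integ_measurable If.
apply: (@ae_le_integ _ (fun x => B * `|f x|)).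
- exact: measurable_funM.
- exact/integZ/integ_abs.
- by apply/aeW => x; rewrite normrM mulrC ler_wpM2r.
Qed.

Lemma ae_eq_Rint f g : measurable_fun setT f -> measurable_fun setT g ->
  {ae m, forall x, f x = g x} -> \int[m]_x f x = \int[m]_x g x.
Proof.
move=> mf mg fg; congr fine; apply: ae_eq_integral => //=; try exact/measurable_EFinP.
by apply: filterS fg => x -> _.
Qed.

Lemma ae_ge0_Rint f : integ f -> {ae m, forall x, 0 <= f x} -> 0 <= \int[m]_x f x.
Proof.
move=> If f0; have mf := integ_measurable If.
rewrite (@ae_eq_Rint f (fun x => `|f x|)) //.
- by apply: Rintegral_ge0.
- exact: measurableT_comp.
- by apply: filterS f0 => x /ger0_norm.
Qed.

Lemma ae_le_Rint f g : integ f -> integ g -> {ae m, forall x, f x <= g x} ->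
  \int[m]_x f x <= \int[m]_x g x.
Proof.
move=> If Ig fg; rewrite -subr_ge0 -RintegralB//.
apply: ae_ge0_Rint; first exact: integB.
by apply: filterS fg => x; rewrite subr_ge0.
Qed.

Lemma EFin_nrm f : integ f -> (nrm f)%:E = (\int[m]_x `|(f x)%:E|)%E.
Proof.
move=> If; rewrite /nrm /Rintegral fineK //.
by apply: integrable_fin_num => //; exact: integ_abs.
Qed.

Lemma nrm_ge0 f : 0 <= nrm f.
Proof. exact: Rintegral_ge0. Qed.

Lemma ae_le_nrm f g : integ f -> integ g ->
  {ae m, forall x, `|f x| <= `|g x|} -> nrm f <= nrm g.
Proof. by move=> If Ig fg; apply: ae_le_Rint => //; exact: integ_abs. Qed.

Lemma ae_eq_nrm f g : integ f -> integ g ->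
  {ae m, forall x, f x = g x} -> nrm f = nrm g.
Proof.
move=> /integ_measurable mf /integ_measurable mg fg.
apply: ae_eq_Rint; try exact: measurableT_comp.
by apply: filterS fg => x ->.
Qed.

Lemma nrmD f g : integ f -> integ g -> nrm (fun x => f x + g x) <= nrm f + nrm g.
Proof.
move=> If Ig; rewrite /nrm -RintegralD//; [|exact: integ_abs..].
apply: ae_le_Rint; [exact/integ_abs/integD|apply: integD; exact: integ_abs|].
by apply/aeW => x; exact: ler_normD.
Qed.

Lemma nrmZ c f : integ f -> nrm (fun x => c * f x) = `|c| * nrm f.
Proof.
move=> If; rewrite /nrm -RintegralZl//; last exact: integ_abs.
by apply: eq_Rintegral => x _; rewrite normrM.
Qed.

Lemma nrmN f : nrm (fun x => - f x) = nrm f.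
Proof. by apply: eq_Rintegral => x _; rewrite normrN. Qed.

Lemma nrmB f g : integ f -> integ g -> nrm (fun x => f x - g x) <= nrm f + nrm g.
Proof.
by move=> If Ig; rewrite -[X in _ <= _ + X]nrmN; apply: nrmD => //; exact: integN.
Qed.

Lemma nrm_distC f g : nrm (fun x => f x - g x) = nrm (fun x => g x - f x).
Proof. by apply: eq_Rintegral => x _; rewrite distrC. Qed.

Lemma nrm_sum (I : Type) (s : seq I) (F : I -> T -> R) :
  (forall i, integ (F i)) ->
  nrm (fun x => \sum_(i <- s) F i x) <= \sum_(i <- s) nrm (F i).
Proof.
move=> IF; elim: s => [|i s IH].
  rewrite big_nil /nrm; under eq_Rintegral do rewrite big_nil normr0.
  by rewrite Rintegral_cst// mul0r.
rewrite big_cons; under [X in nrm X]funext do rewrite big_cons.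
by rewrite (le_trans (nrmD (IF i) (integ_sum _ _)))// lerD2l.
Qed.

Lemma nrm0 : nrm (fun=> 0) = 0.
Proof. by rewrite /nrm; under eq_Rintegral do rewrite normr0; rewrite Rintegral_cst// mul0r. Qed.

Lemma nrm_tri g f h : integ f -> integ g -> integ h ->
  nrm (fun x => f x - h x) <= nrm (fun x => f x - g x) + nrm (fun x => g x - h x).
Proof.
move=> If Ig Ih; rewrite (_ : (fun x => f x - h x) =
  (fun x => (f x - g x) + (g x - h x))); last by apply/funext => x; ring.
by apply: nrmD; exact: integB.
Qed.

Lemma nrm_eq0_ae f : integ f -> nrm f = 0 -> {ae m, forall x, f x = 0}.
Proof.
move=> If f0; have := EFin_nrm If; rewrite f0 => /esym.
move=> /(ae_eq_integral_abs m measurableT (measurable_int m If)).1.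
by apply: filterS => x /(_ Logic.I) /= [].
Qed.

Lemma ae_eq_nrm_le f g : integ f -> integ g -> nrm (fun x => f x - g x) <= 0 ->
  {ae m, forall x, f x = g x}.
Proof.
move=> If Ig fg; have I := integB If Ig.
have /(nrm_eq0_ae I) : nrm (fun x => f x - g x) = 0.
  by apply/eqP; rewrite eq_le fg nrm_ge0.
by apply: filterS => x /eqP; rewrite subr_eq0 => /eqP.
Qed.

Lemma normr_Rint_le f : integ f -> `|\int[m]_x f x| <= nrm f.
Proof. by move=> If; apply: le_normr_Rintegral. Qed.

End L1_toolkit.
Notation integ m f := (m.-integrable setT (EFin \o f)).

(** * Sequences with geometrically small increments *)

Section L1_complete.
Context d (T : measurableType d) (R : realType) (m : {measure set T -> \bar R}).

Lemma geometric_partial_sum_le (C rho : R) a b : 0 <= C -> 0 <= rho < 1 ->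
  \sum_(a <= i < b) C * rho ^+ i <= C * rho ^+ a / (1 - rho).
Proof.
move=> C0 /andP[r0 r1].
have r1' : 0 < 1 - rho by rewrite subr_gt0.
have [ba|/ltnW ab] := leqP b a.
  rewrite big_geq//; apply: divr_ge0; last exact: ltW.
  by rewrite mulr_ge0// exprn_ge0.
rewrite ler_pdivlMr//.
suff -> : (\sum_(a <= i < b) C * rho ^+ i) * (1 - rho) = C * rho ^+ a - C * rho ^+ b.
  by rewrite lerBlDr lerDl mulr_ge0// exprn_ge0.
elim: b ab => [|b IH].
  by rewrite leqn0 => /eqP ->; rewrite big_geq// mul0r subrr.
rewrite leq_eqVlt => /predU1P[->|ab]; first by rewrite big_geq// mul0r subrr.
by rewrite big_nat_recr//= mulrDl IH// exprS; ring.
Qed.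

Lemma geometric_cvg0 (C rho : R) : 0 <= rho < 1 ->
  C * rho ^+ N @[N --> \oo] --> 0.
Proof.
move=> /andP[r0 r1]; have := @cvg_geometric R C rho.
by rewrite ger0_norm//; apply.
Qed.

(** A sequence whose consecutive L1 distances are geometrically small converges
almost everywhere, being dominated by the sum of the absolute increments. *)
Lemma L1_geometric_limit (u : nat -> T -> R) (C rho : R) :
  0 <= C -> 0 <= rho < 1 -> (forall N, integ m (u N)) ->
  (forall N, nrm m (fun x => u N.+1 x - u N x) <= C * rho ^+ N) ->
  exists2 w, integ m w &
    forall N, nrm m (fun x => u N x - w x) <= C * rho ^+ N / (1 - rho).
Proof.
move=> C0 rho01 Iu uC.
have mu N := integ_measurable (Iu N).
pose v N x : R := `|u N.+1 x - u N x|.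
have Iv N : integ m (v N) by apply/integ_abs/integB.
have v0 N x : (0 <= (v N x)%:E)%E by rewrite lee_fin /v.
pose S x : \bar R := (\sum_(N <oo) (v N x)%:E)%E.
have S0 x : (0 <= S x)%E by apply: nneseries_ge0 => n _ _.
have mS : measurable_fun setT S.
  apply: (@ge0_emeasurable_sum _ _ _ _ _ xpredT) => /=.
    by [].
  by move=> k _; exact: measurable_int (Iv k).
have IS : m.-integrable setT S.
  apply/integrableP; split => //.
  under eq_integral do rewrite gee0_abs//.
  rewrite integral_nneseries//; last by move=> n; exact: measurable_int (Iv n).
  apply: (@le_lt_trans _ _ (C * rho ^+ 0 / (1 - rho))%:E); last exact: ltry.
  apply: lime_le.
    by apply: is_cvg_nneseries => n _ _; apply: integral_ge0.
  apply: nearW => n.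
  apply: (@le_trans _ _ (\sum_(0 <= i < n) (C * rho ^+ i)%:E)%E); last first.
    by rewrite sumEFin lee_fin; exact: geometric_partial_sum_le.
  by apply: lee_sum => i _; rewrite -EFin_nrm ?lee_fin//; exact: integB.
have aeS : {ae m, forall x, S x \is a fin_num}.
  by have := integrable_ae measurableT IS; apply: filterS => x; exact.
(* The limit superior is a measurable choice of the almost everywhere limit. *)
pose w x : R := fine (limn_esup (fun N => (u N x)%:E)).
have cvgw : {ae m, forall x, u N x @[N --> \oo] --> w x}.
  apply: filterS aeS => x Sx.
  suff /cvg_ex[/= l ul] : cvgn (u ^~ x).
    suff -> : w x = l by [].
    have ul' : (u N x)%:E @[N --> \oo] --> l%:E by apply: cvg_EFin ul; exact: nearW.
    rewrite /w is_cvg_limn_esupE; last by apply/cvg_ex; exists l%:E.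
    by rewrite (cvg_lim _ ul').
  have cs : cvgn (series (fun N => u N.+1 x - u N x)).
    apply: normed_cvg; apply: nondecreasing_is_cvgn.
      by apply: nondecreasing_series => i _ _ /=.
    exists (fine (S x)) => _ [n _ <-].
    rewrite -lee_fin fineK// /series /= -sumEFin.
    by apply: nneseries_lim_ge => i _ _; exact: v0.
  have -> : u ^~ x = (fun N => u 0 x + series (fun N => u N.+1 x - u N x) N).
    apply/funext => N; rewrite /series /= telescope_sumr//.
    by rewrite addrC subrK.
  by apply: is_cvgD => //; exact: is_cvg_cst.
have mw : measurable_fun setT w.
  apply: measurableT_comp => //.
  by apply: measurable_fun_limn_esup => n; exact/measurable_EFinP.
have dom : {ae m, forall x n, setT x -> (`|(u n x)%:E| <= (`|u 0 x|)%:E + S x)%E}.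
  apply: filterS aeS => x Sx n _; rewrite -(fineK Sx) -EFinD lee_fin.
  have -> : u n x = u 0 x + \sum_(0 <= i < n) (u i.+1 x - u i x).
    by rewrite (telescope_sumr (u ^~ x))// addrC subrK.
  rewrite (le_trans (ler_normD _ _))// lerD2l (le_trans (ler_norm_sum _ _ _))//.
  rewrite -lee_fin fineK// -sumEFin.
  by apply: nneseries_lim_ge => i _ _; exact: v0.
have cvw : {ae m, forall x, setT x -> (u N x)%:E @[N --> \oo] --> (EFin \o w) x}.
  by apply: filterS cvgw => x ux _; apply: cvg_EFin ux; exact: nearW.
have mw' : measurable_fun setT (EFin \o w) by exact/measurable_EFinP.
have IG : m.-integrable setT (fun x => (`|u 0 x|)%:E + S x)%E.
  by apply: integrableD => //; exact: integ_abs.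
have [Iw cv _] := dominated_convergence measurableT
  (fun n => measurable_int _ (Iu n)) mw' cvw IG dom.
exists w => // N.
have cvn : nrm m (fun x => u M x - w x) @[M --> \oo] --> 0.
  rewrite (_ : (fun M => _) = (fun M => fine (\int[m]_x `|(u M x)%:E - (w x)%:E|)%E)).
    exact: fine_cvg cv.
  by apply/funext => M; rewrite -[LHS]/(fine (nrm m _)%:E) EFin_nrm//; exact: integB.
(* Telescoping from N to M, then M to infinity. *)
have step M : (N <= M)%N ->
    nrm m (fun x => u N x - w x) <= C * rho ^+ N / (1 - rho) + nrm m (fun x => u M x - w x).
  move=> NM; rewrite (le_trans (nrm_tri (Iu N) (Iu M) Iw))// lerD2r.
  apply: le_trans (geometric_partial_sum_le N M C0 rho01).
  elim: M NM => [|M IH].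
    by rewrite leqn0 => /eqP ->; rewrite big_geq//; under eq_fun do rewrite subrr; rewrite nrm0.
  rewrite leq_eqVlt => /predU1P[->|NM].
    by rewrite big_geq//; under eq_fun do rewrite subrr; rewrite nrm0.
  rewrite big_nat_recr//= (le_trans (nrm_tri (Iu N) (Iu M) (Iu M.+1)))//.
  by rewrite lerD ?IH// nrm_distC.
apply/ler_addgt0Pr => e e0.
have [M0 _ HM0] : \forall M \near \oo, nrm m (fun x => u M x - w x) <= e.
  move/cvgr0_norm_le : cvn => /(_ _ e0); apply: filterS => M.
  by rewrite ger0_norm// nrm_ge0.
apply: (le_trans (step (maxn N M0) (leq_maxl _ _))); rewrite lerD2l.
exact/HM0/leq_maxr.
Qed.

End L1_complete.

(** * Integral operators on L1 *)

Section kernel_operator.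
Context d (T : measurableType d) (R : realType).
Variable m : {sigma_finite_measure set T -> \bar R}.
Implicit Types (kappa : T -> T -> R) (phi : T -> R).

(** [kernel_op] is the transfer operator of a kernel that is already composed with the
map: [kernel_op m (fun x y => k (F x) y)] is [transfer m k F]. *)
Definition kernel_op kappa phi : T -> R := fun y => \int[m]_x (phi x * kappa x y).

Definition kernel_bound kappa (B : R) :=
  {ae m, forall x, integ m (kappa x) /\ nrm m (kappa x) <= B}.

Variables (kappa : T -> T -> R) (phi : T -> R) (B : R).
Hypothesis B0 : 0 <= B.
Hypothesis mk : measurable_fun setT (fun p : T * T => kappa p.1 p.2).
Hypothesis kB : kernel_bound kappa B.
Hypothesis Iphi : integ m phi.

Let F (p : T * T) : \bar R := (phi p.1 * kappa p.1 p.2)%:E.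

Let mF : measurable_fun setT F.
Proof.
apply/measurable_EFinP; apply: measurable_funM => //.
exact: measurableT_comp (integ_measurable Iphi) _.
Qed.

Let abs_bound : (\int[m]_x \int[m]_y `|F (x, y)| <= (B * nrm m phi)%:E)%E.
Proof.
have Iphi' := integ_abs Iphi.
rewrite EFinM EFin_nrm//.
apply: (@le_trans _ _ (\int[m]_x (`|B * phi x|%R)%:E)%E); last first.
  rewrite -ge0_integralZl//; last first.
    exact: measurable_int Iphi'.
  by under [leLHS]eq_integral do rewrite normrM ger0_norm// EFinM.
apply: ae_ge0_le_integral => //=.
- by move=> x _; exact: integral_ge0.
- apply: (@measurable_fun_fubini_tonelli_F _ _ _ _ _ m (fun p => `|F p|%E)) => //.
  exact: measurableT_comp.
- exact: measurable_int (integ_abs (integZ B Iphi)).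
apply: filterS kB => x [Ik kxB] _.
rewrite /F /=; under eq_integral do rewrite normrM EFinM.
rewrite ge0_integralZl//; last exact: measurable_int (integ_abs Ik).
rewrite -(EFin_nrm Ik) -EFinM lee_fin normrM mulrC ler_wpM2r//.
by rewrite (le_trans kxB)// ler_norm.
Qed.

Let IF : (m \x m)%E.-integrable setT F.
Proof.
apply/integrable12ltyP => //; apply: le_lt_trans abs_bound (ltry _).
Qed.

Lemma kernel_op_ae_integ : {ae m, forall y, integ m (fun x => phi x * kappa x y)}.
Proof. exact: ae_integrable2 IF. Qed.

Let mT : measurable_fun setT (kernel_op kappa phi).
Proof. by apply: measurableT_comp => //; exact: measurable_fubini_G IF. Qed.

Let T_abs : (\int[m]_y `|(kernel_op kappa phi y)%:E| <= (B * nrm m phi)%:E)%E.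
Proof.
apply: le_trans abs_bound.
rewrite (fubini_tonelli (fun p => `|F p|%E))//; last exact: measurableT_comp.
apply: ae_ge0_le_integral => //=.
- by apply/measurable_EFinP/measurableT_comp.
- by move=> y _; exact: integral_ge0.
- apply: (@measurable_fun_fubini_tonelli_G _ _ _ _ _ m (fun p => `|F p|%E)) => //.
  exact: measurableT_comp.
apply: filterS kernel_op_ae_integ => y Iy _.
by rewrite -(EFin_nrm Iy) lee_fin; exact: normr_Rint_le.
Qed.

Lemma kernel_op_integ : integ m (kernel_op kappa phi).
Proof.
apply/integrableP; split; first exact/measurable_EFinP.
by apply: le_lt_trans T_abs (ltry _).
Qed.

Lemma kernel_op_nrm : nrm m (kernel_op kappa phi) <= B * nrm m phi.
Proof. by rewrite -lee_fin EFin_nrm//; exact: kernel_op_integ. Qed.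

(** Fubini. *)
Lemma kernel_op_Rint (c : R) :
  {ae m, forall x, \int[m]_y kappa x y = c} ->
  \int[m]_y kernel_op kappa phi y = c * \int[m]_x phi x.
Proof.
move=> kc.
have E : (\int[m]_x \int[m]_y F (x, y) = \int[m]_y \int[m]_x F (x, y))%E := Fubini IF.
rewrite -RintegralZl//.
rewrite /Rintegral; congr fine.
transitivity (\int[m]_y \int[m]_x F (x, y))%E.
  apply: ae_eq_integral => //; first exact: measurable_int kernel_op_integ.
    exact: measurable_fubini_G IF.
  apply: filterS kernel_op_ae_integ => y Iy _.
  by rewrite /kernel_op /Rintegral fineK//; exact: integrable_fin_num.
rewrite -E; apply: ae_eq_integral => //; first exact: measurable_fubini_F IF.
  exact: measurable_int (integZ _ Iphi).
apply: filterS2 kB kc => x [Ik _] <- _.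
rewrite /F /=; under eq_integral do rewrite EFinM.
by rewrite integralZl// [RHS]EFinM muleC /Rintegral fineK//; exact: integrable_fin_num.
Qed.

End kernel_operator.

Section kernel_operator_linear.
Context d (T : measurableType d) (R : realType).
Variable m : {sigma_finite_measure set T -> \bar R}.
Implicit Types (kappa : T -> T -> R) (phi : T -> R).

Lemma kernel_op_linear (kappa : T -> T -> R) (phi psi : T -> R) (c B : R) :
  measurable_fun setT (fun p : T * T => kappa p.1 p.2) ->
  0 <= B -> kernel_bound m kappa B -> integ m phi -> integ m psi ->
  {ae m, forall y, kernel_op m kappa (fun x => c * phi x + psi x) y =
     c * kernel_op m kappa phi y + kernel_op m kappa psi y}.
Proof.
move=> mk B0 kB I1 I2.
apply: filterS2 (kernel_op_ae_integ B0 mk kB I1) (kernel_op_ae_integ B0 mk kB I2) => y J1 J2.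
rewrite /kernel_op -RintegralZl// -RintegralD//; last exact: integZ.
by apply: eq_Rintegral => x _; ring.
Qed.

Lemma kernel_op_lin_kernel (k1 k2 : T -> T -> R) (phi : T -> R) (c B1 B2 : R) :
  measurable_fun setT (fun p : T * T => k1 p.1 p.2) ->
  measurable_fun setT (fun p : T * T => k2 p.1 p.2) ->
  0 <= B1 -> 0 <= B2 -> kernel_bound m k1 B1 -> kernel_bound m k2 B2 -> integ m phi ->
  {ae m, forall y, kernel_op m (fun x y => c * k1 x y + k2 x y) phi y =
     c * kernel_op m k1 phi y + kernel_op m k2 phi y}.
Proof.
move=> m1 m2 B10 B20 b1 b2 I.
apply: filterS2 (kernel_op_ae_integ B10 m1 b1 I) (kernel_op_ae_integ B20 m2 b2 I) => y J1 J2.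
rewrite /kernel_op -RintegralZl// -RintegralD//; last exact: integZ.
by apply: eq_Rintegral => x _; ring.
Qed.

End kernel_operator_linear.

(** * Markov kernels with a uniform lower bound *)

Section markov_operator.
Context d (T : measurableType d) (R : realType) (m : probability T R).
Implicit Types (kappa : T -> T -> R) (phi psi v : T -> R).

Definition doeblin (alpha : R) kappa :=
  measurable_fun setT (fun p : T * T => kappa p.1 p.2) /\
  {ae m, forall x, [/\ integ m (kappa x), \int[m]_y kappa x y = 1 &
                       {ae m, forall y, alpha <= kappa x y}]}.

Lemma integ_cst (c : R) : integ m (fun=> c).
Proof. exact: finite_measure_integrable_cst. Qed.

Lemma Rint_cst_probability (c : R) : \int[m]_x c = c.
Proof.
rewrite Rintegral_cst// -[RHS]mulr1; congr (_ * _).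
by rewrite -[RHS]/(fine 1%:E); congr fine; exact: probability_setT.
Qed.

Variables (alpha : R) (kappa : T -> T -> R).
Hypothesis alpha01 : 0 < alpha < 1.
Hypothesis dk : doeblin alpha kappa.

Local Notation L := (kernel_op m kappa).

Let mk : measurable_fun setT (fun p : T * T => kappa p.1 p.2) := dk.1.

Let nrm_pos (f : T -> R) : {ae m, forall x, 0 <= f x} -> integ m f ->
  nrm m f = \int[m]_x f x.
Proof.
move=> f0 If; have mf := integ_measurable If; apply: ae_eq_Rint => //.
  exact: measurableT_comp.
by apply: filterS f0 => x /ger0_norm.
Qed.

Lemma doeblin_bound : kernel_bound m kappa 1.
Proof.
have /andP[a0 _] := alpha01.
apply: filterS dk.2 => x [Ik k1 ka]; split => //.
rewrite nrm_pos ?k1//.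
by apply: filterS ka => y; apply: le_trans; exact: ltW.
Qed.

Lemma doeblin_bound_sub : kernel_bound m (fun x y => kappa x y - alpha) (1 - alpha).
Proof.
apply: filterS dk.2 => x [Ik k1 ka]; split; first exact/integB/integ_cst.
rewrite nrm_pos; last 2 first.
- by apply: filterS ka => y; rewrite subr_ge0.
- exact/integB/integ_cst.
by rewrite RintegralB ?k1 ?Rint_cst_probability//; exact: integ_cst.
Qed.

Lemma markov_integ phi : integ m phi -> integ m (L phi).
Proof. exact: kernel_op_integ mk doeblin_bound. Qed.

Lemma markov_nrm phi : integ m phi -> nrm m (L phi) <= nrm m phi.
Proof. by move=> I; have := kernel_op_nrm ler01 mk doeblin_bound I; rewrite mul1r. Qed.

Lemma markov_Rint phi : integ m phi -> \int[m]_y L phi y = \int[m]_x phi x.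
Proof.
move=> I; rewrite (kernel_op_Rint ler01 mk doeblin_bound I (c := 1)) ?mul1r//.
by apply: filterS dk.2 => x [].
Qed.

(** For phi >= 0 the chain int L phi = int phi = |phi| >= |L phi| forces
L phi = |L phi| almost everywhere. *)
Lemma markov_ge0 phi : integ m phi -> {ae m, forall x, 0 <= phi x} ->
  {ae m, forall y, 0 <= L phi y}.
Proof.
move=> I p0; have IL := markov_integ I.
have : {ae m, forall y, `|L phi y| = L phi y}.
  have IA := integ_abs IL.
  apply: ae_eq_nrm_le => //.
  rewrite nrm_pos; [|by apply/aeW => x; rewrite subr_ge0 ler_norm|exact: integB].
  rewrite RintegralB// markov_Rint// -(nrm_pos p0 I) subr_le0.
  exact: markov_nrm.
by apply: filterS => y <-.
Qed.

Lemma markov_lin c phi psi : integ m phi -> integ m psi ->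
  {ae m, forall y, L (fun x => c * phi x + psi x) y = c * L phi y + L psi y}.
Proof. exact: kernel_op_linear ler01 doeblin_bound. Qed.

Lemma markovB phi psi : integ m phi -> integ m psi ->
  {ae m, forall y, L (fun x => phi x - psi x) y = L phi y - L psi y}.
Proof.
move=> I J; have := markov_lin (-1) J I; apply: filterS => y.
rewrite (_ : (fun x => -1 * psi x + phi x) = (fun x => phi x - psi x)).
  by move=> ->; ring.
by apply/funext => x; ring.
Qed.

Lemma markovD phi psi : integ m phi -> integ m psi ->
  {ae m, forall y, L (fun x => phi x + psi x) y = L phi y + L psi y}.
Proof.
move=> I J; have := markov_lin 1 I J; apply: filterS => y.
by under eq_fun do rewrite mul1r; rewrite mul1r.
Qed.

Lemma markov_nrmB phi psi : integ m phi -> integ m psi ->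
  nrm m (fun x => L phi x - L psi x) <= nrm m (fun x => phi x - psi x).
Proof.
move=> I J; have IJ := integB I J.
rewrite -(@ae_eq_nrm _ _ _ _ (L (fun x => phi x - psi x))).
- exact: markov_nrm.
- exact: markov_integ.
- by apply: integB; exact: markov_integ.
- exact: markovB.
Qed.

Lemma markovZ c phi : integ m phi ->
  {ae m, forall y, L (fun x => c * phi x) y = c * L phi y}.
Proof.
move=> I; have := markov_lin c I (integ0 m); apply: filterS => y.
under eq_fun do rewrite addr0.
move=> ->; rewrite [X in _ + X](_ : _ = 0) ?addr0//.
by rewrite /kernel_op; under eq_Rintegral do rewrite mul0r; rewrite Rint_cst_probability.
Qed.

(** Doeblin's argument: on functions of mean zero the operator does not change
when the constant alpha is subtracted from its kernel, which leaves a
nonnegative kernel of mass 1 - alpha. *)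
Lemma markov_contract v : integ m v -> \int[m]_x v x = 0 ->
  nrm m (L v) <= (1 - alpha) * nrm m v.
Proof.
move=> I v0; have /andP[a0 a1] := alpha01.
have a1' : 0 <= 1 - alpha by rewrite subr_ge0 ltW.
pose k1 x y : R := kappa x y - alpha.
have mk1 : measurable_fun setT (fun p : T * T => k1 p.1 p.2) by exact: measurable_funB.
rewrite (@ae_eq_nrm _ _ _ _ _ (kernel_op m k1 v)).
- exact: kernel_op_nrm a1' mk1 doeblin_bound_sub I.
- exact: markov_integ.
- exact: kernel_op_integ a1' mk1 doeblin_bound_sub I.
apply: filterS (kernel_op_ae_integ ler01 mk doeblin_bound I) => y Iy.
rewrite /kernel_op /k1.
under [RHS]eq_Rintegral do rewrite mulrBr [_ * alpha]mulrC.
by rewrite RintegralB//= ?RintegralZl// ?v0 ?mulr0 ?subr0//; exact: integZ.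
Qed.

End markov_operator.

(** * Linear response for sequences of uniformly mixing Markov kernels *)

Section sequential_response.
Context (R : realType) (dim : nat).
Local Notation T := 'rV[R]_dim.
Context (m : probability T R).
Variables (alpha e1 G : R).
Variables (kappa : R -> int -> T -> T -> R) (delta : int -> T -> T -> R).

Hypothesis alpha01 : 0 < alpha < 1.
Hypothesis e1_gt0 : 0 < e1.
Hypothesis G_ge0 : 0 <= G.
Hypothesis dk : forall e n, 0 <= e < e1 -> doeblin m alpha (kappa e n).
Hypothesis mdelta :
  forall n, measurable_fun setT (fun p : T * T => delta n p.1 p.2).
Hypothesis delta_bound : forall n, kernel_bound m (delta n) G.
Hypothesis kappa_continuous : forall eps : R, 0 < eps ->
  exists2 e2, 0 < e2 & forall e n, 0 < e < e2 -> e < e1 ->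
    kernel_bound m (fun x y => kappa e n x y - kappa 0 n x y) eps.
Hypothesis kappa_differentiable : forall eps : R, 0 < eps ->
  exists2 e2, 0 < e2 & forall e n, 0 < e < e2 -> e < e1 ->
    kernel_bound m
      (fun x y => e^-1 * (kappa e n x y - kappa 0 n x y) - delta n x y) eps.

Local Notation rho := (1 - alpha).
Local Notation L e n := (kernel_op m (kappa e n)).
Local Notation Ldot n := (kernel_op m (delta n)).
Local Notation coc e := (cocycle (fun n => L e n)).

Lemma rho01 : 0 <= rho < 1.
Proof. by have /andP[a0 a1] := alpha01; rewrite subr_ge0 ltW//= gtrBl. Qed.

Let rho_ge0 : 0 <= rho. Proof. by have /andP[] := rho01. Qed.

Let e1_0 : (0 : R) <= 0 < e1. Proof. by rewrite lexx. Qed.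

Section one_parameter.
Variables (e : R) (e01 : 0 <= e < e1).

Lemma cocycle_integ n j v : integ m v -> integ m (coc e n j v).
Proof.
by elim: j v => //= j IH v Iv; apply: IH; exact: (markov_integ alpha01 (dk _ e01)).
Qed.

Lemma cocycle_Rint n j v : integ m v -> \int[m]_x coc e n j v x = \int[m]_x v x.
Proof.
elim: j v => //= j IH v Iv; rewrite IH; last exact: (markov_integ alpha01 (dk _ e01)).
exact: (markov_Rint alpha01 (dk _ e01)).
Qed.

Lemma cocycle_ge0 n j v : integ m v -> {ae m, forall x, 0 <= v x} ->
  {ae m, forall x, 0 <= coc e n j v x}.
Proof.
elim: j v => //= j IH v Iv v0; apply: IH.
  exact: (markov_integ alpha01 (dk _ e01)).
exact: (markov_ge0 alpha01 (dk _ e01)).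
Qed.

Lemma cocycle_contract n j v : integ m v -> \int[m]_x v x = 0 ->
  nrm m (coc e n j v) <= rho ^+ j * nrm m v.
Proof.
elim: j v => [|j IH] v Iv v0 /=; first by rewrite expr0 mul1r.
rewrite (le_trans (IH _ _ _))//.
- exact: (markov_integ alpha01 (dk _ e01)).
- by rewrite (markov_Rint alpha01 (dk _ e01)).
rewrite exprSr -mulrA ler_wpM2l ?exprn_ge0//.
exact: (markov_contract alpha01 (dk _ e01)).
Qed.

Lemma cocycle_contractB n j v w : integ m v -> integ m w ->
  \int[m]_x v x = \int[m]_x w x ->
  nrm m (fun x => coc e n j v x - coc e n j w x) <=
  rho ^+ j * nrm m (fun x => v x - w x).
Proof.
elim: j v w => [|j IH] v w Iv Iw vw /=; first by rewrite expr0 mul1r.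
have IL u : integ m u -> integ m (L e (n - j.+1%:Z) u).
  exact: (markov_integ alpha01 (dk _ e01)).
rewrite (le_trans (IH _ _ _ _ _))//.
- exact: IL.
- exact: IL.
- by rewrite !(markov_Rint alpha01 (dk _ e01)).
rewrite exprSr -mulrA ler_wpM2l ?exprn_ge0//.
rewrite -(@ae_eq_nrm _ _ _ _ (L e (n - j.+1%:Z) (fun x => v x - w x))).
- apply: (markov_contract alpha01 (dk _ e01)); first exact: integB.
  by rewrite RintegralB// vw subrr.
- exact/IL/integB.
- by apply: integB; exact: IL.
- exact: (markovB alpha01 (dk _ e01)).
Qed.

End one_parameter.

(** [cocycle] peels off its innermost factor; equivariance is about the outermost. *)
Lemma cocycle_outer (Ls : int -> (T -> R) -> T -> R) n j v :
  cocycle Ls (n + 1) j.+1 v = Ls n (cocycle Ls n j v).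
Proof.
elim: j v => [|j IH] v; first by rewrite /= addrK.
rewrite -[LHS]/(cocycle Ls (n + 1) j.+1 (Ls (n + 1 - j.+2%:Z) v)) IH /=.
by congr (Ls n (cocycle Ls n j (Ls _ v))); rewrite [in LHS]intS opprD addrA addrK.
Qed.

(** mu_n is the image under the dynamics of the constant density 1 started in the
infinitely remote past. *)
Definition equivariant_limit e n (w : T -> R) := integ m w /\
  forall N, nrm m (fun x => coc e n N (fun=> 1) x - w x) <=
            (1 + 1) * rho ^+ N / (1 - rho).

Lemma exists_equivariant_limit e n : 0 <= e < e1 ->
  exists w, equivariant_limit e n w.
Proof.
move=> e01; have I1 := integ_cst m 1.
have IL k := markov_integ alpha01 (dk k e01) I1.
have [||N|N|w Iw wP] := @L1_geometric_limit _ _ _ m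
  (fun N => coc e n N (fun=> 1)) (1 + 1) rho.
- by rewrite addr_ge0.
- exact: rho01.
- exact: cocycle_integ.
- rewrite (le_trans (cocycle_contractB e01 n N (IL _) I1 _))//.
    by rewrite (markov_Rint alpha01 (dk _ e01)).
  rewrite mulrC ler_wpM2r ?exprn_ge0// (le_trans (nrmB _ _))//.
  have n1 : nrm m (fun=> 1) = 1 by rewrite /nrm normr1 Rint_cst_probability.
  by rewrite n1 lerD2r -[leRHS]n1; exact: (markov_nrm alpha01 (dk _ e01)).
by exists w.
Qed.

Definition mu_ e n : T -> R :=
  if pselect (0 <= e < e1) is left e01 then
    projT1 (cid (exists_equivariant_limit n e01)) else fun=> 1.

Lemma mu_P e n : 0 <= e < e1 -> equivariant_limit e n (mu_ e n).
Proof.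
by move=> e01; rewrite /mu_; case: pselect => // e01'; exact: (projT2 (cid _)).
Qed.

Lemma mu_integ e n : 0 <= e < e1 -> integ m (mu_ e n).
Proof. by move=> /(mu_P n)[]. Qed.

Lemma le_geometric0 (c C : R) : (forall N, c <= C * rho ^+ N) -> c <= 0.
Proof.
move=> cC; apply/ler_addgt0Pr => eps eps0; rewrite add0r.
have /cvgr0_norm_le/(_ _ eps0)[N _ NP] := geometric_cvg0 C rho01.
exact: le_trans (cC N) (le_trans (ler_norm _) (NP N (leqnn N))).
Qed.

Lemma mu_Rint e n : 0 <= e < e1 -> \int[m]_x mu_ e n x = 1.
Proof.
move=> e01; have [Iw wP] := mu_P n e01; have I1 := integ_cst m 1.
apply/eqP; rewrite -subr_eq0 -normr_le0; apply: (@le_geometric0 _ ((1 + 1) / (1 - rho))) => N.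
rewrite mulrAC; apply: le_trans (wP N).
have IN := cocycle_integ e01 n N I1.
rewrite distrC -[X in X - _](Rint_cst_probability m).
rewrite -(cocycle_Rint e01 n N I1) -RintegralB//.
exact/normr_Rint_le/integB.
Qed.

(** The negative part of the limit is at most its distance to any of the
nonnegative approximants. *)
Lemma mu_ge0 e n : 0 <= e < e1 -> {ae m, forall x, 0 <= mu_ e n x}.
Proof.
move=> e01; have [Iw wP] := mu_P n e01; have I1 := integ_cst m 1.
have IA := integ_abs Iw.
suff : {ae m, forall y, `|mu_ e n y| = mu_ e n y} by apply: filterS => y <-.
apply: ae_eq_nrm_le => //.
apply: (@le_geometric0 _ (2 * ((1 + 1) / (1 - rho)))) => N.
have IN := cocycle_integ e01 n N I1.
rewrite -mulrA [_ / _ * _]mulrAC.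
apply: le_trans (ler_wpM2l _ (wP N)) => //.
rewrite -[X in X * nrm _ _](@gtr0_norm _ 2)// -nrmZ; last exact: integB.
apply: ae_le_nrm; [exact: integB|exact/integZ/integB|].
apply: filterS (cocycle_ge0 e01 n N I1 _) => [x u0|]; last exact: aeW.
set u := coc _ _ _ _ _ in u0 *; set w := mu_ _ _ _.
have [w0|w0] := lerP 0 w; first by rewrite (ger0_norm w0) subrr normr0.
rewrite (ltr0_norm w0) (ger0_norm (_ : 0 <= - w - w)) ?(ger0_norm (_ : 0 <= 2 * (u - w))); lra.
Qed.

Lemma mu_nrm e n : 0 <= e < e1 -> nrm m (mu_ e n) = 1.
Proof.
move=> e01; have I := mu_integ n e01; rewrite -(mu_Rint n e01).
have mI := integ_measurable I.
apply: ae_eq_Rint => //; first exact: measurableT_comp.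
by apply: filterS (mu_ge0 n e01) => x /ger0_norm.
Qed.

Lemma mu_equivariant e n : 0 <= e < e1 ->
  {ae m, forall y, mu_ e (n + 1) y = L e n (mu_ e n) y}.
Proof.
move=> e01; have [Iw wP] := mu_P n e01; have [Iw1 wP1] := mu_P (n + 1) e01.
have I1 := integ_cst m 1; have IL := markov_integ alpha01 (dk n e01).
apply: ae_eq_nrm_le => //; first exact: IL.
apply: (@le_geometric0 _ (2 * ((1 + 1) / (1 - rho)))) => N.
have IN := cocycle_integ e01 n N I1.
have IN1 := cocycle_integ e01 (n + 1) N.+1 I1.
apply: le_trans (nrm_tri Iw1 IN1 (IL _ Iw)) _.
rewrite nrm_distC cocycle_outer.
have h1 : nrm m (fun x => coc e (n + 1) N.+1 (fun=> 1) x - mu_ e (n + 1) x) <=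
    (1 + 1) / (1 - rho) * rho ^+ N.
  apply: le_trans (wP1 N.+1) _; rewrite mulrAC ler_wpM2l//.
    by rewrite divr_ge0// subr_ge0; have /andP[_ /ltW] := rho01.
  by rewrite exprS ler_piMl ?exprn_ge0//; have /andP[_ /ltW] := rho01.
have h2 := le_trans (markov_nrmB alpha01 (dk n e01) IN Iw) (wP N).
rewrite cocycle_outer in h1; rewrite mulrAC in h2.
by rewrite -mulrA mulrDl mul1r lerD.
Qed.

Definition source n : T -> R := Ldot n (mu_ 0 n).

Lemma source_integ n : integ m (source n).
Proof. exact: kernel_op_integ G_ge0 (mdelta n) (delta_bound n) (mu_integ n e1_0). Qed.

Lemma source_nrm n : nrm m (source n) <= G.
Proof.
have := kernel_op_nrm G_ge0 (mdelta n) (delta_bound n) (mu_integ n e1_0).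
by rewrite mu_nrm ?mulr1.
Qed.

Lemma small_parameter (P : R -> Prop) :
  (exists2 e2 : R, 0 < e2 & forall e : R, 0 < e < e2 -> e < e1 -> P e) ->
  exists e : R, [/\ 0 < e, e < e1 & P e].
Proof.
move=> [e2 e20 eP]; exists (Num.min e1 e2 / 2).
have h : 0 < Num.min e1 e2 by rewrite lt_min e1_gt0.
have h1 : Num.min e1 e2 <= e1 by rewrite ge_min lexx.
have h2 : Num.min e1 e2 <= e2 by rewrite ge_min lexx orbT.
by split; [| |apply: eP]; lra.
Qed.

(** This is the derivative in e of the identity int kappa e n x y dy = 1. *)
Lemma delta_Rint n : {ae m, forall x, \int[m]_y delta n x y = 0}.
Proof.
have key (k : nat) : {ae m, forall x, `|\int[m]_y delta n x y| <= k.+1%:R^-1}.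
  have k0 : (0 : R) < k.+1%:R^-1 by rewrite invr_gt0.
  have [e2 e20 H] := kappa_differentiable k0.
  have [e [e0 ee1 eP]] := small_parameter (ex_intro2 _ _ e2 e20 (H ^~ n)).
  have e01 : 0 <= e < e1 by rewrite ltW.
  have [_ dke] := dk n e01; have [_ dk0] := dk n e1_0.
  apply: filterS2 (ae_and dke dk0) (ae_and eP (delta_bound n)).
  move=> x [[Ie e1' _] [I0 e0' _]] [[Id dB] [Idel _]].
  have Iq : integ m (fun y => e^-1 * (kappa e n x y - kappa 0 n x y)).
    exact/integZ/integB.
  have := le_trans (normr_Rint_le Id) dB.
  by rewrite RintegralB// RintegralZl//; [rewrite RintegralB// e1' e0' subrr mulr0 sub0r normrN|exact: integB].
have := ae_foralln key; apply: filterS => x xk.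
apply/eqP; rewrite -normr_le0; apply/ler_addgt0Pr => eps eps0; rewrite add0r.
have [k kP] := ltr_add_invr eps0.
by rewrite (le_trans (xk k))// ltW// -[X in X < _]add0r.
Qed.

Lemma source_Rint n : \int[m]_x source n x = 0.
Proof.
rewrite (kernel_op_Rint G_ge0 (mdelta n) (delta_bound n) (mu_integ n e1_0)
  (delta_Rint n)).
by rewrite mul0r.
Qed.

(** The source has mean zero, so the contraction applies to each term of the series. *)
Definition response_term n j : T -> R := coc 0 n j (source (n - j%:Z - 1)).

Lemma response_term_integ n j : integ m (response_term n j).
Proof. exact/cocycle_integ/source_integ. Qed.

Lemma response_term_Rint n j : \int[m]_x response_term n j x = 0.
Proof. by rewrite cocycle_Rint ?source_Rint//; exact: source_integ. Qed.

Lemma response_term_nrm n j : nrm m (response_term n j) <= G * rho ^+ j.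
Proof.
rewrite (le_trans (cocycle_contract _ _ _ _ _))//.
- exact: source_integ.
- exact: source_Rint.
by rewrite mulrC ler_wpM2r ?exprn_ge0// source_nrm.
Qed.

Definition response_partial n J x : R := \sum_(0 <= j < J.+1) response_term n j x.

Lemma response_partial_integ n J : integ m (response_partial n J).
Proof. by apply: integ_sum => j; exact: response_term_integ. Qed.

Lemma exists_response n : exists2 w, integ m w &
  forall J, nrm m (fun x => response_partial n J x - w x) <=
    G * rho * rho ^+ J / (1 - rho).
Proof.
apply: L1_geometric_limit => [||J|J].
- exact: mulr_ge0.
- exact: rho01.
- exact: response_partial_integ.
rewrite -mulrA -exprS; apply: le_trans (response_term_nrm n J.+1).
rewrite le_eqVlt; apply/orP; left; apply/eqP; congr nrm; apply/funext => x.
by rewrite /response_partial big_nat_recr//= addrAC subrr add0r.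
Qed.

Definition response n : T -> R := projT1 (cid2 (exists_response n)).

Lemma response_integ n : integ m (response n).
Proof. by rewrite /response; case: cid2. Qed.

Lemma response_partial_le n J :
  nrm m (fun x => response_partial n J x - response n x) <=
    G * rho / (1 - rho) * rho ^+ J.
Proof. by rewrite /response; case: cid2 => w _ /= wP; rewrite mulrAC. Qed.

Lemma response_partial_Rint n J : \int[m]_x response_partial n J x = 0.
Proof.
elim: J => [|J IH].
  rewrite -(response_term_Rint n 0); apply: eq_Rintegral => x _.
  by rewrite /response_partial big_nat1.
rewrite -[RHS]addr0 -{1}IH -(response_term_Rint n J.+1) -RintegralD//.
- by apply: eq_Rintegral => x _; rewrite /response_partial big_nat_recr.
- exact: response_partial_integ.
- exact: response_term_integ.
Qed.

Lemma response_Rint n : \int[m]_x response n x = 0.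
Proof.
apply/eqP; rewrite -normr_le0; apply: (@le_geometric0 _ (G * rho / (1 - rho))) => J.
apply: le_trans (response_partial_le n J).
have IR := response_integ n; have IP := response_partial_integ n J.
rewrite -normrN -[X in `|X|]add0r -(response_partial_Rint n J) -RintegralB//.
exact/normr_Rint_le/integB.
Qed.

Definition response_bound : R := G / (1 - rho).

Lemma response_nrm n : nrm m (response n) <= response_bound.
Proof.
have IR := response_integ n; have IP := response_partial_integ n 0.
have := response_partial_le n 0; rewrite expr0 mulr1 nrm_distC => h.
have h0 : nrm m (response_partial n 0) <= G.
  have := response_term_nrm n 0; rewrite expr0 mulr1; congr (nrm _ _ <= _).
  by apply/funext => x; rewrite /response_partial big_nat1.
have : nrm m (response n) <=
    nrm m (fun x => response n x - response_partial n 0 x) + nrm m (response_partial n 0).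
  rewrite -[X in nrm m X <= _](_ : (fun x => (response n x - response_partial n 0 x) +
    response_partial n 0 x) = _); last by apply/funext => x; rewrite subrK.
  by apply: nrmD => //; exact: integB.
have r1 : 0 < 1 - rho by rewrite subr_gt0; have /andP[] := rho01.
have : G * rho / (1 - rho) + G = response_bound by rewrite /response_bound; field; lra.
lra.
Qed.

(** The partial sum up to J + 1 at time n + 1 is, almost everywhere, the image of the
partial sum up to J at time n plus the source; both sides converge geometrically. *)
Lemma response_equivariant n :
  {ae m, forall y, response (n + 1) y = L 0 n (response n) y + source n y}.
Proof.
have IL := markov_integ alpha01 (dk n e1_0).
have IS := source_integ n.
have IR k := response_integ k; have IP k J := response_partial_integ k J.
apply: ae_eq_nrm_le => //; first by apply: integD => //; exact: IL.
apply: (@le_geometric0 _ (2 * (G * rho / (1 - rho)))) => J.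
have -> : nrm m (fun x => response (n + 1) x - (L 0 n (response n) x + source n x)) =
  nrm m (fun x => (response (n + 1) x - response_partial (n + 1) J.+1 x) +
    (L 0 n (response_partial n J) x - L 0 n (response n) x)).
  apply: ae_eq_nrm.
  - by apply: integB => //; apply: integD => //; exact: IL.
  - by apply: integD; apply: integB => //; exact: IL.
  suff : {ae m, forall x, response_partial (n + 1) J.+1 x =
                 L 0 n (response_partial n J) x + source n x}.
    by apply: filterS => x ->; ring.
  elim: J => [|J IH].
    apply/aeW => x; rewrite /response_partial big_nat_recr//= !big_nat1 addrC.
    congr (_ + _); last by rewrite /response_term /= subr0 addrK.
    rewrite {1}/response_term cocycle_outer.
    congr (L 0 n _ x); apply/funext => y; rewrite big_nat1 /response_term.
    by rewrite subr0 addrK.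
  have := markovD alpha01 (dk n e1_0) (IP n J) (response_term_integ n J.+1).
  apply: filterS2 IH => x IH LD.
  rewrite {1}/response_partial big_nat_recr//= -/(response_partial _ _ _) IH.
  rewrite (_ : response_partial n J.+1 = (fun x => response_partial n J x + response_term n J.+1 x)); last first.
    by apply/funext => y; rewrite {1}/response_partial big_nat_recr.
  rewrite LD -!addrA; congr (_ + _); rewrite addrC; congr (_ + _).
  rewrite {1}/response_term cocycle_outer /response_term.
  congr (L 0 n (coc 0 n J.+1 (source _)) x).
  by rewrite [in LHS]intS opprD addrA addrK.
apply: le_trans (nrmD _ _) _.
- exact: integB.
- by apply: integB; exact: IL.
have h1 := response_partial_le (n + 1) J.+1; rewrite nrm_distC in h1.
have h2 := le_trans (markov_nrmB alpha01 (dk n e1_0) (IP n J) (IR n)) (response_partial_le n J).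
rewrite -mulrA mulrDl mul1r lerD//.
apply: le_trans h1 _; apply: ler_wpM2l.
  apply: divr_ge0; first exact: mulr_ge0.
  by rewrite subr_ge0; have /andP[_ /ltW] := rho01.
by rewrite exprS ler_piMl ?exprn_ge0//; have /andP[_ /ltW] := rho01.
Qed.

Section perturbation.
Variables (e : R) (n : int).
Hypotheses (e_gt0 : 0 < e) (e_lt : e < e1).

Let e01 : 0 <= e < e1. Proof. by rewrite ltW. Qed.
Let mke : measurable_fun setT (fun p : T * T => kappa e n p.1 p.2) := (dk n e01).1.
Let mk0 : measurable_fun setT (fun p : T * T => kappa 0 n p.1 p.2) := (dk n e1_0).1.
Let be : kernel_bound m (kappa e n) 1 := doeblin_bound alpha01 (dk n e01).
Let b0 : kernel_bound m (kappa 0 n) 1 := doeblin_bound alpha01 (dk n e1_0).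
Let mB : measurable_fun setT (fun p : T * T => kappa e n p.1 p.2 - kappa 0 n p.1 p.2).
Proof. exact: measurable_funB. Qed.

Let kernel_opB phi : integ m phi ->
  {ae m, forall y, kernel_op m (fun x y => kappa e n x y - kappa 0 n x y) phi y =
    L e n phi y - L 0 n phi y}.
Proof.
move=> I; have := kernel_op_lin_kernel (-1) mk0 mke ler01 ler01 b0 be I.
apply: filterS => y; rewrite mulN1r addrC => <-.
by apply: eq_Rintegral => x _; ring.
Qed.

Lemma perturbation_nrm (eps : R) phi : 0 <= eps ->
  kernel_bound m (fun x y => kappa e n x y - kappa 0 n x y) eps ->
  integ m phi ->
  nrm m (fun y => L e n phi y - L 0 n phi y) <= eps * nrm m phi.
Proof.
move=> eps0 bB I; apply: le_trans (kernel_op_nrm eps0 mB bB I).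
rewrite le_eqVlt; apply/orP; left; apply/eqP; apply/esym/ae_eq_nrm.
- exact: kernel_op_integ eps0 mB bB I.
- apply: integB; first exact: (markov_integ alpha01 (dk n e01)).
  exact: (markov_integ alpha01 (dk n e1_0)).
- exact: kernel_opB.
Qed.

Lemma source_nrmB (eps : R) : 0 <= eps ->
  kernel_bound m (fun x y => kappa e n x y - kappa 0 n x y) 1 ->
  kernel_bound m
    (fun x y => e^-1 * (kappa e n x y - kappa 0 n x y) - delta n x y) eps ->
  nrm m (fun y => e^-1 * (L e n (mu_ 0 n) y - L 0 n (mu_ 0 n) y) - source n y) <= eps.
Proof.
move=> eps0 bB bD; have I := mu_integ n e1_0.
have mD : measurable_fun setT (fun p : T * T =>
    e^-1 * (kappa e n p.1 p.2 - kappa 0 n p.1 p.2) - delta n p.1 p.2).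
  by apply: measurable_funB => //; exact: measurable_funM.
have bdd := kernel_op_nrm eps0 mD bD I; rewrite mu_nrm// mulr1 in bdd.
apply: le_trans bdd.
rewrite le_eqVlt; apply/orP; left; apply/eqP; apply/esym/ae_eq_nrm.
- exact: kernel_op_integ eps0 mD bD I.
- apply: integB; last exact: source_integ.
  apply/integZ/integB; first exact: (markov_integ alpha01 (dk n e01)).
  exact: (markov_integ alpha01 (dk n e1_0)).
apply: filterS3 (kernel_op_ae_integ ler01 mB bB I)
  (kernel_op_ae_integ G_ge0 (mdelta n) (delta_bound n) I) (kernel_opB I).
move=> y J1 J2 <-; rewrite /source /kernel_op -RintegralZl// -RintegralB//.
  by apply: eq_Rintegral => x _; ring.
exact: integZ.
Qed.

Definition difference_quotient x : R :=
  e^-1 * (mu_ e n x - mu_ 0 n x) - response n x.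

Lemma difference_quotient_integ : integ m difference_quotient.
Proof. by apply: integB; [apply/integZ/integB; exact: mu_integ|exact: response_integ]. Qed.

Lemma difference_quotient_Rint : \int[m]_x difference_quotient x = 0.
Proof.
have [I1 I0] := (mu_integ n e01, mu_integ n e1_0).
rewrite RintegralB//; last 2 first.
- exact/integZ/integB.
- exact: response_integ.
rewrite RintegralZl//; last exact: integB.
by rewrite RintegralB// !mu_Rint// response_Rint subrr mulr0 subr0.
Qed.

Lemma difference_quotient_nrm :
  nrm m difference_quotient <= e^-1 * 2 + response_bound.
Proof.
have [I1 I0] := (mu_integ n e01, mu_integ n e1_0).
apply: le_trans (nrmB (integZ _ (integB I1 I0)) (response_integ n)) _.
apply: lerD (response_nrm n).
rewrite nrmZ; last exact: integB.
rewrite gtr0_norm ?invr_gt0// ler_wpM2l ?invr_ge0 ?(ltW e_gt0)//.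
by apply: le_trans (nrmB I1 I0) _; rewrite !mu_nrm.
Qed.

End perturbation.

(** Subtracting the equivariance relations of mu^e, mu^0 and eta shows that the
error D_n of the difference quotient satisfies
D_(n+1) = L^e_n D_n + (L^e_n - L_n) eta_n + (e^-1 (L^e_n - L_n) mu_n - g_n). *)
Lemma difference_quotient_step e n eps : 0 < e -> e < e1 -> 0 <= eps -> eps <= 1 ->
  kernel_bound m (fun x y => kappa e n x y - kappa 0 n x y) eps ->
  kernel_bound m
    (fun x y => e^-1 * (kappa e n x y - kappa 0 n x y) - delta n x y) eps ->
  nrm m (difference_quotient e (n + 1)) <=
    rho * nrm m (difference_quotient e n) + eps * (response_bound + 1).
Proof.
move=> e0 ee1 eps0 eps1 bB bD.
have e01 : 0 <= e < e1 by rewrite ltW.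
have IQ k := difference_quotient_integ k e0 ee1.
have ILe := markov_integ alpha01 (dk n e01).
have IL0 := markov_integ alpha01 (dk n e1_0).
have [Ie I0] := (mu_integ n e01, mu_integ n e1_0).
have [IR IS] := (response_integ n, source_integ n).
pose A y : R := L e n (difference_quotient e n) y.
pose B y : R := L e n (response n) y - L 0 n (response n) y.
pose C y : R := e^-1 * (L e n (mu_ 0 n) y - L 0 n (mu_ 0 n) y) - source n y.
have IA : integ m A by exact: ILe.
have IB : integ m B by apply: integB; [exact: ILe|exact: IL0].
have IC : integ m C by apply: integB => //; apply/integZ/integB; [exact: ILe|exact: IL0].
have -> : nrm m (difference_quotient e (n + 1)) = nrm m (fun y => A y + (B y + C y)).
  apply: ae_eq_nrm => //; first by apply: integD => //; exact: integD.
  have h1 := ae_and (mu_equivariant n e01) (mu_equivariant n e1_0).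
  have h2 := ae_and (response_equivariant n)
     (markovB alpha01 (dk n e01) (integZ e^-1 (integB Ie I0)) IR).
  have h3 := ae_and (markovZ alpha01 (dk n e01) e^-1 (integB Ie I0))
    (markovB alpha01 (dk n e01) Ie I0).
  apply: filterS3 h1 h2 h3 => y [E1 E2] [E3 E4] [E5 E6].
  rewrite /difference_quotient /A /B /C E1 E2 E3 -/(difference_quotient e n).
  rewrite [L e n (difference_quotient e n) y]E4 E5 E6.
  ring.
apply: le_trans (nrmD IA (integD IB IC)) _; apply: lerD.
  apply: (markov_contract alpha01 (dk n e01) (IQ n)).
  exact: difference_quotient_Rint.
apply: le_trans (nrmD IB IC) _; rewrite mulrDr mulr1; apply: lerD.
  apply: le_trans (perturbation_nrm e0 ee1 eps0 bB IR) _.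
  by rewrite ler_wpM2l// response_nrm.
apply: source_nrmB => //; apply: filterS bB => x [? h]; split => //.
exact: le_trans h eps1.
Qed.

Lemma response_bound_ge0 : 0 <= response_bound.
Proof.
by apply: divr_ge0 => //; rewrite subr_ge0; have /andP[_ /ltW] := rho01.
Qed.

(** The recursion of [difference_quotient_step] starts from the crude bound
[difference_quotient_nrm], which blows up with e^-1 but is uniform in n: started N
steps earlier, it is damped by (1 - alpha)^N. *)
Lemma response_limit (eps : R) : 0 < eps ->
  exists2 e2, 0 < e2 & forall e n, 0 < e < e2 -> e < e1 ->
    nrm m (difference_quotient e n) <= eps.
Proof.
move=> eps0; have /andP[a0 a1] := alpha01; have rb0 := response_bound_ge0.
pose c := response_bound + 1.
have c0 : 0 < c by rewrite /c ltr_wpDl.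
(* The fixed point of x = rho x + eps alpha is eps. *)
pose eps' := Num.min 1 (eps * alpha / c).
have eps'0 : 0 < eps' by rewrite lt_min ltr01/= divr_gt0// mulr_gt0.
have eps'1 : eps' <= 1 by rewrite ge_min lexx.
have eps'c : eps' * c <= eps * alpha by rewrite -ler_pdivlMr// ge_min lexx orbT.
have [e2 e20 H2] := kappa_continuous eps'0.
have [e3 e30 H3] := kappa_differentiable eps'0.
exists (Num.min e2 e3); first by rewrite lt_min e20.
move=> e n /andP[e0]; rewrite lt_min => /andP[ee2 ee3] ee1.
have step k : nrm m (difference_quotient e (k + 1)) <=
    rho * nrm m (difference_quotient e k) + eps * alpha.
  have h := difference_quotient_step (n := k) e0 ee1 (ltW eps'0) eps'1.
  apply: le_trans (h _ _) _; [by apply: H2; rewrite ?e0|by apply: H3; rewrite ?e0|].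
  by rewrite lerD2l.
pose M := e^-1 * 2 + response_bound.
have M0 : 0 <= M by rewrite addr_ge0// mulr_ge0// invr_ge0 ltW.
have iter N : forall k, nrm m (difference_quotient e k) <= eps + M * rho ^+ N.
  elim: N => [|N IH] k.
    rewrite expr0 mulr1 (le_trans (difference_quotient_nrm k e0 ee1))//.
    by rewrite lerDr ltW.
  rewrite -[k](subrK 1); apply: le_trans (step _) _.
  have := ler_wpM2l rho_ge0 (IH (k - 1)); rewrite exprS.
  rewrite mulrDr mulrCA; lra.
rewrite -subr_le0; apply: (@le_geometric0 _ M) => N.
by rewrite lerBlDl.
Qed.

End sequential_response.

(** * From real-valued estimates to extended-real suprema and limits *)

Section extended_real_forms.
Context (R : realType).

Lemma cvg_ereal0 (I : Type) (F : set_system I) (FF : Filter F) (g : I -> \bar R) :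
  (forall i, (0 <= g i)%E) ->
  (forall eps : R, 0 < eps -> \forall i \near F, (g i <= eps%:E)%E) ->
  g i @[i --> F] --> 0%E.
Proof.
move=> g0 gF; apply/fine_cvgP; split.
  apply: filterS (gF _ ltr01) => i gi.
  by rewrite ge0_fin_numE// (le_lt_trans gi)// ltry.
apply/cvgr0Pnorm_le => eps eps0; apply: filterS (gF _ eps0) => i gi /=.
have fi : g i \is a fin_num by rewrite ge0_fin_numE// (le_lt_trans gi)// ltry.
by rewrite ger0_norm ?fine_ge0// -lee_fin fineK.
Qed.

Lemma sup_over_le (I : Type) (F : I -> \bar R) c :
  (forall i, (F i <= c)%E) -> (sup_over F <= c)%E.
Proof. by move=> Fc; apply: ge_ereal_sup => _ [i _ <-]. Qed.

Lemma sup_over_ge (I : Type) (F : I -> \bar R) i : (F i <= sup_over F)%E.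
Proof. by apply: ereal_sup_ubound; exists i. Qed.

Lemma sup_over_cvg0 (I : Type) (i0 : I) (F : R -> I -> \bar R) (e1 : R) :
  0 < e1 -> (forall e i, (0 <= F e i)%E) ->
  (forall eps : R, 0 < eps -> exists2 e2 : R, 0 < e2 &
    forall e i, 0 < e < e2 -> e < e1 -> (F e i <= eps%:E)%E) ->
  sup_over (F e) @[e --> (0 : R)^'+] --> 0%E.
Proof.
move=> e10 F0 FP; apply: cvg_ereal0 => [e|eps eps0].
  exact: le_trans (F0 e i0) (sup_over_ge _ _).
have [e2 e20 H] := FP _ eps0.
near=> e; apply: sup_over_le => i; apply: H.
  by apply/andP; split; near: e; [exact: nbhs_right_gt|exact: nbhs_right_lt].
by near: e; exact: nbhs_right_lt.
Unshelve. all: by end_near. Qed.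

Context (dim : nat) (m : {measure set 'rV[R]_dim -> \bar R}).

Lemma L1normE v : L1fun m v -> L1norm m v = (nrm m v)%:E.
Proof. by move=> Iv; rewrite /L1norm Lnorm1 EFin_nrm. Qed.

Lemma L1norm_ge0 v : (0 <= L1norm m v)%E.
Proof. exact: Lnorm_ge0. Qed.

End extended_real_forms.

Section linear_response_of_kernels.
Context (R : realType) (dim : nat).
Local Notation T := 'rV[R]_dim.
Context (m : probability T R).
Variables (k : T -> T -> R) (D : T -> T -> T -> R).
Variables (f : int -> R -> T -> T) (fdot : int -> T -> T).

Let kappa (e : R) (n : int) (x y : T) : R := k (f n e x) y.
Let delta (n : int) (x y : T) : R := D (f n 0 x) (fdot n x) y.

(** The estimates of the previous part, restated for extended-real norms, suprema over
n and limits at 0+. *)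
Lemma linear_response_of_kernels (alpha e1 G : R) :
  0 < alpha < 1 -> 0 < e1 -> 0 <= G ->
  (forall e n, 0 <= e < e1 -> doeblin m alpha (kappa e n)) ->
  (forall n, measurable_fun setT (fun p : T * T => delta n p.1 p.2)) ->
  (forall n, kernel_bound m (delta n) G) ->
  (forall eps : R, 0 < eps ->
    exists2 e2, 0 < e2 & forall e n, 0 < e < e2 -> e < e1 ->
      kernel_bound m (fun x y => kappa e n x y - kappa 0 n x y) eps) ->
  (forall eps : R, 0 < eps ->
    exists2 e2, 0 < e2 & forall e n, 0 < e < e2 -> e < e1 ->
      kernel_bound m
        (fun x y => e^-1 * (kappa e n x y - kappa 0 n x y) - delta n x y) eps) ->
  exists mu : R -> int -> T -> R,
    part_a m k D f fdot e1 mu /\ part_b m k D f fdot mu.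
Proof.
move=> alpha01 e10 G0 dk mdel bdel kC kD.
have e1_0 : (0 : R) <= 0 < e1 by rewrite lexx.
have r01 := rho01 alpha01.
have /andP[a0 a1] := alpha01.
pose mu := mu_ alpha01 dk.
have Imu e n : 0 <= e < e1 -> L1fun m (mu e n) by exact: mu_integ.
have IL e n phi : 0 <= e < e1 -> L1fun m phi -> L1fun m (Lop m k f e n phi).
  by move=> e01; exact: (markov_integ alpha01 (dk e n e01)).
pose g := response_source m D f fdot mu.
have Ig n : L1fun m (g n) by exact: (source_integ alpha01 e10 G0 dk mdel bdel).
have gG n : nrm m (g n) <= G by exact: (source_nrm alpha01 e10 G0 dk mdel bdel).
exists mu; split.
- split.
  + move=> n e e01 phi Iphi; split.
    * exact: IL.
    * exact: (markov_ge0 alpha01 (dk e n e01)).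
    * exact: (markov_Rint alpha01 (dk e n e01)).
    * rewrite !L1normE ?lee_fin//; last exact: IL.
      exact: (markov_nrm alpha01 (dk e n e01)).
  + split.
      move=> n e e01; split; last exact: mu_equivariant.
      by split; [exact: Imu|exact: mu_ge0|exact: mu_Rint].
    exists 1 => n e e01; rewrite L1normE; last exact: Imu.
    by rewrite mu_nrm.
  + exists 1, (1 - alpha); split => //; first by rewrite subr_gt0 a1 gtrBl.
    move=> n l e v _ e01 Iv v0; rewrite !L1normE//; last exact: (cocycle_integ alpha01 dk).
    by rewrite mul1r -EFinM lee_fin; exact: (cocycle_contract alpha01 dk).
  + split => //; apply: (@le_lt_trans _ _ G%:E); last exact: ltry.
    by apply: sup_over_le => n; rewrite L1normE// lee_fin.
  + split.
      apply: (sup_over_cvg0 (0 : int) e10) => [e n|eps eps0]; first exact: L1norm_ge0.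
      have [e2 e20 H2] := kC _ ltr01; have [e3 e30 H3] := kD _ eps0.
      exists (Num.min e2 e3); first by rewrite lt_min e20.
      move=> e n /andP[e0]; rewrite lt_min => /andP[ee2 ee3] ee1.
      have e01 : 0 <= e < e1 by rewrite ltW.
      rewrite L1normE; last first.
        apply: (@integB _ _ _ m) => //; last exact: Ig.
        by apply: (@integZ _ _ _ m); apply: (@integB _ _ _ m); apply: IL => //; exact: Imu.
      have [b1 b2] : kernel_bound m (fun x y => kappa e n x y - kappa 0 n x y) 1 /\
          kernel_bound m (fun x y => e^-1 * (kappa e n x y - kappa 0 n x y) -
            delta n x y) eps.
        by split; [apply: H2|apply: H3]; rewrite ?e0.
      by rewrite lee_fin; exact: (source_nrmB alpha01 e10 G0 dk mdel bdel e0 ee1 (ltW eps0) b1 b2).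
    apply: (sup_over_cvg0 (0 : int) e10) => [e n|eps eps0].
      apply: le_trans (L1norm_ge0 m _) (ereal_sup_ubound _); exists (fun=> 0) => //.
      have I0 : L1fun m (fun=> 0) := integ0 m.
      by split => //=; rewrite (L1normE I0) nrm0 lee_fin.
    have [e2 e20 H] := kC _ eps0; exists e2 => // e n ee2 ee1.
    have e0 : 0 < e by case/andP: ee2.
    have e01 : 0 <= e < e1 by rewrite ltW.
    apply: ge_ereal_sup => _ [v [Iv]] + <-; rewrite (L1normE Iv) lee_fin => v1.
    rewrite L1normE; last by apply: (@integB _ _ _ m); exact: IL.
    rewrite lee_fin; apply: le_trans (perturbation_nrm alpha01 e10 dk e0 ee1 (ltW eps0) (H _ _ ee2 ee1) Iv) _.
    by rewrite ler_piMr// ltW.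
pose term n j := cocycle (Lop m k f 0) n j (g (n - j%:Z - 1)).
have Iterm n j : L1fun m (term n j) by exact: (response_term_integ alpha01 e10 G0 dk mdel bdel).
have term_nrm n j : nrm m (term n j) <= G * (1 - alpha) ^+ j.
  exact: (response_term_nrm alpha01 e10 G0 dk mdel bdel kD).
have termE n j : L1norm m (term n j) = (nrm m (term n j))%:E by exact: L1normE.
have tail n J : (\sum_(J <= j <oo) L1norm m (term n j) <=
    (G * (1 - alpha) ^+ J / (1 - (1 - alpha)))%:E)%E.
  apply: lime_le; first by apply: is_cvg_nneseries => j _ _; exact: L1norm_ge0.
  apply: nearW => b.
  under eq_bigr do rewrite termE.
  rewrite sumEFin lee_fin; apply: le_trans (geometric_partial_sum_le J b G0 r01).
  by apply: ler_sum => j _.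
pose eta := response alpha01 e10 G0 dk mdel bdel kD.
have Ieta n : L1fun m (eta n) by exact: response_integ.
exists eta; split.
- split => //; apply: (@le_lt_trans _ _ (response_bound alpha G)%:E); last exact: ltry.
  by apply: sup_over_le => n; rewrite L1normE// lee_fin; exact: response_nrm.
- apply: (sup_over_cvg0 (0 : int) e10) => [e n|eps eps0]; first exact: L1norm_ge0.
  have [e2 e20 H] := response_limit alpha01 e10 G0 dk mdel bdel kC kD eps0.
  exists e2 => // e n ee2 ee1; have e0 : 0 < e by case/andP: ee2.
  rewrite L1normE; first by rewrite lee_fin; exact: H.
  exact: (difference_quotient_integ alpha01 e10 G0 dk mdel bdel kD n e0 ee1).
- move=> n; apply: cvg_ereal0 => [J|eps eps0]; first exact: L1norm_ge0.
  have /cvgr0_norm_le/(_ _ eps0) := geometric_cvg0 (G * (1 - alpha) / (1 - (1 - alpha))) r01.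
  apply: filterS => J hJ; have := response_partial_le alpha01 e10 G0 dk mdel bdel kD n J.
  rewrite nrm_distC => h.
  rewrite (_ : (fun x => _) = (fun x => eta n x -
    response_partial delta alpha01 dk n J x)).
    rewrite L1normE; first by rewrite lee_fin; apply: le_trans h (le_trans (ler_norm _) hJ).
    apply: (@integB _ _ _ m); [exact: Ieta|].
    exact: (response_partial_integ alpha01 e10 G0 dk mdel bdel).
  apply/funext => x; congr (_ - _); rewrite /response_partial [RHS]big_ltn//; congr (_ + _).
  by rewrite /response_term /= subr0.
- exact: Iterm.
- split=> [n|]; first by apply: le_lt_trans (tail n 1%N) _; exact: ltry.
  apply: cvg_ereal0 => [J|eps eps0].
    apply: le_trans (sup_over_ge _ (0 : int)).
    by apply: nneseries_ge0 => j _ _; exact: L1norm_ge0.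
  have /cvgr0_norm_le/(_ _ eps0) := geometric_cvg0 (G / (1 - (1 - alpha))) r01.
  apply: filterS => J hJ; apply: sup_over_le => n; apply: le_trans (tail n J) _.
  by rewrite lee_fin mulrAC (le_trans (ler_norm _) hJ).
Qed.

End linear_response_of_kernels.

(** * Smooth functions of one variable with bounded derivatives *)

Section bounded_smooth1.
Context (R : realType).
Implicit Types u v w : R -> R.

(** Bounded derivatives up to order n, the last of which is still differentiable.
Boundedness makes the class closed under products and keeps test functions
integrable against any integrable function. *)
Fixpoint bsmooth1 (n : nat) u : Prop :=
  (exists M : R, forall t, `|u t| <= M) /\
  exists2 u', forall t : R, is_derive t 1 u (u' t) &
    if n is n'.+1 then bsmooth1 n' u' else True.

Lemma bsmooth1_bounded n u : bsmooth1 n u -> exists2 M, 0 <= M & forall t, `|u t| <= M.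
Proof.
case: n => [|n] [[M uM] _]; exists M => //; exact: le_trans (normr_ge0 _) (uM 0).
Qed.

Lemma bsmooth1S n u : bsmooth1 n.+1 u -> bsmooth1 n u.
Proof.
elim: n u => [|n IH] u [bu [u' du su]]; split => //; exists u' => //.
exact: IH.
Qed.

Lemma bsmooth1_derive n u : bsmooth1 n u ->
  exists2 u', forall t : R, is_derive t 1 u (u' t) & (n > 0)%N -> bsmooth1 n.-1 u'.
Proof. by case: n => [|n] [bu [u' du su]]; exists u'. Qed.

Lemma bsmooth1_intro n u u' : (exists M : R, forall t, `|u t| <= M) ->
  (forall t : R, is_derive t 1 u (u' t)) -> ((n > 0)%N -> bsmooth1 n.-1 u') ->
  bsmooth1 n u.
Proof. by case: n => [|n] bu du su; split => //; exists u' => //; exact: su. Qed.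

Lemma bsmooth1_cst n c : bsmooth1 n (fun=> c).
Proof.
elim: n c => [|n IH] c; apply: (@bsmooth1_intro _ _ (fun=> 0)) => //.
- by exists `|c|.
- by exists `|c|.
Qed.

Lemma bsmooth1D n u v : bsmooth1 n u -> bsmooth1 n v ->
  bsmooth1 n (fun t => u t + v t).
Proof.
elim: n u v => [|n IH] u v su sv;
  have [M _ uM] := bsmooth1_bounded su; have [N _ vN] := bsmooth1_bounded sv;
  have [u' du su'] := bsmooth1_derive su; have [v' dv sv'] := bsmooth1_derive sv;
  apply: (@bsmooth1_intro _ _ (fun t => u' t + v' t)) => //.
- by exists (M + N) => t; rewrite (le_trans (ler_normD _ _))// lerD.
- by exists (M + N) => t; rewrite (le_trans (ler_normD _ _))// lerD.
- by move=> _; apply: IH; [exact: su'|exact: sv'].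
Qed.

Lemma bsmooth1M n u v : bsmooth1 n u -> bsmooth1 n v ->
  bsmooth1 n (fun t => u t * v t).
Proof.
elim: n u v => [|n IH] u v su sv;
  have [M M0 uM] := bsmooth1_bounded su; have [N N0 vN] := bsmooth1_bounded sv;
  have [u' du su'] := bsmooth1_derive su; have [v' dv sv'] := bsmooth1_derive sv;
  apply: (@bsmooth1_intro _ _ (fun t => u t * v' t + v t * u' t)) => //.
- by exists (M * N) => t; rewrite normrM ler_pM.
- by exists (M * N) => t; rewrite normrM ler_pM.
- move=> _; apply: bsmooth1D; apply: IH.
  + exact: bsmooth1S.
  + exact: sv'.
  + exact: bsmooth1S.
  + exact: su'.
Qed.

Lemma bsmooth1Z n c u : bsmooth1 n u -> bsmooth1 n (fun t => c * u t).
Proof. by apply: bsmooth1M; exact: bsmooth1_cst. Qed.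

Definition smooth1 u := forall n, bsmooth1 n u.

(** Asking for boundedness of v' alone, and not of v, covers affine changes of
variable. *)
Lemma smooth1_comp u v v' : smooth1 u -> (forall t : R, is_derive t 1 v (v' t)) ->
  smooth1 v' -> smooth1 (fun t => u (v t)).
Proof.
move=> su dv sv' n; have {}su := su n; elim: n u su => [|n IH] u su;
  have [M _ uM] := bsmooth1_bounded su; have [u' du su'] := bsmooth1_derive su.
  apply: (@bsmooth1_intro _ _ (fun t => u' (v t) * v' t)) => //; by exists M.
apply: (@bsmooth1_intro _ _ (fun t => u' (v t) * v' t)) => //; first by exists M.
by move=> _; apply: bsmooth1M (sv' n); apply: IH; exact: su'.
Qed.

Lemma smooth1_affine u a b : smooth1 u -> smooth1 (fun t => u (a * t + b)).
Proof.
move=> su; apply: (smooth1_comp (v' := fun=> a) su) => [t|n]; last exact: bsmooth1_cst.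
apply: is_derive_eq.
by rewrite [a *: _]mulr1 addr0.
Qed.

Lemma smooth1_sin : smooth1 sin.
Proof.
suff h n : bsmooth1 n (@sin R) /\ bsmooth1 n (@cos R) by move=> n; have [] := h n.
have bs : exists M : R, forall t, `|sin t| <= M.
  by exists 1 => t; rewrite ler_norml sin_geN1 sin_le1.
have bc : exists M : R, forall t, `|cos t| <= M.
  by exists 1 => t; rewrite ler_norml cos_geN1 cos_le1.
elim: n => [|n [IHs IHc]].
  by split; [apply: (bsmooth1_intro bs)|apply: (bsmooth1_intro bc)].
split; first exact: (bsmooth1_intro bs).
apply: (@bsmooth1_intro _ _ (fun t => - 1 * sin t) bc) => [t|_].
  by rewrite mulN1r; exact: is_derive_cos.
exact: bsmooth1Z.
Qed.

(** The functions t^-k exp(-1/t), extended by 0 to t <= 0.  The derivative of the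
k-th one is a combination of the next two, so all of them are smooth. *)
Definition flat k (t : R) : R := if 0 < t then t^-1 ^+ k * expR (- t^-1) else 0.

(** From x^k / k! <= exp x, at x = 1/t. *)
Lemma flat_bounded k t : 0 <= flat k t <= k`!%:R.
Proof.
rewrite /flat; case: ifPn => [t0|_]; last by rewrite lexx ler0n.
have x0 : 0 < t^-1 by rewrite invr_gt0.
apply/andP; split; first by rewrite mulr_ge0 ?expR_ge0// exprn_ge0// ltW.
rewrite expRN ler_pdivrMr ?expR_gt0//.
case: k => [|k]; first by rewrite expr0 mul1r -expR0 ler_expR ltW.
have := expR_ge1Dxn k (ltW x0).
rewrite -ler_pdivrMl ?ltr0n ?fact_gt0// mulrC => h.
by apply: le_trans h; rewrite lerDr.
Qed.

(** Quadratic decay at 0 gives derivative 0 there. *)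
Lemma flat_le_sqr k t : `|flat k t| <= k.+2`!%:R * t ^+ 2.
Proof.
have [t0|t0] := ltrP 0 t; last first.
  by rewrite /flat ltNge t0/= normr0 mulr_ge0// sqr_ge0.
have /andP[f0 f1] := flat_bounded k.+2 t.
have /andP[g0 _] := flat_bounded k t.
rewrite ger0_norm//.
have -> : flat k t = flat k.+2 t * t ^+ 2.
  rewrite /flat t0 2!exprS; field; exact: lt0r_neq0.
by rewrite ler_wpM2r// sqr_ge0.
Qed.

Lemma flat_is_derive k (t : R) :
  is_derive t 1 (flat k) (- k%:R * flat k.+1 t + flat k.+2 t).
Proof.
have [t0|t0|<-] := ltrgtP 0 t; first 1 last.
- have -> : - k%:R * flat k.+1 t + flat k.+2 t = 0.
    by rewrite /flat ltNge (ltW t0)/= mulr0 addr0.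
  apply: (@near_eq_is_derive _ _ _ (cst 0)).
  near=> x; rewrite /flat ltNge (_ : x <= 0)//.
  by apply/ltW; near: x; exact: lt_nbhsl.
- have E0 j : flat j (0 : R) = 0 by rewrite /flat ltxx.
  rewrite !E0 mulr0 addr0.
  have c0 : h^-1 *: (flat k (h *: 1 + 0) - flat k 0) @[h --> (0 : R)^'] --> (0 : R).
    apply/cvgr0Pnorm_le => eps eps0.
    have K0 : 0 < k.+2`!%:R :> R by rewrite ltr0n fact_gt0.
    near=> h; rewrite E0 subr0 addr0.
    rewrite [h *: 1]mulr1 [_ *: _]/(_ * _) normrM normfV.
    have h0 : 0 < `|h| by rewrite normr_gt0; near: h; exact: nbhs_dnbhs_neq.
    rewrite ler_pdivrMl//; apply: le_trans (flat_le_sqr k h) _.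
    rewrite -real_normK ?num_real// expr2 mulrCA ler_wpM2l// -ler_pdivlMl//.
    near: h; by apply: dnbhs0_le; rewrite mulr_gt0 ?invr_gt0.
  apply: DeriveDef; first by apply/cvg_ex; exists 0.
  exact: (cvg_lim _ c0).
- apply: (@near_eq_is_derive _ _ _ (fun t : R => t^-1 ^+ k * expR (- t^-1))).
    near=> x; rewrite /flat (_ : 0 < x)//; near: x; exact: lt_nbhsr.
  have t1 : t != 0 by exact: lt0r_neq0.
  have dV : is_derive t 1 (fun t : R => t^-1) (- t ^- 2).
    apply: is_derive_eq (is_deriveV t1 (is_derive_id t 1)) _.
    by rewrite [_ *: _]mulr1.
  have dX : is_derive t 1 (fun t : R => t^-1 ^+ k) (k%:R * t^-1 ^+ k.-1 * - t ^- 2).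
    have -> : (fun t : R => t^-1 ^+ k) = (fun t : R => t^-1) ^+ k.
      by apply/funext => s; rewrite exprfctE.
    apply: is_derive_eq (is_deriveX k dV) _.
    by [].
  have dE : is_derive t 1 (fun t : R => expR (- t^-1)) (t ^- 2 * expR (- t^-1)).
    apply: is_derive_eq (is_derive1_comp (is_derive_expR _) (is_deriveN dV)) _.
    by rewrite opprK mulrC.
  apply: is_derive_eq (is_deriveM dX dE) _.
  have scaleE (a c : R) : a *: (c : R^o) = a * c by [].
  rewrite /flat t0 !scaleE -exprVn.
  case: k dX => [|k] _ /=; rewrite -?exprVn !exprS ?expr0; ring.
Unshelve. all: by end_near. Qed.

Lemma smooth1_flat k : smooth1 (flat k).
Proof.
move=> n; elim: n k => [|n IH] k.
all: apply: (bsmooth1_intro _ (flat_is_derive k)).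
1,3: by exists k`!%:R => t; have /andP[f0 f1] := flat_bounded k t; rewrite ger0_norm.
  by [].
by move=> _; apply: bsmooth1D => //; exact: bsmooth1Z.
Qed.

(** A smooth substitute for the indicator function of the positive reals:
[step] takes its values in [0, 1], vanishes exactly on the nonpositive reals,
and its dilations increase to that indicator function. *)
Definition step : R -> R := flat 0.

Lemma step01 t : 0 <= step t <= 1.
Proof. exact: flat_bounded 0 t. Qed.

Lemma step_le0 t : t <= 0 -> step t = 0.
Proof. by rewrite /step /flat ltNge => ->. Qed.

Lemma step_dilation_cvg (c : R) : step (N%:R * c) @[N --> \oo] --> ((0 < c)%R%:R : R).
Proof.
have [c0|c0] := ltP 0 c; last first.
  rewrite (_ : (fun N => _) = fun=> 0); first exact: cvg_cst.
  by apply/funext => N; apply: step_le0; rewrite mulr_ge0_le0.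
rewrite mulr1n; apply/cvgrPdist_le => eps eps0; near=> N.
have N0 : 0 < N%:R :> R by rewrite ltr0n; near: N; exact: nbhs_infty_gt.
have /andP[s0 s1] := step01 (N%:R * c).
rewrite ger0_norm ?subr_ge0// /step /flat mulr_gt0// expr0 mul1r.
have := expR_ge1Dx (- (N%:R * c)^-1).
suff : (N%:R * c)^-1 <= eps by lra.
rewrite -[leRHS]invrK lef_pV2 ?posrE ?invr_gt0 ?mulr_gt0//.
rewrite -ler_pdivrMr//; apply: ltW; near: N; exact: nbhs_infty_gtr.
Unshelve. all: by end_near. Qed.

End bounded_smooth1.

(** * Smooth functions of several variables with bounded derivatives *)

Section bounded_smooth.
Context (R : realType) (dim : nat).
Local Notation Rd := 'rV[R]_dim.
Implicit Types phi psi : Rd -> R.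

(** Full differentiability, not only existence of partial derivatives, is carried
along: it is what expresses directional derivatives through partial ones. *)
Fixpoint bsmooth (n : nat) phi : Prop :=
  [/\ exists M : R, forall x, `|phi x| <= M,
      measurable_fun setT phi,
      forall x, differentiable phi x &
      if n is n'.+1 then forall i, bsmooth n' (partial i phi) else True].

Definition bounded_smooth phi := forall n, bsmooth n phi.

Lemma bsmooth_bounded n phi : bsmooth n phi ->
  exists2 M : R, 0 <= M & forall x, `|phi x| <= M.
Proof. by case: n => [|n] [[M uM] _ _ _]; exists M => //; exact: le_trans (normr_ge0 _) (uM 0). Qed.

Lemma bsmooth_measurable n phi : bsmooth n phi -> measurable_fun setT phi.
Proof. by case: n => [|n] []. Qed.

Lemma bsmooth_differentiable n phi x : bsmooth n phi -> differentiable phi x.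
Proof. by case: n => [|n] []. Qed.

Lemma bsmoothS n phi : bsmooth n.+1 phi -> bsmooth n phi.
Proof. by elim: n phi => [|n IH] phi [? ? ? H]; split => // i; exact/IH/H. Qed.

Lemma bounded_smooth_partial phi i : bounded_smooth phi -> bounded_smooth (partial i phi).
Proof. by move=> s n; case: (s n.+1) => _ _ _; exact. Qed.

Lemma bounded_smooth_smooth phi : bounded_smooth phi -> smooth phi.
Proof.
move=> s l; have {s} : bounded_smooth (foldr (@partial R dim) phi l).
  by elim: l => //= i l IH; exact: bounded_smooth_partial.
move=> s; split => [x|i x].
  exact/differentiable_continuous/(bsmooth_differentiable _ (s 0%N)).
exact/diff_derivable/(bsmooth_differentiable _ (s 0%N)).
Qed.

Lemma derive_line phi x v : 'D_v phi x = 'D_1 (fun h : R => phi (h *: v + x)) 0.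
Proof.
rewrite /derive; set g1 := fun h => h^-1 *: _; set g2 := fun h => h^-1 *: _.
suff -> : g1 = g2 by [].
by rewrite funeqE /g1 /g2 => h /=; rewrite addr0 scale0r add0r [_%:A]mulr1.
Qed.

Lemma measurable_translation (c : Rd) : measurable_fun setT (fun x : Rd => x + c).
Proof.
apply: (@measurable_rVP R dim _ Rd) => i; under eq_fun do rewrite mxE.
by apply: measurable_funD => //; exact: measurable_coord.
Qed.

Lemma bsmooth_cst n c : bsmooth n (fun=> c).
Proof.
elim: n c => [|n IH] c; split => //; try by exists `|c|.
move=> i; rewrite (_ : partial i _ = fun=> 0)//.
by apply/funext => x; rewrite /partial derive_cst.
Qed.

Lemma bsmoothD n phi psi : bsmooth n phi -> bsmooth n psi ->
  bsmooth n (fun x => phi x + psi x).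
Proof.
elim: n phi psi => [|n IH] phi psi s t; have [M _ sM] := bsmooth_bounded s;
  have [N _ tN] := bsmooth_bounded t;
  have ms := bsmooth_measurable s; have mt := bsmooth_measurable t;
  have ds x := bsmooth_differentiable x s; have dt x := bsmooth_differentiable x t;
  split => //; try by [exists (M + N) => x; rewrite (le_trans (ler_normD _ _))// lerD
    | exact: measurable_funD | move=> x; exact: differentiableD].
move=> i; rewrite (_ : partial i _ = fun x => partial i phi x + partial i psi x).
  by apply: IH; [case: s => _ _ _; exact|case: t => _ _ _; exact].
by apply/funext => x; rewrite /partial deriveD//; exact: diff_derivable.
Qed.

Lemma bsmoothM n phi psi : bsmooth n phi -> bsmooth n psi ->
  bsmooth n (fun x => phi x * psi x).
Proof.
elim: n phi psi => [|n IH] phi psi s t; have [M M0 sM] := bsmooth_bounded s;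
  have [N N0 tN] := bsmooth_bounded t;
  have ms := bsmooth_measurable s; have mt := bsmooth_measurable t;
  have ds x := bsmooth_differentiable x s; have dt x := bsmooth_differentiable x t;
  split => //; try by [exists (M * N) => x; rewrite normrM ler_pM
    | exact: measurable_funM | move=> x; exact: differentiableM].
move=> i; rewrite (_ : partial i _ =
    fun x => phi x * partial i psi x + psi x * partial i phi x).
  apply: bsmoothD; apply: IH; try exact: bsmoothS.
    by case: t => _ _ _; exact.
  by case: s => _ _ _; exact.
by apply/funext => x; rewrite /partial deriveM//; exact: diff_derivable.
Qed.

Lemma bounded_smooth_cst c : bounded_smooth (fun=> c).
Proof. by move=> n; exact: bsmooth_cst. Qed.

Lemma bounded_smoothD phi psi : bounded_smooth phi -> bounded_smooth psi ->
  bounded_smooth (fun x => phi x + psi x).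
Proof. by move=> s t n; exact: bsmoothD. Qed.

Lemma bounded_smoothM phi psi : bounded_smooth phi -> bounded_smooth psi ->
  bounded_smooth (fun x => phi x * psi x).
Proof. by move=> s t n; exact: bsmoothM. Qed.

Lemma bounded_smooth_prod (I : Type) (s : seq I) (F : I -> Rd -> R) :
  (forall i, bounded_smooth (F i)) -> bounded_smooth (fun x => \prod_(i <- s) F i x).
Proof.
move=> sF; elim: s => [|i s IH].
  by under eq_fun do rewrite big_nil; exact: bounded_smooth_cst.
by under eq_fun do rewrite big_cons; exact: bounded_smoothM.
Qed.

Lemma bounded_smooth_coord (u : R -> R) (j : 'I_dim) : smooth1 u ->
  bounded_smooth (fun x : Rd => u (x 0 j)).
Proof.
move=> su n; have {}su := su n; elim: n u su => [|n IH] u su;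
  have [M _ uM] := bsmooth1_bounded su; have [u' du su'] := bsmooth1_derive su.
all: have du1 (t : R) : differentiable u t by
  apply/derivable1_diffP; have [] := du t.
all: have dc (x : Rd) : differentiable (fun x : Rd => u (x 0 j)) x by
  apply: (@differentiable_comp _ _ _ _ (fun x : Rd => x 0 j) u);
  [exact: differentiable_coord|exact: du1].
all: have mc : measurable_fun setT (fun x : Rd => u (x 0 j)) by
  apply: measurableT_comp (measurable_coord j);
  apply: continuous_measurable_fun => t; exact: differentiable_continuous.
all: split => //; try by exists M.
move=> i; rewrite (_ : partial i _ = fun x => (i == j)%:R * u' (x 0 j)).
  by apply: bsmoothM; [exact: bsmooth_cst|exact/IH/su'].
apply/funext => x; rewrite /partial derive_line.
have dl : is_derive (0 : R) 1 (fun h : R => (h *: delta_mx 0 i + x) 0 j : R) (i == j)%:R.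
  rewrite (_ : (fun h => _) = fun h : R => (i == j)%:R * h + x 0 j).
    by apply: is_derive_eq; rewrite [_ *: _]mulr1 addr0.
  by apply/funext => h; rewrite !mxE eqxx/= mulrC eq_sym.
have := is_derive1_comp (du ((0 *: delta_mx 0 i + x) 0 j)) dl.
by rewrite scale0r add0r => /(@derive_val _ _ _ _ _ _ _) ->; rewrite mulrC.
Qed.

Lemma partial_translate i phi c x :
  partial i (fun x => phi (x + c)) x = partial i phi (x + c).
Proof.
rewrite /partial /derive.
set g1 := fun h => h^-1 *: _; set g2 := fun h => h^-1 *: _.
by suff -> : g1 = g2 by []; rewrite funeqE /g1 /g2 => h /=; rewrite addrA.
Qed.

Lemma bounded_smooth_translate phi c : bounded_smooth phi ->
  bounded_smooth (fun x => phi (x + c)).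
Proof.
move=> s n; have {}s := s n; elim: n phi s => [|n IH] phi s;
  have [M _ sM] := bsmooth_bounded s; have ms := bsmooth_measurable s;
  have ds x := bsmooth_differentiable x s.
all: have dc (x : Rd) : differentiable (fun x : Rd => phi (x + c)) x by
  apply: (@differentiable_comp _ _ _ _ (fun x : Rd => x + c) phi) => //;
  exact: differentiableD.
all: have mc : measurable_fun setT (fun x : Rd => phi (x + c)) by
  apply: measurableT_comp ms (measurable_translation c).
all: split => //; try by exists M.
move=> i; rewrite (_ : partial i _ = fun x => partial i phi (x + c)).
  by apply: IH; case: s => _ _ _; exact.
by apply/funext => x; exact: partial_translate.
Qed.

Lemma line_is_derive phi x h (t : R) : (forall x, differentiable phi x) ->
  is_derive t 1 (fun t : R => phi (x + t *: h)) ('D_h phi (x + t *: h)).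
Proof.
move=> dphi.
have dl : derivable (fun s : R => phi (s *: h + (x + t *: h))) 0 1.
  by apply: (derivable1P phi _ _).1; apply: diff_derivable; exact: dphi.
have dl' := derivableP dl; rewrite -derive_line in dl'.
have ds : is_derive t 1 (fun s : R => s - t) 1.
  by apply: is_derive_eq; rewrite subr0.
rewrite -(subrr t) in dl'; have := @is_derive1_comp R _ (fun s : R => s - t) t _ _ dl' ds.
rewrite mulr1 (_ : _ \o _ = fun t => phi (x + t *: h))//.
by apply/funext => s /=; rewrite scalerBl addrCA subrK.
Qed.

Lemma derive_dot phi x h : differentiable phi x ->
  'D_h phi x = \sum_(i < dim) h 0 i * partial i phi x.
Proof.
move=> dphi; rewrite deriveE// {1}(row_sum_delta h) linear_sum.
by apply: eq_bigr => i _; rewrite linearZ/= /partial deriveE.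
Qed.

End bounded_smooth.

(** * Approximation of indicator functions in weighted L1 *)

Section dominated.
Context d (T : measurableType d) (R : realType) (m : {measure set T -> \bar R}).

Lemma dominated_nrm (F : nat -> T -> R) (f g : T -> R) :
  (forall N, measurable_fun setT (F N)) -> measurable_fun setT f -> integ m g ->
  (forall N x, `|F N x| <= g x) ->
  {ae m, forall x, F N x @[N --> \oo] --> f x} ->
  nrm m (fun x => F N x - f x) @[N --> \oo] --> 0.
Proof.
move=> mF mf Ig Fg Ff.
have IF N : integ m (F N) by apply: (ae_le_integ (mF N) Ig); exact/aeW.
have Ff' : {ae m, forall x, setT x -> (F N x)%:E @[N --> \oo] --> (EFin \o f) x}.
  by apply: filterS Ff => x Fx _; apply: cvg_EFin Fx; exact: nearW.
have mf' : measurable_fun setT (EFin \o f) by exact/measurable_EFinP.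
have dom : {ae m, forall x n, setT x -> (`|(F n x)%:E| <= (EFin \o g) x)%E}.
  by apply/aeW => x n _; rewrite lee_fin.
have [If cv _] := dominated_convergence measurableT
  (fun n => measurable_int _ (IF n)) mf' Ff' Ig dom.
rewrite (_ : (fun N => _) = (fun N => fine (\int[m]_x `|(F N x)%:E - (f x)%:E|)%E)).
  exact: fine_cvg cv.
by apply/funext => N; rewrite -[LHS]/(fine (nrm m _)%:E) EFin_nrm//; exact: integB.
Qed.

End dominated.

Section approximation.
Context d (T : measurableType d) (R : realType) (m : {measure set T -> \bar R}).
Variables (g : T -> R) (P : set (T -> R)).
Hypothesis Ig : integ m g.
Hypothesis P_measurable : forall phi, P phi -> measurable_fun setT phi.
Hypothesis P01 : forall phi x, P phi -> 0 <= phi x <= 1.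
Hypothesis P0 : P (fun=> 0).
Hypothesis PC : forall phi, P phi -> P (fun x => 1 - phi x).
Hypothesis PM : forall phi psi, P phi -> P psi -> P (fun x => phi x * psi x).

(** The weight g is the integrable function against which test functions will be
integrated; it allows m itself to be infinite. *)
Definition approximable (A : set T) : Prop := measurable A /\
  forall eps : R, 0 < eps -> exists2 phi, P phi &
    nrm m (fun x => (\1_A x - phi x) * g x) <= eps.

Let indic01 (A : set T) x : 0 <= (\1_A x : R) <= 1.
Proof. by rewrite indicE; case: (_ \in _); rewrite ?lexx ?ler01. Qed.

Let abs_le1 (a b : R) : 0 <= a <= 1 -> 0 <= b <= 1 -> `|a - b| <= 1.
Proof. by move=> ? ?; rewrite ler_norml; lra. Qed.

Lemma integ_indicB A phi : measurable A -> P phi ->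
  integ m (fun x => (\1_A x - phi x) * g x).
Proof.
move=> mA Pphi; under [X in _ \o X]funext do rewrite mulrC.
apply: (integ_bounded Ig (B := 1)) => [|x]; last exact: (abs_le1 (indic01 _ _) (P01 _ _)).
by apply: measurable_funB; [exact: measurable_indic|exact: P_measurable].
Qed.

Lemma approximable_cvg A (phi : nat -> T -> R) : measurable A ->
  (forall N, P (phi N)) ->
  {ae m, forall x, phi N x @[N --> \oo] --> (\1_A x : R)} -> approximable A.
Proof.
move=> mA Pphi cphi; split => // eps eps0.
have cv : nrm m (fun x => (\1_A x - phi N x) * g x - 0) @[N --> \oo] --> 0.
  apply: (@dominated_nrm _ _ _ m (fun N x => (\1_A x - phi N x) * g x) (fun=> 0)
    (fun x => `|g x|)) => //.
  - by move=> N; exact/integ_measurable/integ_indicB.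
  - exact: integ_abs.
  - by move=> N x; rewrite normrM ler_piMl// (abs_le1 (indic01 _ _) (P01 _ _)).
  apply: filterS cphi => x cx.
  have := cvgM (cvgB (@cvg_cst _ (\1_A x : R) _ _ _) cx) (@cvg_cst _ (g x) _ _ _).
  by rewrite subrr mul0r; apply.
have /cvgr0_norm_le/(_ _ eps0)[N _ NP] := cv.
exists (phi N) => //.
have := NP N (leqnn N); rewrite ger0_norm ?nrm_ge0//.
by under eq_fun do rewrite subr0.
Qed.

Lemma approximableC A : approximable A -> approximable (~` A).
Proof.
move=> [mA hA]; split; first exact: measurableC.
move=> eps eps0; have [phi Pphi h] := hA _ eps0.
exists (fun x => 1 - phi x); first exact: PC.
apply: le_trans h; rewrite -[leRHS]nrmN le_eqVlt; apply/orP; left; apply/eqP.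
congr nrm; apply/funext => x; rewrite !indicE in_setC.
by case: (x \in A) => /=; ring.
Qed.

(** 1 - (1 - phi)(1 - psi) approximates the union: its error is at most the sum of the
errors, since all functions take their values in [0, 1]. *)
Lemma approximableU A B : approximable A -> approximable B -> approximable (A `|` B).
Proof.
move=> [mA hA] [mB hB]; split; first exact: measurableU.
move=> eps eps0; have e2 : 0 < eps / 2 by rewrite divr_gt0.
have [phi Pphi h] := hA _ e2; have [psi Ppsi k] := hB _ e2.
exists (fun x => 1 - (1 - phi x) * (1 - psi x)); first by apply/PC/PM; exact: PC.
have IA := integ_indicB mA Pphi; have IB := integ_indicB mB Ppsi.
rewrite [leRHS](splitr eps); apply: le_trans (lerD h k).
rewrite /nrm -RintegralD//; [|exact: integ_abs..].
apply: ae_le_Rint; last 1 first.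
- apply/aeW => x; rewrite !normrM -mulrDl ler_wpM2r//.
  have /andP[a0 a1] := P01 x Pphi; have /andP[b0 b1] := P01 x Ppsi.
  rewrite !indicE in_setU; move: a0 a1 b0 b1; set a := phi x; set b := psi x.
  move=> a0 a1 b0 b1; case: (x \in A); case: (x \in B) => /=.
  + rewrite (_ : _ - _ = (1 - a) * (1 - b)); last by ring.
    rewrite [X in X <= _]ger0_norm; last by rewrite mulr_ge0 ?subr_ge0.
    by rewrite !ger0_norm ?subr_ge0//; nra.
  + rewrite (_ : _ - _ = (1 - a) * (1 - b)); last by ring.
    rewrite [X in X <= _]ger0_norm; last by rewrite mulr_ge0 ?subr_ge0.
    by rewrite (@ger0_norm _ (1%:R - a)) ?subr_ge0//; have := normr_ge0 (0%:R - b); nra.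
  + rewrite (_ : _ - _ = (1 - a) * (1 - b)); last by ring.
    rewrite [X in X <= _]ger0_norm; last by rewrite mulr_ge0 ?subr_ge0.
    by rewrite (@ger0_norm _ (1%:R - b)) ?subr_ge0//; have := normr_ge0 (0%:R - a); nra.
  + rewrite !sub0r !normrN (ger0_norm a0) (ger0_norm b0) ger0_norm; nra.
- apply/integ_abs/integ_indicB; first exact: measurableU.
  by apply/PC/PM; exact: PC.
- by apply: integD; exact: integ_abs.
Qed.

Lemma approximable0 : approximable set0.
Proof.
apply: (@approximable_cvg _ (fun _ _ => 0)) => //.
by apply/aeW => x; rewrite indic0; exact: cvg_cst.
Qed.

(** Finite unions approximate a countable union by dominated convergence. *)
Lemma approximable_bigcup (A : nat -> set T) : (forall n, approximable (A n)) ->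
  approximable (\bigcup_n A n).
Proof.
move=> hA; pose B n := \big[setU/set0]_(i < n) A i.
have hB n : approximable (B n).
  rewrite /B; elim: n => [|n IH]; first by rewrite big_ord0; exact: approximable0.
  by rewrite big_ord_recr; exact: approximableU.
have mA n := (hA n).1; have mB n := (hB n).1.
have mU : measurable (\bigcup_n A n) by exact: bigcupT_measurable.
split => // eps eps0; have e2 : 0 < eps / 2 by rewrite divr_gt0.
have cB x : (\1_(B N) x : R) @[N --> \oo] --> (\1_(\bigcup_n A n) x : R).
  rewrite !indicE; have [|Ux] := boolP (x \in \bigcup_n A n).
    rewrite inE => -[n _ Anx].
    apply: cvg_near_cst; exists n.+1 => // N /= nN; rewrite indicE mem_set// /B -bigcup_mkord.
    by exists n.
  rewrite (_ : (fun _ => _) = fun=> 0); first exact: cvg_cst.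
  apply/funext => N; rewrite indicE memNset// /B -bigcup_mkord => -[i _ Aix].
  by case/negP: Ux; rewrite inE; exists i.
have cv : nrm m (fun x => \1_(B N) x * g x - \1_(\bigcup_n A n) x * g x) @[N --> \oo] --> 0.
  apply: (@dominated_nrm _ _ _ m (fun N x => \1_(B N) x * g x) _ (fun x => `|g x|)).
  - by move=> N; apply: measurable_funM (integ_measurable Ig); exact: measurable_indic.
  - by apply: measurable_funM (integ_measurable Ig); exact: measurable_indic.
  - exact: integ_abs.
  - move=> N x; rewrite normrM ler_piMl// ger0_norm; by have /andP[] := indic01 (B N) x.
  - by apply/aeW => x; exact: cvgM (cB x) (cvg_cst _).
have /cvgr0_norm_le/(_ _ e2)[N _ NP] := cv.
have {NP} := NP N (leqnn N); rewrite ger0_norm ?nrm_ge0// => hN.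
have [phi Pphi h] := (hB N).2 _ e2.
exists phi => //; rewrite [leRHS](splitr eps); apply: le_trans (lerD hN h).
have Ii (C : set T) : measurable C -> integ m (fun x => \1_C x * g x).
  move=> mC; under [X in _ \o X]funext do rewrite mulrC.
  apply: (integ_bounded Ig (B := 1)); first exact: measurable_indic.
  by move=> x; rewrite ger0_norm; have /andP[] := indic01 C x.
have Ip : integ m (fun x => phi x * g x).
  under [X in _ \o X]funext do rewrite mulrC.
  apply: (integ_bounded Ig (B := 1)); first exact: P_measurable.
  by move=> x; have /andP[? ?] := P01 x Pphi; rewrite ger0_norm.
have E (C : set T) : (fun x => (\1_C x - phi x) * g x) =
    (fun x => \1_C x * g x - phi x * g x) by apply/funext => x; rewrite mulrBl.
by rewrite [X in _ <= X + _]nrm_distC !E; exact: (nrm_tri (Ii _ mU) (Ii _ (mB N)) Ip).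
Qed.

Lemma approximable_sigma_algebra : sigma_algebra setT approximable.
Proof.
split; first exact: approximable0.
  by move=> A hA; rewrite setTD; exact: approximableC.
exact: approximable_bigcup.
Qed.

End approximation.

(** * Test functions in translation-invariant settings *)

Import HBSimple.

Section translation_setting_def.
Context (R : realType) (dim : nat).
Local Notation Rd := 'rV[R]_dim.
Variables (M : {measure set Rd -> \bar R}) (Lam : set Rd).
Variables (supp : (Rd -> R) -> Prop) (chi : nat -> Rd -> R).

Definition Lam_periodic (T : Type) (f : Rd -> T) := forall x z, Lam z -> f (x + z) = f x.

Definition test_fun (phi : Rd -> R) := [/\ bounded_smooth phi, Lam_periodic phi & supp phi].

Definition smooth01 (phi : Rd -> R) := [/\ bounded_smooth phi, Lam_periodic phi &
  forall x, 0 <= phi x <= 1].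

(** What Lebesgue measure on R^d (no periods, compact supports) and on a
fundamental cell of Z^d (integer periods, no condition on supports) have in
common.  The functions chi are cut-offs, which bring functions without support
condition into the class of test functions; [ts_rays] provides smooth
approximations of the half-spaces that generate the Borel sets. *)
Record translation_setting : Prop := TranslationSetting {
  ts_invariant : forall (f : Rd -> R) (c : Rd), measurable_fun setT f ->
    (forall x, 0 <= f x) -> Lam_periodic f ->
    (\int[M]_x (f (x + c)%R)%:E = \int[M]_x (f x)%:E)%E;
  ts_suppM : forall phi psi, supp psi -> supp (fun x => phi x * psi x);
  ts_suppD : forall phi psi, supp phi -> supp psi -> supp (fun x => phi x + psi x);
  ts_supp_translate : forall phi (c : Rd), supp phi -> supp (fun x => phi (x + c));
  ts_test_integ : forall phi, test_fun phi -> integ M phi;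
  ts_translate_cvg : forall psi, test_fun psi -> forall eps : R, 0 < eps ->
    exists2 del : R, 0 < del & forall h : Rd, `|h| < del ->
      nrm M (fun x => psi (x + h) - psi x) <= eps;
  ts_chi_test : forall N, test_fun (chi N);
  ts_chi01 : forall N x, 0 <= chi N x <= 1;
  ts_chi_cvg : {ae M, forall x, chi N x @[N --> \oo] --> (1 : R)};
  ts_rays : forall (i : 'I_dim) (a : R), exists2 phi : nat -> Rd -> R,
    forall N : nat, smooth01 (phi N) &
    {ae M, forall x, phi N x @[N --> \oo] --> (\1_[set x : Rd | a < x 0 i] x : R)} }.

End translation_setting_def.

Section translation_setting.
Context (R : realType) (dim : nat).
Local Notation Rd := 'rV[R]_dim.
Context (M : {measure set Rd -> \bar R}).
Variables (Lam : set Rd) (supp : (Rd -> R) -> Prop) (chi : nat -> Rd -> R).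
Implicit Types (f g phi psi : Rd -> R) (c : Rd).

Local Notation Lam_periodic := (@Lam_periodic R dim Lam _).
Local Notation test_fun := (@test_fun R dim Lam supp).
Local Notation smooth01 := (@smooth01 R dim Lam).

Hypothesis setting : translation_setting M Lam supp chi.

Let M_invariant := ts_invariant setting.
Let suppM := ts_suppM setting.
Let suppD := ts_suppD setting.
Let supp_translate := ts_supp_translate setting.
Let test_integ := ts_test_integ setting.
Let test_translate_cvg := ts_translate_cvg setting.
Let chi_test := ts_chi_test setting.
Let chi01 := ts_chi01 setting.
Let chi_cvg := ts_chi_cvg setting.
Let rays := ts_rays setting.

(** ** Invariance of integrals *)

Lemma translate_measurable f c : measurable_fun setT f ->
  measurable_fun setT (fun x : Rd => f (x + c)).
Proof. by move=> mf; apply: measurableT_comp mf (measurable_translation c). Qed.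

Lemma translate_periodic (T : Type) (f : Rd -> T) c : Lam_periodic f ->
  Lam_periodic (fun x => f (x + c)).
Proof. by move=> pf x z Lz; rewrite addrAC; exact: pf. Qed.

Lemma translate_integ f c : integ M f -> Lam_periodic f -> integ M (fun x => f (x + c)).
Proof.
move=> If pf; have mf := integ_measurable If.
apply/integrableP; split; first by apply/measurable_EFinP; exact: translate_measurable.
have /integrableP[_] := If; rewrite (_ : (\int[M]_x `|(EFin \o f) x|)%E =
  (\int[M]_x `|(EFin \o (fun x => f (x + c)%R)) x|)%E)//.
apply/esym/(M_invariant (f := fun x => `|f x|)) => //.
  exact: measurableT_comp.
by move=> x z Lz; rewrite pf.
Qed.

Lemma translate_nrm f c : measurable_fun setT f -> Lam_periodic f ->
  nrm M (fun x => f (x + c)) = nrm M f.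
Proof.
move=> mf pf; congr fine; apply: (M_invariant (f := fun x => `|f x|)) => //.
  exact: measurableT_comp.
by move=> x z Lz; rewrite pf.
Qed.

(** Invariance is known for nonnegative functions; f + |f| and |f| are nonnegative. *)
Lemma translate_Rint f c : integ M f -> Lam_periodic f ->
  \int[M]_x f (x + c) = \int[M]_x f x.
Proof.
move=> If pf; have IA := integ_abs If; have ID := integD If IA.
have Ifc := translate_integ c If pf; have IAc := integ_abs Ifc.
have h1 : \int[M]_x (f (x + c) + `|f (x + c)|) = \int[M]_x (f x + `|f x|).
  congr fine; apply: (M_invariant (f := fun x => f x + `|f x|)) => //.
  - exact: integ_measurable ID.
  - by move=> x; have := lerNnormlW (lexx `|f x|); rewrite -subr_ge0 opprK addrC.
  - by move=> x z Lz; rewrite pf.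
have h2 : nrm M (fun x => f (x + c)) = nrm M f.
  exact: (translate_nrm c (integ_measurable If) pf).
move: h1; rewrite !RintegralD// -/(nrm M _) h2.
exact: addIr.
Qed.

(** ** Indicator functions *)

Lemma smooth01_measurable phi : smooth01 phi -> measurable_fun setT phi.
Proof. by case=> s _ _; exact: (bsmooth_measurable (s 0%N)). Qed.

Lemma smooth01C phi : smooth01 phi -> smooth01 (fun x => 1 - phi x).
Proof.
move=> [s p h]; split.
- rewrite (_ : (fun x => _) = fun x => 1 + (-1) * phi x); last first.
    by apply/funext => x; ring.
  apply: bounded_smoothD; first exact: bounded_smooth_cst.
  by apply: bounded_smoothM => //; exact: bounded_smooth_cst.
- by move=> x z Lz; rewrite p.
- by move=> x; have := h x; lra.
Qed.

Lemma smooth01M phi psi : smooth01 phi -> smooth01 psi ->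
  smooth01 (fun x => phi x * psi x).
Proof.
move=> [s p h] [t q k]; split.
- exact: bounded_smoothM.
- by move=> x z Lz; rewrite p// q.
- move=> x; have /andP[? ?] := h x; have /andP[? ?] := k x.
  by rewrite mulr_ge0//= mulr_ile1.
Qed.

Lemma smooth01_0 : smooth01 (fun=> 0).
Proof. by split => //; [exact: bounded_smooth_cst|move=> x; rewrite lexx ler01]. Qed.

(** The approximable sets form a sigma-algebra, and half-spaces orthogonal to a
coordinate axis generate the Borel sets. *)
Lemma measurable_approximable g (A : set Rd) : integ M g -> measurable A ->
  approximable M g smooth01 A.
Proof.
move=> Ig.
have P01 phi x : smooth01 phi -> 0 <= phi x <= 1 by case.
have sa : sigma_algebra setT (approximable M g smooth01).
  apply: approximable_sigma_algebra => //.
  - exact: smooth01_measurable.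
  - exact: smooth01_0.
  - exact: smooth01C.
  - exact: smooth01M.
move: A; apply: smallest_sub => // A; rewrite -bigcup_seq/= => -[i _ [Y mY <-]].
rewrite setTI.
have : RGenOInfty.G (R := R) .-sigma.-measurable Y by rewrite -RGenOInfty.measurableE.
move: Y {mY}; apply: smallest_sub => [|Y [a ->]].
  have [sa0 saC saU] := sa; split => /=.
  - by rewrite preimage_set0.
  - move=> Y hY; rewrite setTD preimage_setC -setTD; exact: saC.
  - by move=> F hF; rewrite preimage_bigcup; exact: saU.
have [phi sphi cphi] := rays i a.
apply: (@approximable_cvg _ _ _ M g smooth01 Ig _ _ _ phi) => //.
- exact: smooth01_measurable.
- have := @measurable_coord R dim i measurableT `]a, +oo[%classic (measurable_itv _).
  by rewrite setTI.
apply: filterS cphi => x; rewrite (_ : _ @^-1` _ = [set x : Rd | a < x 0 i])//.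
by apply/seteqP; split => y /=; rewrite in_itv/= andbT.
Qed.

Lemma chi_mul_cvg f : integ M f ->
  nrm M (fun x => f x * chi N x - f x) @[N --> \oo] --> 0.
Proof.
move=> If; have mf := integ_measurable If.
apply: (@dominated_nrm _ _ _ M (fun N x => f x * chi N x) f (fun x => `|f x|)) => //.
- move=> N; apply: measurable_funM => //.
  by have [s _ _] := chi_test N; exact: (bsmooth_measurable (s 0%N)).
- exact: integ_abs.
- by move=> N x; have /andP[? ?] := chi01 N x; rewrite normrM ler_piMr// ger0_norm.
apply: filterS chi_cvg => x cx.
by have := cvgM (@cvg_cst _ (f x) _ _ _) cx; rewrite mulr1; apply.
Qed.

(** ** The L1 norm is a supremum over test functions *)

(** It suffices to test against approximations of the sign of g. *)
Lemma nrm_le_test g (C : R) : integ M g ->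
  (forall phi, test_fun phi -> (forall x, `|phi x| <= 1) ->
     `|\int[M]_x (g x * phi x)| <= C) ->
  nrm M g <= C.
Proof.
move=> Ig HC; have mg := integ_measurable Ig.
apply/ler_addgt0Pr => eps eps0.
have e4 : 0 < eps / 4 by rewrite divr_gt0.
have mA : measurable [set x | 0 < g x].
  rewrite -[X in measurable X]setTI (_ : [set x | 0 < g x] = g @^-1` `]0, +oo[%classic).
    exact: mg.
  by apply/seteqP; split => x /=; rewrite in_itv/= andbT.
have [_ /(_ _ e4)[phi [sphi pphi phi01] hphi]] := measurable_approximable Ig mA.
have /cvgr0_norm_le/(_ _ e4)[N _ NP] := chi_mul_cvg Ig.
have {NP} := NP N (leqnn N); rewrite ger0_norm ?nrm_ge0// => hN.
(* A test function close to the sign of g. *)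
pose psi x := (2 * phi x - 1) * chi N x.
have [schi pchi supchi] := chi_test N.
have tpsi : test_fun psi.
  split.
  - apply: bounded_smoothM => //.
    rewrite (_ : (fun x => _) = fun x => 2 * phi x + (-1))//.
    apply: bounded_smoothD; last exact: bounded_smooth_cst.
    by apply: bounded_smoothM => //; exact: bounded_smooth_cst.
  - by move=> x z Lz; rewrite /psi pphi// pchi.
  - exact: suppM.
have psi1 x : `|psi x| <= 1.
  have := phi01 x; have := chi01 N x; rewrite /psi normrM => /andP[a b] c.
  by rewrite mulr_ile1 ?normr_ge0// ler_norml; lra.
have mpsi : measurable_fun setT psi by case: tpsi => s _ _; exact: (bsmooth_measurable (s 0%N)).
have Igp : integ M (fun x => g x * psi x) by exact: integ_bounded Ig mpsi psi1.
have I1 : integ M (fun x => (\1_[set x | 0 < g x] x - phi x) * g x).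
  apply: (integ_indicB Ig (P := smooth01)) => //.
  - exact: smooth01_measurable.
  - by move=> f x [].
have I2 : integ M (fun x => g x * chi N x - g x).
  apply: integB => //; apply: (integ_bounded Ig (B := 1)).
    exact: (bsmooth_measurable (schi 0%N)).
  by move=> x; have /andP[? ?] := chi01 N x; rewrite ger0_norm.
have key : nrm M g <= \int[M]_x (g x * psi x) +
   (2 * nrm M (fun x => (\1_[set x | 0 < g x] x - phi x) * g x) +
    nrm M (fun x => g x * chi N x - g x)).
  rewrite /nrm -RintegralZl//; last exact: integ_abs.
  rewrite -RintegralD//; [|exact/integZ/integ_abs|exact: integ_abs].
  rewrite -RintegralD//; last by apply: integD; [exact/integZ/integ_abs|exact: integ_abs].
  apply: ae_le_Rint; first exact: integ_abs.
    by apply: integD => //; apply: integD; [exact/integZ/integ_abs|exact: integ_abs].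
  apply/aeW => x; rewrite /psi indicE.
  have := phi01 x; have := chi01 N x; move: (phi x) (chi N x) => p c.
  move=> /andP[c0 c1] /andP[p0 p1].
  have -> : g x * c - g x = - (g x * (1 - c)) by ring.
  rewrite normrN !normrM (ger0_norm (_ : 0 <= 1 - c)) ?subr_ge0//.
  have [g0|g0] := ltrP 0 (g x).
    rewrite mem_set//= (gtr0_norm g0) ger0_norm ?subr_ge0//.
    have : 0 <= (1 - p) * (1 - c) by rewrite mulr_ge0 ?subr_ge0.
    move=> /(ler_wpM2l (ltW g0)); nra.
  rewrite memNset//=; last by rewrite ltNge g0.
  rewrite (ler0_norm g0) sub0r normrN (ger0_norm p0).
  have : 0 <= p * (1 - c) by rewrite mulr_ge0 ?subr_ge0.
  have := oppr_ge0 (g x); rewrite g0 => gn.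
  by move=> /(ler_wpM2l gn); nra.
apply: le_trans key _; apply: lerD.
  by apply: le_trans (ler_norm _) _; exact: HC.
by move: hphi hN; lra.
Qed.

(** ** Density of test functions *)

Definition test_closure f := forall eps : R, 0 < eps ->
  exists2 psi, test_fun psi & nrm M (fun x => f x - psi x) <= eps.

Lemma test_funD phi psi : test_fun phi -> test_fun psi ->
  test_fun (fun x => phi x + psi x).
Proof.
move=> [s p h] [t q k]; split; first exact: bounded_smoothD.
- by move=> x z Lz; rewrite p// q.
- exact: suppD.
Qed.

Lemma test_funM phi psi : bounded_smooth phi -> Lam_periodic phi -> test_fun psi ->
  test_fun (fun x => phi x * psi x).
Proof.
move=> s p [t q k]; split; first exact: bounded_smoothM.
- by move=> x z Lz; rewrite p// q.
- exact: suppM.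
Qed.

Lemma test_funZ (c : R) psi : test_fun psi -> test_fun (fun x => c * psi x).
Proof. by move=> tp; apply: test_funM => //; exact: bounded_smooth_cst. Qed.

Lemma test_closureD f g : integ M f -> integ M g -> test_closure f -> test_closure g ->
  test_closure (fun x => f x + g x).
Proof.
move=> If Ig cf cg eps eps0; have e2 : 0 < eps / 2 by rewrite divr_gt0.
have [phi tphi h] := cf _ e2; have [psi tpsi k] := cg _ e2.
exists (fun x => phi x + psi x); first exact: test_funD.
have [Iphi Ipsi] := (test_integ tphi, test_integ tpsi).
rewrite [leRHS](splitr eps); apply: le_trans (lerD h k).
rewrite (_ : (fun x => _) = fun x => (f x - phi x) + (g x - psi x)).
  by apply: nrmD; exact: integB.
by apply/funext => x; ring.
Qed.

Lemma test_closureZ (c : R) f : integ M f -> test_closure f ->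
  test_closure (fun x => c * f x).
Proof.
move=> If cf eps eps0; have c0 : 0 < `|c| + 1 by rewrite ltr_wpDl.
have [|phi tphi h] := cf (eps / (`|c| + 1)); first by rewrite divr_gt0.
exists (fun x => c * phi x); first exact: test_funZ.
rewrite (_ : (fun x => _) = fun x => c * (f x - phi x)); last first.
  by apply/funext => x; ring.
rewrite nrmZ; last by apply: integB => //; exact: test_integ.
apply: (@le_trans _ _ ((`|c| + 1) * nrm M (fun x => f x - phi x))).
  by rewrite ler_wpM2r ?nrm_ge0// lerDl.
by rewrite mulrC -ler_pdivlMr.
Qed.

Lemma test_closure_sum (I : Type) (s : seq I) (F : I -> Rd -> R) :
  (forall i, integ M (F i)) -> (forall i, test_closure (F i)) ->
  test_closure (fun x => \sum_(i <- s) F i x).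
Proof.
move=> IF cF; elim: s => [|i s IH].
  move=> eps eps0; exists (fun x => 0 * chi 0 x); first exact: test_funZ.
  rewrite (_ : (fun x => _) = fun=> 0) ?nrm0 ?ltW//.
  by apply/funext => x; rewrite big_nil mul0r subrr.
under eq_fun do rewrite big_cons.
by apply: test_closureD => //; exact: integ_sum.
Qed.

Lemma test_closure_lim f : integ M f -> (forall eps : R, 0 < eps ->
  exists f', [/\ integ M f', test_closure f' & nrm M (fun x => f x - f' x) <= eps]) ->
  test_closure f.
Proof.
move=> If hf eps eps0; have e2 : 0 < eps / 2 by rewrite divr_gt0.
have [f' [If' cf' ff']] := hf _ e2; have [phi tphi h] := cf' _ e2.
exists phi => //; rewrite [leRHS](splitr eps); apply: le_trans (lerD ff' h).
by apply: nrm_tri => //; exact: test_integ.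
Qed.

Lemma test_closure_chi_indic N (A : set Rd) : measurable A ->
  test_closure (fun x => \1_A x * chi N x).
Proof.
move=> mA eps eps0; have tN := chi_test N; have IN := test_integ tN.
have [_ /(_ _ eps0)[phi [sphi pphi _] h]] := measurable_approximable IN mA.
exists (fun x => phi x * chi N x); first exact: test_funM.
by under eq_fun do rewrite -mulrBl.
Qed.

(** Integrable functions are limits of simple functions, and those of combinations of
cut-off indicator functions. *)
Lemma test_dense f : integ M f -> test_closure f.
Proof.
move=> If.
suff sf (s : {sfun Rd >-> R}) : integ M (s : Rd -> R) -> test_closure s.
  apply: test_closure_lim => // eps eps0.
  have [s_ [Is _ cs]] := approximation_sfun_integrable measurableT If.
  have cs' : nrm M (fun x => f x - s_ n x) @[n --> \oo] --> 0.
    rewrite (_ : (fun n => _) =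
        (fun n => fine (\int[M]_x `|(f x)%:E - (s_ n x)%:E|)%E)).
      exact: fine_cvg cs.
    by apply/funext => n; rewrite -[LHS]/(fine (nrm M _)%:E) EFin_nrm//; exact: integB.
  have /cvgr0_norm_le/(_ _ eps0)[n _ nP] := cs'.
  exists (s_ n); split => //; last first.
    by have := nP n (leqnn n); rewrite ger0_norm// nrm_ge0.
  exact: sf.
move=> Is; apply: test_closure_lim => // eps eps0.
have /cvgr0_norm_le/(_ _ eps0)[N _ NP] := chi_mul_cvg Is.
have {NP} := NP N (leqnn N); rewrite ger0_norm ?nrm_ge0// nrm_distC => hN.
have [sN _ _] := chi_test N.
have IchiA A : measurable A -> integ M (fun x => \1_A x * chi N x).
  move=> mA; under [X in _ \o X]funext do rewrite mulrC.
  apply: (integ_bounded (test_integ (chi_test N)) (B := 1)).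
    exact: measurable_indic.
  by move=> x; rewrite indicE; case: (_ \in _); rewrite ?normr1 ?normr0.
exists (fun x => s x * chi N x); split => //.
  apply: (integ_bounded Is (B := 1)); first exact: (bsmooth_measurable (sN 0%N)).
  by move=> x; have /andP[? ?] := chi01 N x; rewrite ger0_norm.
pose l : seq R := finmap.enum_fset (fset_set (range s)).
rewrite (_ : (fun x => _) = fun x =>
    \sum_(y <- l) y * (\1_(s @^-1` [set y]) x * chi N x)).
  have mi (y : R) : measurable (s @^-1` [set y]).
    by rewrite -[_ @^-1` _]setTI; exact: measurable_funP.
  apply: test_closure_sum => [y|y]; first exact/integZ/IchiA.
  by apply: test_closureZ; [exact: IchiA|exact: test_closure_chi_indic].
apply/funext => x; rewrite (fimfunE s x) fsbig_finite//= mulr_suml.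
by apply: eq_bigr => y _; rewrite mulrA.
Qed.

(** Translations are isometries, so continuity need only be checked on the dense class
of test functions. *)
Lemma translation_continuous g : integ M g -> Lam_periodic g ->
  forall eps : R, 0 < eps -> exists2 del : R, 0 < del &
    forall h : Rd, `|h| < del -> nrm M (fun x => g (x + h) - g x) <= eps.
Proof.
move=> Ig pg eps eps0; have e3 : 0 < eps / 3 by rewrite divr_gt0.
have [psi tpsi hpsi] := test_dense Ig e3.
have [del del0 hdel] := test_translate_cvg tpsi e3.
exists del => // h hh; have Ipsi := test_integ tpsi; have [_ ppsi _] := tpsi.
have Igh := translate_integ h Ig pg; have Ipsih := translate_integ h Ipsi ppsi.
have h1 : nrm M (fun x => g (x + h) - psi (x + h)) <= eps / 3.
  rewrite (translate_nrm (f := fun x => g x - psi x))//.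
    by apply: (@integ_measurable _ _ _ M); exact: integB.
  by move=> x z Lz; rewrite pg// ppsi.
apply: le_trans (nrm_tri Igh Ipsih Ig) _.
have := nrm_tri Ipsih Ipsi Ig; rewrite [X in _ <= _ + X]nrm_distC.
by have := hdel h hh; lra.
Qed.

(** ** Functions with an integrable weak gradient *)

Section weak_derivative.
Variables (q : Rd -> R) (dq : Rd -> Rd).
Hypothesis Iq : integ M q.
Hypothesis pq : Lam_periodic q.
Hypothesis Idq : forall i, integ M (fun x => dq x 0 i).
Hypothesis pdq : Lam_periodic dq.
Hypothesis dqP : forall phi, test_fun phi -> forall i,
  \int[M]_x (q x * partial i phi x) = - \int[M]_x (dq x 0 i * phi x).

Let pdqi i : Lam_periodic (fun x => dq x 0 i).
Proof. by move=> x z Lz; rewrite pdq. Qed.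

Lemma coord_norm_le (h : Rd) i : `|h 0 i| <= `|h|.
Proof. by rewrite [leRHS]/Num.norm /= mx_normrE; exact: (le_bigmax _ _ (0, i)). Qed.

Lemma test_fun_translate phi c : test_fun phi -> test_fun (fun x => phi (x + c)).
Proof.
move=> [s p t]; split; first exact: bounded_smooth_translate.
- exact: translate_periodic.
- exact: supp_translate.
Qed.

Lemma integ_mul_smooth f phi : integ M f -> bounded_smooth phi ->
  integ M (fun x => f x * phi x).
Proof.
move=> If s; have [B _ hB] := bsmooth_bounded (s 0%N).
exact: integ_bounded If (bsmooth_measurable (s 0%N)) hB.
Qed.

Lemma translate_pairing g phi c : integ M g -> Lam_periodic g -> test_fun phi ->
  \int[M]_x (g (x - c) * phi x) = \int[M]_x (g x * phi (x + c)).
Proof.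
move=> Ig pg [s p t].
rewrite -(translate_Rint c (f := fun x => g (x - c) * phi x)).
- by apply: eq_Rintegral => x _; rewrite addrK.
- by apply: integ_mul_smooth => //; exact: translate_integ.
- move=> x z Lz; congr (_ * _); last exact: p.
  by rewrite addrAC; exact: pg.
Qed.

Section pairing_along_line.
Variables (phi : Rd -> R) (h : Rd).
Hypothesis tphi : test_fun phi.

Let sphi : bounded_smooth phi. Proof. by case: tphi. Qed.

Let dphi x : differentiable phi x.
Proof. exact: (bsmooth_differentiable x (sphi 0%N)). Qed.

Let pairing (t : R) : R := \int[M]_x (q x * phi (x + t *: h)).

Lemma directional_bounded : exists2 B : R, 0 <= B & forall x, `|'D_h phi x| <= B.
Proof.
have /choice[B hB] : forall i, exists B : R, forall x, `|partial i phi x| <= B.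
  move=> i; have [B _ hB] := bsmooth_bounded (bounded_smooth_partial i sphi 0%N).
  by exists B.
exists (\sum_(i < dim) `|h 0 i| * `|B i|) => [|x].
  by apply: sumr_ge0 => i _; exact: mulr_ge0.
rewrite derive_dot// (le_trans (ler_norm_sum _ _ _))//; apply: ler_sum => i _.
by rewrite normrM ler_wpM2l// (le_trans (hB i x))// ler_norm.
Qed.

(** Differentiation under the integral sign, dominated by a multiple of |q|, followed by
the defining property of the weak gradient for the translated test function. *)
Lemma pairing_derive (t : R) : is_derive t 1 pairing
  (- \sum_(i < dim) h 0 i * \int[M]_x (dq x 0 i * phi (x + t *: h))).
Proof.
have [B B0 hB] := directional_bounded.
pose F (t : R) x := q x * phi (x + t *: h).
have dF (s : R) (x : Rd) : is_derive s 1 (F ^~ x) (q x * 'D_h phi (x + s *: h)).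
  have := line_is_derive x h s dphi => d1.
  have := is_deriveZ (q x) d1.
  by [].
have E (s : R) (x : Rd) : derive1 (F ^~ x) s = q x * 'D_h phi (x + s *: h).
  by rewrite derive1E; have [_ ->] := dF s x.
have tI : t \in `]t - 1, t + 1[ by rewrite in_itv/= ltrBlDr ltrDl ltr01.
have IF (s : R) : integ M (F s).
  exact: integ_mul_smooth (bounded_smooth_translate _ sphi).
have IG : integ M (fun x => B * `|q x|) by exact/integZ/integ_abs.
have G0 x : 0 <= B * `|q x| by exact: mulr_ge0.
have I0 (s : R) : `]t - 1, t + 1[%classic s -> integ M (F s) by move=> _; exact: IF.
have Gub (s : R) (x : Rd) : `]t - 1, t + 1[%classic s -> setT x ->
    `|partial1of2 F s x| <= B * `|q x|.
  by move=> _ _; rewrite /partial1of2 E normrM mulrC ler_wpM2r.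
have derF (s : R) (x : Rd) : `]t - 1, t + 1[%classic s -> setT x ->
    derivable (F ^~ x) s 1.
  by move=> _ _; have [] := dF s x.
apply: DeriveDef; first exact: (derivable_under_integral measurableT tI I0 derF G0 IG Gub).
rewrite -derive1E (differentiation_under_integral measurableT tI I0 derF G0 IG Gub).
transitivity (\int[M]_x \sum_(i < dim) h 0 i * (q x * partial i phi (x + t *: h))).
  apply: eq_Rintegral => x _; rewrite /partial1of2 E derive_dot// mulr_sumr.
  by apply: eq_bigr => i _; rewrite mulrCA.
have tphi' := test_fun_translate (t *: h) tphi.
have sphi' := bounded_smooth_translate (t *: h) sphi.
have pE i x : partial i (fun x => phi (x + t *: h)) x = partial i phi (x + t *: h).
  exact: partial_translate.
have Ip i : integ M (fun x => q x * partial i phi (x + t *: h)).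
  apply: integ_mul_smooth => //.
  by apply: bounded_smooth_translate; exact: bounded_smooth_partial.
rewrite Rintegral_sum; last by move=> i; exact: integZ.
rewrite -sumrN; apply: eq_bigr => i _.
rewrite RintegralZl// -mulrN; congr (_ * _).
rewrite -(dqP tphi' i); apply: eq_Rintegral => x _.
by rewrite pE.
Qed.

(** The mean value theorem on [0, 1] for the pairing, corrected by its linear part at
0. *)
Lemma first_order_pairing (eps : R) : (forall x, `|phi x| <= 1) ->
  (forall (t : R) i, 0 <= t <= 1 ->
     nrm M (fun x => dq (x - t *: h) 0 i - dq x 0 i) <= eps) ->
  `|\int[M]_x ((q (x - h) - q x + \sum_(i < dim) h 0 i * dq x 0 i) * phi x)|
    <= \sum_(i < dim) `|h 0 i| * eps.
Proof.
move=> phi1 heps.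
pose c := \sum_(i < dim) h 0 i * \int[M]_x (dq x 0 i * phi x).
pose der (t : R) := - \sum_(i < dim) h 0 i * \int[M]_x (dq x 0 i * phi (x + t *: h)).
pose H (t : R) : R := pairing t + c * t.
have dH (t : R) : is_derive t 1 H (der t + c).
  have := pairing_derive t => d1.
  have d2 : is_derive t 1 (fun t : R => c * t) c.
    by apply: is_derive_eq; rewrite [_ *: _]mulr1.
  exact: is_deriveD.
have cH : {within `[0, 1], continuous H}.
  apply: continuous_subspaceT => t.
  by apply/differentiable_continuous/derivable1_diffP; have [] := dH t.
have [th th01] := @MVT R H (fun t => der t + c) 0 1 ltr01 (fun t _ => dH t) cH.
rewrite subr0 mulr1.
have Idp i : integ M (fun x => dq x 0 i * phi x) by exact: integ_mul_smooth.
have -> : H 1 - H 0 =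
    \int[M]_x ((q (x - h) - q x + \sum_(i < dim) h 0 i * dq x 0 i) * phi x).
  have Iqh := translate_integ (- h) Iq pq.
  have Is : integ M (fun x => \sum_(i < dim) h 0 i * dq x 0 i).
    by apply: integ_sum => i; exact: integZ.
  transitivity (\int[M]_x ((q (x - h) * phi x - q x * phi x) +
      \sum_(i < dim) h 0 i * (dq x 0 i * phi x))).
    rewrite RintegralD//; last 2 first.
    - by apply: integB; exact: integ_mul_smooth.
    - by apply: integ_sum => i; exact: integZ.
    rewrite RintegralB//; [|exact: integ_mul_smooth..].
    rewrite Rintegral_sum; last by move=> i; exact: integZ.
    rewrite (eq_bigr (fun i => h 0 i * \int[M]_x (dq x 0 i * phi x))); last first.
      by move=> i _; rewrite RintegralZl.
    rewrite -/c translate_pairing// /H /pairing mulr1 mulr0 addr0 scale1r scale0r.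
    rewrite addrAC; congr (_ - _ + _).
    by apply: eq_Rintegral => x _; rewrite addr0.
  apply: eq_Rintegral => x _; rewrite mulrDl mulrBl mulr_suml; congr (_ + _).
  by apply: eq_bigr => i _; rewrite mulrA.
move=> ->; rewrite /der /c addrC -sumrB (le_trans (ler_norm_sum _ _ _))//.
apply: ler_sum => i _; rewrite -mulrBr normrM ler_wpM2l//.
have th1 : 0 <= th <= 1 by move: th01; rewrite in_itv/= => /andP[/ltW -> /ltW ->].
apply: le_trans (heps th i th1).
have Idt : integ M (fun x => dq (x - th *: h) 0 i).
  by have := translate_integ (- (th *: h)) (Idq i) (pdqi i).
rewrite -(translate_pairing _ (Idq i) (pdqi i) tphi) -RintegralB//; last first.
  exact: integ_mul_smooth.
have Idd := integB Idt (Idq i).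
have Iphi1 : integ M (fun x => dq x 0 i * phi x - dq (x - th *: h) 0 i * phi x).
  by apply: integB => //; exact: integ_mul_smooth.
apply: le_trans (normr_Rint_le Iphi1) _; apply: ae_le_nrm => //.
apply/aeW => x; rewrite -mulrBl normrM distrC -[leRHS]mulr1.
by rewrite ler_wpM2l.
Qed.

End pairing_along_line.

(** Taking the supremum over test functions in [first_order_pairing]. *)
Lemma first_order_remainder (eps : R) : 0 < eps -> exists2 del : R, 0 < del &
  forall h : Rd, `|h| < del ->
    nrm M (fun x => q (x - h) - q x + \sum_(i < dim) h 0 i * dq x 0 i) <= eps * `|h|.
Proof.
move=> eps0; pose eps' := eps / dim.+1%:R.
have eps'0 : 0 < eps' by rewrite divr_gt0.
have /choice[del hdel] : forall i, exists del : R, 0 < del /\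
    forall h : Rd, `|h| < del -> nrm M (fun x => dq (x + h) 0 i - dq x 0 i) <= eps'.
  by move=> i; have [del del0 H] := translation_continuous (Idq i) (pdqi i) eps'0; exists del.
exists (\big[Order.min/1]_(i < dim) del i).
  by apply: lt_bigmin => // i _; have [] := hdel i.
move=> h hh; have Iqh := translate_integ (- h) Iq pq.
apply: nrm_le_test => [|phi tphi phi1].
  by apply: integD; [exact: integB|apply: integ_sum => i; exact: integZ].
have small (t : R) i : 0 <= t <= 1 ->
    nrm M (fun x => dq (x - t *: h) 0 i - dq x 0 i) <= eps'.
  move=> /andP[t0 t1]; have [_] := hdel i; apply.
  have th : `|t *: h| <= `|h| by rewrite normrZ ger0_norm// ler_piMl.
  rewrite normrN; apply: le_lt_trans th _; apply: lt_le_trans hh _.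
  exact: bigmin_le.
apply: le_trans (first_order_pairing tphi phi1 small) _.
apply: (@le_trans _ _ (\sum_(i < dim) `|h| * eps')).
  by apply: ler_sum => i _; rewrite ler_wpM2r ?(ltW eps'0)// coord_norm_le.
rewrite sumr_const card_ord -mulrnAr [leRHS]mulrC ler_wpM2l//.
rewrite /eps' -mulr_natr mulrAC ler_pdivrMr// ler_wpM2l ?(ltW eps0)//.
by rewrite ler_nat.
Qed.

Lemma weak_gradient_translation (eps : R) : 0 < eps -> exists2 del : R, 0 < del &
  forall h : Rd, `|h| < del -> forall i,
    nrm M (fun x => dq (x - h) 0 i - dq x 0 i) <= eps.
Proof.
move=> eps0.
have /choice[del hdel] : forall i, exists del : R, 0 < del /\
    forall h : Rd, `|h| < del -> nrm M (fun x => dq (x + h) 0 i - dq x 0 i) <= eps.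
  by move=> i; have [del del0 H] := translation_continuous (Idq i) (pdqi i) eps0; exists del.
exists (\big[Order.min/1]_(i < dim) del i).
  by apply: lt_bigmin => // i _; have [] := hdel i.
move=> h hh i; have [_] := hdel i; apply.
by rewrite normrN; apply: lt_le_trans hh _; exact: bigmin_le.
Qed.

End weak_derivative.

End translation_setting.

(** * Measures as bundled sigma-finite or probability measures *)

(** Measures given as plain measures are equipped here with a finiteness structure;
the accompanying equations allow one to pass back and forth by rewriting. *)
Section bundled_measures.
Context d (T : measurableType d) (R : realType) (m : {measure set T -> \bar R}).

Section sigma_finite_bundle.
Variable sf : sigma_finite setT m.
Let mu : set T -> \bar R := m.
HB.instance Definition _ := Measure.copy mu m.
HB.instance Definition _ := Measure_isSigmaFinite.Build _ _ _ mu sf.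
Definition sigma_finite_bundle : {sigma_finite_measure set T -> \bar R} := mu.
End sigma_finite_bundle.

Section probability_bundle.
Variable m1 : m setT = 1%E.
Let mu : set T -> \bar R := m.
HB.instance Definition _ := Measure.copy mu m.
HB.instance Definition _ := Measure_isProbability.Build _ _ _ mu m1.
Definition probability_bundle : probability T R := mu.
End probability_bundle.

End bundled_measures.

Lemma sigma_finite_bundleE d (T : measurableType d) (R : realType)
  (m : {measure set T -> \bar R}) (sf : sigma_finite setT m) :
  (sigma_finite_bundle sf : {measure set T -> \bar R}) = m.
Proof. by destruct m as [mu cls]; destruct cls. Qed.

Lemma probability_bundleE d (T : measurableType d) (R : realType)
  (m : {measure set T -> \bar R}) (m1 : m setT = 1%E) :
  (probability_bundle m1 : {measure set T -> \bar R}) = m.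
Proof. by destruct m as [mu cls]; destruct cls. Qed.

(** * Lebesgue measure on row vectors: Tonelli and translations *)

Section tonelli_rV.
Context (R : realType).
Local Notation lam := (@lebesgue_measure R).

Lemma sigma_finite_lebesgue_rV d : sigma_finite setT (lebesgue_rV R d).
Proof.
exists (fun n => rect (fun=> `[- n%:R, n%:R]%classic)).
  apply/seteqP; split => // x _.
  have [n hn] : exists n : nat, `|x| <= n%:R.
    exists (Num.bound `|x|); apply/ltW/archi_boundP; exact: normr_ge0.
  exists n => // i /=; rewrite in_itv/= -ler_norml.
  by apply: le_trans (coord_norm_le x i) hn.
move=> n; split; first by apply: measurable_rect => i; exact: measurable_itv.
rewrite lebesgue_rV_rect => [|i]; last exact: measurable_itv.
under eq_bigr do rewrite lebesgue_measure_itv/= EFinN.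
have h : (if (- n%:R%:E < n%:R%:E :> \bar R)%E then (n%:R%:E - (- n%:R%:E))%E else 0%E)
   = (n%:R + n%:R)%:E :> \bar R.
  rewrite -EFinN lte_fin; case: ltP => [_|nn]; first by rewrite -EFinB opprK.
  by congr EFin; have := ler0n R n; lra.
under eq_bigr do rewrite h.
by rewrite prodEFin; exact: ltry.
Qed.

Lemma cons_rV0 d (p : R * 'rV[R]_d) : cons_rV p 0 ord0 = p.1.
Proof.
rewrite (_ : ord0 = lshift d (ord0 : 'I_1)); last exact/val_inj.
by apply: etrans (row_mxEl _ _ _ _) _; rewrite mxE.
Qed.

Lemma cons_rVS d (p : R * 'rV[R]_d) i : cons_rV p 0 (lift ord0 i) = p.2 0 i.
Proof.
rewrite (_ : lift ord0 i = rshift 1 i); last exact/val_inj.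
exact: row_mxEr.
Qed.

Lemma tonelli_lebesgue_rV d (h : 'rV[R]_d.+1 -> \bar R) : measurable_fun setT h ->
  (forall x, (0 <= h x)%E) ->
  (\int[lebesgue_rV R d.+1]_x h x =
   \int[lam]_t \int[lebesgue_rV R d]_x h (cons_rV (t, x)))%E.
Proof.
move=> mh h0; have mc := @measurable_cons_rV R d.
pose L := sigma_finite_bundle (@sigma_finite_lebesgue_rV d).
have LE : (L : {measure set _ -> \bar R}) = lebesgue_rV R d := sigma_finite_bundleE _.
rewrite -[in RHS]LE.
transitivity (\int[pushforward (lam \x L)%E (@cons_rV R d)]_x h x)%E.
  apply: eq_measure_integral => A mA _ /=.
  rewrite /prod_lebesgue /pushforward.
  have mA' : measurable (@cons_rV R d @^-1` A).
    by rewrite -[_ @^-1` _]setTI; exact: mc.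
  rewrite -LE; apply/esym/(@product_measure_unique _ _ _ _ _ lam L) => // *.
  exact: product_measure2E.
rewrite ge0_integral_pushforward//.
apply: (@fubini_tonelli1 _ _ _ _ _ lam L (h \o @cons_rV R d)) => [|p].
  exact: measurableT_comp.
exact: h0.
Qed.

Lemma measurable_tonelli_rV d (h : 'rV[R]_d.+1 -> \bar R) : measurable_fun setT h ->
  (forall x, (0 <= h x)%E) ->
  measurable_fun setT (fun t : R => \int[lebesgue_rV R d]_x h (cons_rV (t, x)))%E.
Proof.
move=> mh h0; have mc := @measurable_cons_rV R d.
pose L := sigma_finite_bundle (@sigma_finite_lebesgue_rV d).
have LE : (L : {measure set _ -> \bar R}) = lebesgue_rV R d := sigma_finite_bundleE _.
rewrite -LE.
apply: (@measurable_fun_fubini_tonelli_F _ _ _ _ _ L (h \o @cons_rV R d)) => [|p].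
  exact: measurableT_comp.
exact: h0.
Qed.

End tonelli_rV.

(** Translation invariance of the d-dimensional Lebesgue measure on the box I^d,
tested on functions that are periodic in each coordinate with respect to a set of
periods: it is inherited from the one-dimensional case by integrating one
coordinate after the other.  The cases of interest are I = R without periods
and I = [0, 1[ with integer periods. *)
Section invariance_rV.
Context (R : realType).
Local Notation lam := (@lebesgue_measure R).
Variables (I : set R) (P : set R).
Hypothesis mI : measurable I.
Hypothesis P0 : P 0.

Definition periods d : set 'rV[R]_d := [set z | forall i, P (z 0 i)].

Hypothesis inv1 : forall (F : R -> \bar R) (c : R), measurable_fun setT F ->
  (forall t, (0 <= F t)%E) -> (forall t z, P z -> F (t + z)%R = F t) ->
  (\int[lam]_(t in I) F (t + c)%R = \int[lam]_(t in I) F t)%E.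

Let rI d : set 'rV[R]_d := rect (fun=> I).

Let mrI d : measurable (@rI d).
Proof. exact: measurable_rect. Qed.

Let tonelli_box d (h : 'rV[R]_d.+1 -> \bar R) : measurable_fun setT h ->
  (forall x, (0 <= h x)%E) ->
  (\int[lebesgue_rV R d.+1]_(x in @rI d.+1) h x =
   \int[lam]_(t in I) \int[lebesgue_rV R d]_(x in @rI d) h (cons_rV (t, x)))%E.
Proof.
move=> mh h0; rewrite integral_mkcond tonelli_lebesgue_rV; last 2 first.
- apply/(measurable_restrictT _ _).1; [exact: mrI|exact: measurable_funTS].
- by move=> x; apply: erestrict_ge0.
rewrite [RHS]integral_mkcond; apply: eq_integral => t _.
rewrite patchE; case: ifPn => tI.
  rewrite [RHS]integral_mkcond; apply: eq_integral => x _; rewrite !patchE.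
  congr (if _ then _ else _); apply/idP/idP; rewrite !inE => H.
    by move=> i; have := H (lift ord0 i); rewrite cons_rVS.
  move=> i; case: (unliftP ord0 i) => [j|] ->; first by rewrite cons_rVS; exact: H.
  by rewrite cons_rV0 /=; rewrite inE in tI.
apply: integral0_eq => x _; rewrite patchE memNset// => /(_ ord0).
by rewrite cons_rV0/= => /mem_set It; rewrite It in tI.
Qed.

Lemma translation_invariant_rV d (h : 'rV[R]_d -> \bar R) (c : 'rV[R]_d) :
  measurable_fun setT h -> (forall x, (0 <= h x)%E) ->
  (forall x z, periods z -> h (x + z)%R = h x) ->
  (\int[lebesgue_rV R d]_(x in rect (fun=> I)) h (x + c)%R =
   \int[lebesgue_rV R d]_(x in rect (fun=> I)) h x)%E.
Proof.
elim: d h c => [|d IH] h c mh h0 hP.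
  by apply: eq_integral => x _; congr h; apply/rowP => -[].
rewrite !tonelli_box//; last exact: measurableT_comp mh (measurable_translation c).
pose c' : 'rV[R]_d := \row_i c 0 (lift ord0 i).
have E t x : cons_rV (t, x) + c = cons_rV (t + c 0 ord0, x + c').
  apply/rowP => i; rewrite mxE; case: (unliftP ord0 i) => [j|] ->.
    by rewrite !cons_rVS/= !mxE.
  by rewrite !cons_rV0.
have mcons (t : R) : measurable_fun setT (fun x : 'rV[R]_d => cons_rV (t, x)).
  by apply: measurableT_comp (@measurable_cons_rV R d) _; exact: measurable_pair1.
pose F t := (\int[lebesgue_rV R d]_(x in @rI d) h (cons_rV (t, x)))%E.
transitivity (\int[lam]_(t in I) F (t + c 0 ord0)%R)%E.
  apply: eq_integral => t _; under eq_integral do rewrite E.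
  rewrite (IH (fun x => h (cons_rV (t + c 0 ord0, x))))//.
    exact: measurableT_comp mh (mcons _).
  move=> x z Pz; rewrite (_ : cons_rV _ = cons_rV (t + c 0 ord0, x) + cons_rV (0, z)).
    apply: hP => i; case: (unliftP ord0 i) => [j|] ->; first by rewrite cons_rVS; exact: Pz.
    by rewrite cons_rV0.
  apply/rowP => i; rewrite [in RHS]mxE; case: (unliftP ord0 i) => [j|] ->.
    by rewrite !cons_rVS/= !mxE.
  by rewrite !cons_rV0/= addr0.
apply: inv1.
- pose B : set 'rV[R]_d.+1 := rect (fun i => if i == ord0 then setT else I).
  have mB : measurable B by apply: measurable_rect => i; case: ifP.
  have FE : F = fun t => (\int[lebesgue_rV R d]_x (h \_ B) (cons_rV (t, x)))%E.
    apply/funext => t; rewrite /F integral_mkcond; apply: eq_integral => x _.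
    rewrite !patchE; congr (if _ then _ else _); apply/idP/idP; rewrite !inE => H.
      move=> i; case: (unliftP ord0 i) => [j|] ->; last by rewrite eqxx.
      by rewrite cons_rVS eq_sym (negPf (neq_lift _ _)); exact: H.
    move=> i; have := H (lift ord0 i).
    by rewrite cons_rVS eq_sym (negPf (neq_lift _ _)).
  rewrite FE; apply: measurable_tonelli_rV.
    by apply/(measurable_restrictT _ _).1 => //; exact: measurable_funTS.
  by move=> x; apply: erestrict_ge0.
- by move=> t; apply: integral_ge0.
- move=> t z Pz; apply: eq_integral => x _.
  rewrite (_ : cons_rV _ = cons_rV (t, x) + cons_rV (z, 0)).
    apply: hP => i; case: (unliftP ord0 i) => [j|] ->; first by rewrite cons_rVS/= mxE.
    by rewrite cons_rV0.
  apply/rowP => i; rewrite [in RHS]mxE; case: (unliftP ord0 i) => [j|] ->.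
    by rewrite !cons_rVS/= mxE addr0.
  by rewrite !cons_rV0.
Qed.

End invariance_rV.

(** * One-dimensional translations and restricted measures *)

Section translation1.
Context (R : realType).
Local Notation lam := (@lebesgue_measure R).

Let shift1 (c : R) : measurableTypeR R -> measurableTypeR R := fun t => t + c.

Let measurable_shift (c : R) : measurable_fun setT (shift1 c).
Proof. exact: measurable_funD. Qed.

HB.instance Definition _ c := isMeasurableFun.Build _ _ _ _ (shift1 c) (measurable_shift c).

Lemma lebesgue_measure_translate (F : R -> \bar R) (c : R) : measurable_fun setT F ->
  (forall t, (0 <= F t)%E) ->
  (\int[lam]_t F (t + c)%R = \int[lam]_t F t)%E.
Proof.
move=> mF F0; transitivity (\int[pushforward lam (shift1 c)]_t F t)%E.
  by rewrite ge0_integral_pushforward//; exact: measurable_shift.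
apply: eq_measure_integral => A mA _; apply/esym.
apply: lebesgue_measure_unique => //= _ [[a b]] _ <-.
rewrite /pushforward (_ : shift1 c @^-1` _ = `]a - c, b - c]%classic); last first.
  by apply/seteqP; split => t /=; rewrite !in_itv/= ltrBlDr lerBrDr.
rewrite !lebesgue_measure_itv/= !lte_fin ltrD2r.
by case: ifP => // _; rewrite -!EFinB; congr EFin; ring.
Qed.

Lemma lebesgue_integral_translate_set (F : R -> \bar R) (A : set R) (c : R) :
  measurable A -> measurable_fun setT F -> (forall t, (0 <= F t)%E) ->
  (\int[lam]_(t in [set t : R | A (t + c)%R]) F (t + c)%R = \int[lam]_(t in A) F t)%E.
Proof.
move=> mA mF F0; rewrite integral_mkcond [RHS]integral_mkcond.
rewrite -(lebesgue_measure_translate (F := F \_ A) c).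
- apply: eq_integral => t _; rewrite !patchE.
  suff -> : (t \in [set t : R | A (t + c)]) = (t + c \in A) by [].
  by apply/idP/idP; rewrite !inE.
- by apply/(measurable_restrictT _ _).1 => //; exact: measurable_funTS.
- by move=> t; apply: erestrict_ge0.
Qed.

(** On a unit interval, cut the translated fundamental domain [c, c + 1[ at 1 and
move its right part back by one period. *)
Lemma periodic_integral_translate (F : R -> \bar R) (c : R) : measurable_fun setT F ->
  (forall t, (0 <= F t)%E) -> (forall t z, z \is a Num.int -> F (t + z)%R = F t) ->
  (\int[lam]_(t in `[0%R, 1%R[) F (t + c)%R = \int[lam]_(t in `[0%R, 1%R[) F t)%E.
Proof.
move=> mF F0 FP; pose s := c - (Num.floor c)%:~R.
have s01 : 0 <= s < 1.
  have /andP[h1 h2] := floor_itv c.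
  by rewrite /s subr_ge0 h1/= ltrBlDl -[X in _ + X]/(1%:~R) -intrD.
have {s01} /andP[s0 s1] := s01.
have Fs t : F (t + c) = F (t + s).
  have -> : t + c = t + s + (Num.floor c)%:~R by rewrite /s addrA subrK.
  by rewrite FP//; apply/intrP; exists (Num.floor c).
under eq_integral do rewrite Fs.
have E (x y z : R) :
    (\int[lam]_(t in `[x, y[) F (t + z)%R = \int[lam]_(t in `[(x + z)%R, (y + z)%R[) F t)%E.
  rewrite -(lebesgue_integral_translate_set z (A := `[x + z, y + z[%classic))//.
  congr (integral _ _ _); apply/seteqP; split => t /=; rewrite !in_itv/= lerD2r ltrD2r//.
have split_at (x y z : R) : x <= y <= z -> (\int[lam]_(t in `[x, z[) F t =
    \int[lam]_(t in `[x, y[) F t + \int[lam]_(t in `[y, z[) F t)%E.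
  move=> /andP[xy yz]; rewrite (@itv_bndbnd_setU _ _ (BLeft x) (BLeft y) (BLeft z))//.
  rewrite ge0_integral_setU//; first exact: measurable_funTS.
  apply/disj_setPS => t [/=]; rewrite !in_itv/= => /andP[_ ty] /andP[yt _].
  by move: ty; rewrite ltNge yt.
rewrite E add0r (split_at s 1 (1 + s)); last by rewrite (ltW s1) lerDl.
rewrite (split_at 0 s 1) ?s0 ?(ltW s1)// addeC; congr (_ + _)%E.
have := E 0 s 1; rewrite add0r [s + 1]addrC => <-.
by apply: eq_integral => t _; rewrite FP// int_num1.
Qed.

End translation1.

Section restricted_measure.
Context d (T : measurableType d) (R : realType) (m : {measure set T -> \bar R}).
Variables (D : set T) (mD : measurable D).

Lemma mrestr_ae : {ae mrestr m mD, forall x, D x}.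
Proof.
exists (~` D); split; first exact: measurableC.
  by rewrite /= /mrestr setICl measure0.
by move=> x /=.
Qed.

Lemma ge0_integral_mrestr (f : T -> \bar R) : measurable_fun setT f ->
  (forall x, (0 <= f x)%E) ->
  (\int[mrestr m mD]_x f x = \int[m]_(x in D) f x)%E.
Proof.
move=> mf f0; rewrite (@ge0_negligible_integral _ _ _ _ setT (~` D))//.
- rewrite setTD setCK; apply: eq_measure_integral => A mA AD.
  by rewrite /= /mrestr setIidl.
- exact: measurableC.
- by rewrite /= /mrestr setICl measure0.
Qed.

End restricted_measure.

(** * Lebesgue measure on R^d and on a fundamental cell of Z^d *)

Section smooth_tools.
Context (R : realType).

Lemma smooth1_derive1 (u : R -> R) : smooth1 u ->
  (forall t : R, is_derive t 1 u (derive1 u t)) /\ smooth1 (derive1 u).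
Proof.
move=> su; have E u' : (forall t : R, is_derive t 1 u (u' t)) -> derive1 u = u'.
  by move=> du; apply/funext => t; rewrite derive1E; have [_ ->] := du t.
split; first by have [u' du _] := bsmooth1_derive (su 0%N); rewrite (E _ du).
by move=> n; have [u' du h] := bsmooth1_derive (su n.+1); rewrite (E _ du); exact: h.
Qed.

Lemma smooth1_cst (c : R) : smooth1 (fun=> c).
Proof. by move=> n; exact: bsmooth1_cst. Qed.

Lemma smooth1M (u v : R -> R) : smooth1 u -> smooth1 v -> smooth1 (fun t => u t * v t).
Proof. by move=> su sv n; exact: bsmooth1M. Qed.

Lemma step_ge (t : R) : 0 < t -> 1 - t^-1 <= step t.
Proof. by move=> t0; rewrite /step /flat t0 expr0 mul1r; exact: expR_ge1Dx. Qed.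

Lemma step_shift_cvg (a : R) : step (N%:R + a) @[N --> \oo] --> (1 : R).
Proof.
apply/cvgrPdist_le => eps eps0; near=> N.
have Na : eps^-1 <= N%:R + a.
  by rewrite -lerBlDr; apply: ltW; near: N; exact: nbhs_infty_gtr.
have Na0 : 0 < N%:R + a by apply: lt_le_trans Na; rewrite invr_gt0.
have /andP[_ s1] := step01 (N%:R + a).
rewrite ger0_norm ?subr_ge0// lerBlDl -lerBlDr; apply: le_trans (step_ge Na0).
by rewrite lerD2l lerN2 -[leRHS]invrK lef_pV2 ?posrE// invr_gt0.
Unshelve. all: by end_near. Qed.

Context (dim : nat).
Local Notation Rd := 'rV[R]_dim.

Lemma bounded_smooth_lipschitz (phi : Rd -> R) : bounded_smooth phi ->
  exists2 K : R, 0 <= K & forall x h, `|phi (x + h) - phi x| <= K * `|h|.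
Proof.
move=> s.
have /choice[B hB] : forall i, exists B : R, forall x, `|partial i phi x| <= B.
  move=> i; have [B _ hB] := bsmooth_bounded (bounded_smooth_partial i s 0%N).
  by exists B.
exists (\sum_(i < dim) `|B i|) => [|x h]; first exact: sumr_ge0.
have dphi y : differentiable phi y := bsmooth_differentiable y (s 0%N).
have dl (t : R) := line_is_derive x h t dphi.
have cl : {within `[0, 1], continuous (fun t : R => phi (x + t *: h))}.
  apply: continuous_subspaceT => t.
  by apply/differentiable_continuous/derivable1_diffP; have [] := dl t.
have [t _] := MVT (@ltr01 R) (fun t _ => dl t) cl.
rewrite scale1r scale0r addr0 subr0 mulr1 => ->.
rewrite derive_dot// (le_trans (ler_norm_sum _ _ _))// mulr_suml.
apply: ler_sum => i _; rewrite normrM mulrC ler_pM//; last exact: coord_norm_le.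
by rewrite (le_trans (hB i _))// ler_norm.
Qed.

End smooth_tools.

Section lebesgue_setting.
Context (R : realType) (dim : nat).
Local Notation Rd := 'rV[R]_dim.
Local Notation mu := (lebesgue_rV R dim).

Definition bounded_support (phi : Rd -> R) : Prop :=
  exists2 N : R, 0 <= N & forall x, N < `|x| -> phi x = 0.

Lemma bounded_support_compact phi : bounded_support phi -> compactly_supported phi.
Proof.
move=> [N N0 hN]; exists [set x : Rd | forall i, `[- N, N]%classic (x 0 i)].
  exact: (@rV_compact R dim (fun=> `[- N, N]%classic) (fun=> @segment_compact R _ _)).
move=> x; apply: contra_notP => /eqP phix i; rewrite /= in_itv/= -ler_norml.
apply: le_trans (coord_norm_le x i) _; rewrite leNgt; apply/negP => /hN.
by move/eqP; rewrite (negPf phix).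
Qed.

Let box (N : R) : set Rd := rect (fun=> `[- N, N]%classic).

Let mbox N : measurable (box N).
Proof. by apply: measurable_rect => i; exact: measurable_itv. Qed.

Let box_fin N : (mu (box N) < +oo)%E.
Proof.
rewrite lebesgue_rV_rect => [|i]; last exact: measurable_itv.
under eq_bigr do rewrite lebesgue_measure_itv/= EFinN -EFinN -EFinB -(fun_if EFin).
by rewrite prodEFin; exact: ltry.
Qed.

Let integ_box N : integ mu (\1_(box N) : Rd -> R).
Proof.
apply/integrableP; split; first by apply/measurable_EFinP; exact: measurable_indic.
under eq_integral do rewrite /= ger0_norm//.
by rewrite integral_indic// setIT; exact: box_fin.
Qed.

Let outside_box N (x : Rd) : 0 <= N -> ~ box N x -> N < `|x|.
Proof.
move=> N0; apply: contra_notP => /negP; rewrite -leNgt => xN i.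
by rewrite /= in_itv/= -ler_norml (le_trans (coord_norm_le x i)).
Qed.

Let le_box (f : Rd -> R) (N K : R) : measurable_fun setT f -> 0 <= N -> 0 <= K ->
  (forall x, N < `|x| -> f x = 0) -> (forall x, `|f x| <= K) ->
  integ mu f /\ nrm mu f <= K * nrm mu (\1_(box N) : Rd -> R).
Proof.
move=> mf N0 K0 f0 fK.
have le x : `|f x| <= `|K * (\1_(box N) x : R)|.
  rewrite normrM (ger0_norm K0) indicE; have [xb|xb] := boolP (x \in box N).
    by rewrite normr1 mulr1.
  by rewrite f0 ?normr0 ?mulr0//; apply: outside_box => //; move: xb; rewrite notin_setE.
have If : integ mu f.
  by apply: (ae_le_integ mf (integ_abs (integZ K (integ_box N)))); exact/aeW.
split => //; rewrite -[X in X * _](ger0_norm K0) -nrmZ//.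
by apply: ae_le_nrm => //; [exact: integZ|exact: aeW].
Qed.

(** A product of smooth one-sided cut-offs, equal to 0 off the cube of side 2 N. *)
Let chi (N : nat) (x : Rd) : R :=
  \prod_(i <- index_enum 'I_dim) (step (N%:R + x 0 i) * step (N%:R + - x 0 i)).

Lemma lebesgue_setting : translation_setting mu [set 0] bounded_support chi.
Proof.
have per (f : Rd -> R) : Lam_periodic [set 0] f by move=> x z ->; rewrite addr0.
split.
- move=> f c mf f0 _.
  have rT : rect (fun=> setT) = [set: Rd] by apply/seteqP; split.
  have := @translation_invariant_rV R setT [set 0] measurableT erefl _ dim (EFin \o f) c.
  rewrite rT; apply => //.
  + by move=> F c' mF F0 _; exact: lebesgue_measure_translate.
  + exact/measurable_EFinP.
  + by move=> x z Pz; rewrite /= (_ : z = 0) ?addr0//; apply/rowP => i; rewrite mxE Pz.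
- by move=> phi psi [N N0 h]; exists N => // x /h ->; rewrite mulr0.
- move=> phi psi [N N0 h] [N' N'0 h']; exists (Num.max N N'); first by rewrite le_max N0.
  by move=> x; rewrite gt_max => /andP[/h -> /h' ->]; rewrite addr0.
- move=> phi c [N N0 h]; exists (N + `|c|) => [|x]; first exact: addr_ge0.
  rewrite -ltrBrDr => Nx; apply: h; apply: lt_le_trans Nx _.
  by rewrite lerBlDr -[X in `|X| <= _](addrK c) (le_trans (ler_normB _ _)).
- move=> phi [s _ [N N0 h]]; have [K K0 hK] := bsmooth_bounded (s 0%N).
  by have [] := le_box (bsmooth_measurable (s 0%N)) N0 K0 h hK.
- move=> psi [s _ [N N0 h]] eps eps0.
  have [K K0 hK] := bounded_smooth_lipschitz s.
  pose V := nrm mu (\1_(box (N + 1)) : Rd -> R).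
  have V0 : 0 < K * V + 1 by rewrite ltr_wpDl// mulr_ge0// nrm_ge0.
  exists (Num.min 1 (eps / (K * V + 1))); first by rewrite lt_min ltr01/= divr_gt0.
  move=> e; rewrite lt_min => /andP[e1 e2].
  have me : measurable_fun setT (fun x : Rd => psi (x + e) - psi x).
    apply: measurable_funB; last exact: (bsmooth_measurable (s 0%N)).
    exact: (bsmooth_measurable (bounded_smooth_translate e s 0%N)).
  have out x : N + 1 < `|x| -> psi (x + e) - psi x = 0.
    move=> Nx; rewrite !h ?subrr//; first by apply: lt_trans Nx; rewrite ltrDl.
    rewrite -(ltrD2r 1); apply: lt_le_trans Nx _.
    rewrite -[X in `|X| <= _](addrK e); apply: le_trans (ler_normB _ _) _.
    by rewrite lerD2l ltW.
  have [_] := le_box me (addr_ge0 N0 ler01) (mulr_ge0 K0 (normr_ge0 e)) out (hK ^~ e).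
  move/le_trans; apply.
  have : `|e| * (K * V + 1) <= eps by rewrite -ler_pdivlMr// ltW.
  by rewrite -/V mulrAC; have := normr_ge0 e; lra.
- move=> N; split => //.
    apply: bounded_smooth_prod => i; apply: bounded_smoothM.
      apply: (@bounded_smooth_coord _ _ (fun t => step (N%:R + t))).
      rewrite (_ : (fun t => _) = (fun t => step (1 * t + N%:R))).
        exact/smooth1_affine/smooth1_flat.
      by apply/funext => t; rewrite mul1r addrC.
    apply: (@bounded_smooth_coord _ _ (fun t => step (N%:R + - t))).
    rewrite (_ : (fun t => _) = (fun t => step (-1 * t + N%:R))).
      exact/smooth1_affine/smooth1_flat.
    by apply/funext => t; rewrite mulN1r addrC.
  exists N%:R => // x Nx; have : exists i, N%:R < `|x 0 i|.
    apply: contrapT => /forallNP H; move: Nx; rewrite ltNge => /negP; apply.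
    rewrite [leLHS]/Num.norm /= mx_normrE; apply: bigmax_le => // -[i j] _.
    by rewrite (ord1 i) leNgt; apply/negP; exact: H.
  move=> [i hi]; rewrite /chi (bigD1_seq i) ?mem_index_enum ?index_enum_uniq//=.
  rewrite [X in X * _](_ : _ = 0) ?mul0r//.
  move: hi; rewrite ltr_normr => /orP[hi|hi].
    by rewrite [X in _ * X]step_le0 ?mulr0// subr_le0 ltW.
  by rewrite (@step_le0 _ (N%:R + x 0 i)) ?mul0r//; lra.
- move=> N x; rewrite /chi; elim/big_ind : _ => [|a b|i _].
  + by rewrite ler01 lexx.
  + by move=> /andP[a0 a1] /andP[b0 b1]; rewrite mulr_ge0//= mulr_ile1.
  + have /andP[a0 a1] := step01 (N%:R + x 0 i).
    have /andP[b0 b1] := step01 (N%:R - x 0 i).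
    by rewrite mulr_ge0//= mulr_ile1.
- apply/aeW => x; rewrite /chi; elim: (index_enum _) => [|i l IH].
    by under eq_fun do rewrite big_nil; exact: cvg_cst.
  under eq_fun do rewrite big_cons.
  have := cvgM (cvgM (step_shift_cvg (x 0 i)) (step_shift_cvg (- x 0 i))) IH.
  by rewrite !mulr1; apply.
- move=> i a; exists (fun N x => step (N%:R * (x 0 i - a))) => [N|].
    split => // [|x]; last exact: step01.
    apply: (@bounded_smooth_coord _ _ (fun t => step (N%:R * (t - a)))).
    rewrite (_ : (fun t => _) = (fun t => step (N%:R * t + - (N%:R * a)))).
      exact/smooth1_affine/smooth1_flat.
    by apply/funext => t; rewrite mulrBr.
  apply/aeW => x; rewrite (_ : \1_[set x : Rd | a < x 0 i] x = (0 < x 0 i - a)%R%:R :> R).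
    exact: step_dilation_cvg.
  rewrite subr_gt0 indicE; congr (nat_of_bool _)%:R.
  by apply/idP/idP; rewrite inE.
Qed.

End lebesgue_setting.

Section torus_setting.
Context (R : realType) (dim : nat).
Local Notation Rd := 'rV[R]_dim.
Local Notation mu := (m_torus R dim).

Lemma m_torus_setT : mu setT = 1%E.
Proof.
rewrite /m_torus /= /mrestr setTI /unit_cell lebesgue_rV_rect => [|i]; last exact: measurable_itv.
by rewrite big1// => i _; rewrite lebesgue_measure_itv/= lte_fin ltr01 -EFinB subr0.
Qed.

Lemma m_torus_cell : {ae mu, forall x, unit_cell R dim x}.
Proof. exact: mrestr_ae. Qed.

(** sin (pi (t - a)) sin (pi (1 - t)) has period 1 and, on [0, 1[, is positive exactly
when a < t. *)
Definition arc (a t : R) : R := sin (pi * (t - a)) * sin (pi * (1 - t)).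

Lemma sin_pi_int (z : R) : z \is a Num.int ->
  exists2 s : R, s * s = 1 & forall t, sin (pi * (t + z)) = s * sin (pi * t).
Proof.
have pos (n : nat) : exists2 s : R, s * s = 1 &
    forall t, sin (pi * (t + n%:R)) = s * sin (pi * t).
  elim: n => [|n [s ss IH]]; first by exists 1; rewrite ?mulr1// => t; rewrite addr0 mul1r.
  exists (- s); first by rewrite mulrNN.
  by move=> t; rewrite -natr1 addrA mulrDr mulr1 sinDpi IH mulNr.
move=> /intrP[[n|n] ->]; first exact: pos.
have [s ss IH] := pos n.+1; exists s => // t.
rewrite NegzE mulrNz -[X in X = _]mul1r -{1}ss -mulrA; congr (_ * _).
by rewrite -IH subrK.
Qed.

Lemma arc_periodic (a t z : R) : z \is a Num.int -> arc a (t + z) = arc a t.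
Proof.
move=> zint; rewrite /arc; have [s ss h] := sin_pi_int zint.
have h' : s * sin (pi * (1 - (t + z))) = sin (pi * (1 - t)).
  by rewrite -h; congr (sin (_ * _)); ring.
by rewrite addrAC h -h'; ring.
Qed.

Lemma arc_gt0 (a t : R) : 0 <= a < 1 -> 0 <= t < 1 -> (0 < arc a t) = (a < t).
Proof.
move=> /andP[a0 a1] /andP[t0 t1]; rewrite /arc.
have p0 : 0 < pi :> R := pi_gt0 R.
have [->|tn0] := eqVneq t 0.
  by rewrite subr0 mulr1 sinpi mulr0 ltxx; apply/esym/negbTE; rewrite -leNgt.
have {}t0 : 0 < t by rewrite lt0r tn0.
have s0 : 0 < sin (pi * (1 - t)) by apply: sin_gt0_pi; apply/andP; split; nra.
rewrite pmulr_lgt0//; have [at0|ta] := ltP a t.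
  by rewrite sin_gt0_pi//; apply/andP; split; nra.
apply/negbTE; rewrite -leNgt -oppr_ge0 -sinN -mulrN opprB.
move: ta; rewrite le_eqVlt => /predU1P[->|ta]; first by rewrite subrr mulr0 sin0.
by apply/ltW/sin_gt0_pi; apply/andP; split; nra.
Qed.

Lemma arc_smooth (a : R) : smooth1 (arc a).
Proof.
apply: smooth1M.
  rewrite (_ : (fun t => _) = fun t => sin (pi * t + - (pi * a))).
    exact/smooth1_affine/smooth1_sin.
  by apply/funext => t; rewrite mulrBr.
rewrite (_ : (fun t => _) = fun t => sin (- pi * t + pi)).
  exact/smooth1_affine/smooth1_sin.
by apply/funext => t; congr sin; ring.
Qed.

Lemma torus_integ_bounded (f : Rd -> R) (K : R) : measurable_fun setT f ->
  (forall x, `|f x| <= K) -> integ mu f /\ nrm mu f <= `|K|.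
Proof.
rewrite -(probability_bundleE m_torus_setT) => mf fK.
have IK := integ_cst (probability_bundle m_torus_setT) K.
have le x : `|f x| <= `|K| by apply: le_trans (fK x) (ler_norm _).
have If : integ (probability_bundle m_torus_setT) f.
  by apply: (ae_le_integ mf IK); exact/aeW.
split => //; rewrite -(Rint_cst_probability (probability_bundle m_torus_setT) `|K|).
by apply: ae_le_Rint; [exact: integ_abs|exact: (integ_abs IK)|exact: aeW].
Qed.

Lemma torus_setting : translation_setting mu (@int_vec R dim) (fun=> True) (fun _ _ => 1).
Proof.
have t1 : test_fun (@int_vec R dim) (fun=> True) (fun=> 1 : R).
  by split => //; exact: bounded_smooth_cst.
split => //.
- move=> f c mf f0 pf.
  rewrite !ge0_integral_mrestr//; last 3 first.
  + exact/measurable_EFinP.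
  + by apply/measurable_EFinP; exact: translate_measurable.
  + by move=> x; rewrite lee_fin.
  apply: (@translation_invariant_rV R `[0, 1[%classic [set t | t \is a Num.int] _ _ _ dim
    (EFin \o f) c).
  + exact: measurable_itv.
  + exact: int_num0.
  + by move=> F c' mF F0 FP; exact: periodic_integral_translate.
  + exact/measurable_EFinP.
  + by move=> x; rewrite lee_fin.
  + by move=> x z Pz; rewrite /= pf.
- move=> phi [s _ _]; have [K _ hK] := bsmooth_bounded (s 0%N).
  by have [] := torus_integ_bounded (bsmooth_measurable (s 0%N)) hK.
- move=> psi [s _ _] eps eps0; have [K K0 hK] := bounded_smooth_lipschitz s.
  have K1 : 0 < K + 1 by rewrite ltr_wpDl.
  exists (eps / (K + 1)); first exact: divr_gt0.
  move=> h hh.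
  have mh : measurable_fun setT (fun x : Rd => psi (x + h) - psi x).
    apply: measurable_funB; last exact: (bsmooth_measurable (s 0%N)).
    exact: (bsmooth_measurable (bounded_smooth_translate h s 0%N)).
  have [_] := torus_integ_bounded mh (hK ^~ h); move/le_trans; apply.
  have : `|h| * (K + 1) <= eps by rewrite -ler_pdivlMr// ltW.
  by rewrite ger0_norm ?mulr_ge0//; have := normr_ge0 h; lra.
- by move=> _ _; rewrite ler01 lexx.
- by apply/aeW => x; exact: cvg_cst.
- move=> i a; have [a0|a0] := ltP a 0.
    exists (fun _ _ => 1) => [_|].
      by split => //; [exact: bounded_smooth_cst|move=> _; rewrite ler01 lexx].
    apply: filterS m_torus_cell => x /(_ i); rewrite /= in_itv/= => /andP[x0 _].
    by rewrite indicE mem_set//=; [exact: cvg_cst|exact: lt_le_trans x0].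
  have [a1|a1] := leP 1 a.
    exists (fun _ _ => 0) => [_|].
      by split => //; [exact: bounded_smooth_cst|move=> _; rewrite ler01 lexx].
    apply: filterS m_torus_cell => x /(_ i); rewrite /= in_itv/= => /andP[_ x1].
    rewrite indicE memNset//=; first exact: cvg_cst.
    by apply/negP; rewrite -leNgt; apply/ltW/(lt_le_trans x1).
  exists (fun N x => step (N%:R * arc a (x 0 i))) => [N|].
    split.
    + apply: (@bounded_smooth_coord _ _ (fun t => step (N%:R * arc a t))).
      have [da sda] := smooth1_derive1 (arc_smooth a).
      apply: (smooth1_comp (v := fun t => N%:R * arc a t)
        (v' := fun t => N%:R * derive1 (arc a) t) (@smooth1_flat R 0)).
      exact: smooth1M (smooth1_cst _) sda.
    + by move=> x z Lz; rewrite mxE arc_periodic//; exact: Lz.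
    + by move=> x; exact: step01.
  apply: filterS m_torus_cell => x /(_ i); rewrite /= in_itv/= => x01.
  rewrite (_ : \1_[set x : Rd | a < x 0 i] x = (0 < arc a (x 0 i))%R%:R :> R).
    exact: step_dilation_cvg.
  rewrite arc_gt0 ?a0// indicE; congr (nat_of_bool _)%:R.
  by apply/idP/idP; rewrite inE.
Qed.

End torus_setting.

(** * From differentiable kernels to linear response *)

Section ess_bounds.
Context (R : realType) (dim : nat) (m : probability 'rV[R]_dim R).
Local Notation Rd := 'rV[R]_dim.

(** The essential supremum bounds almost everywhere because the measure is not zero. *)
Lemma Linfnorm_ae (u : Rd -> Rd) (c : R) : (Linfnorm m u <= c%:E)%E ->
  {ae m, forall x, `|u x| <= c}.
Proof.
have m0 : (0 < (1 : \bar R))%E by exact: lte01.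
rewrite -(probability_setT m) in m0; rewrite /Linfnorm unlock m0.
move=> /ess_supP; apply: filterS => x /=.
by rewrite lee_fin normr_id.
Qed.

Variables (X : set Rd) (eqv : Rd -> Rd -> Prop) (e0 : R).
Variables (f : int -> R -> Rd -> Rd) (fdot : int -> Rd -> Rd) (r : int -> R -> Rd -> Rd).
Hypothesis uf : uniformly_differentiable m X eqv e0 f fdot r.

Lemma fdot_bound : exists2 F : R, 0 <= F & forall n, {ae m, forall x, `|fdot n x| <= F}.
Proof.
have [_ _ _ sup _] := uf.
have ge0 : (0 <= sup_over (fun n => Linfnorm m (fdot n)))%E.
  exact: le_trans (Lnorm_ge0 _ _ _) (sup_over_ge _ (0 : int)).
exists (fine (sup_over (fun n => Linfnorm m (fdot n)))); first exact: fine_ge0.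
move=> n; apply: Linfnorm_ae; rewrite fineK; first exact: sup_over_ge.
by rewrite ge0_fin_numE.
Qed.

Lemma remainder_bound (eps : R) : 0 < eps -> exists2 e2 : R, 0 < e2 &
  forall e n, 0 < e < e2 -> {ae m, forall x, `|r n e x| <= eps * e}.
Proof.
move=> eps0; have [_ _ _ _ cv] := uf.
have [fin cv0] := (fine_cvgP _ _).1 cv.
have le0 : \forall e \near (0 : R)^'+,
    `|fine (sup_over (fun n => `|e|^-1%:E * Linfnorm m (r n e))%E)| <= eps.
  by move/cvgr0Pnorm_le : cv0; exact.
have {fin le0} [d /= d0 hd] : \forall e \near (0 : R)^'+,
    (sup_over (fun n => `|e|^-1%:E * Linfnorm m (r n e)) <= eps%:E)%E.
  near=> e; have fe : sup_over (fun n => `|e|^-1%:E * Linfnorm m (r n e))%E \is a fin_num.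
    by near: e.
  rewrite -(fineK fe) lee_fin; apply: le_trans (ler_norm _) _.
  by near: e.
exists d => // e n /andP[e0' ed].
have : (sup_over (fun n => `|e|^-1%:E * Linfnorm m (r n e)) <= eps%:E)%E.
  by apply: hd => //=; rewrite sub0r normrN gtr0_norm.
move=> /(le_trans (sup_over_ge _ n)) h; apply: Linfnorm_ae.
rewrite mulrC EFinM -lee_pdivrMl//.
by move: h; rewrite gtr0_norm.
Unshelve. all: by end_near. Qed.

End ess_bounds.

Section response_of_differentiable_kernel.
Context (R : realType) (dim : nat) (m : probability 'rV[R]_dim R).
Local Notation Rd := 'rV[R]_dim.
Variables (k : Rd -> Rd -> R) (D : Rd -> Rd -> Rd -> R) (C : R).

Hypothesis kI : forall z, integ m (k z).
Hypothesis k1 : forall z, \int[m]_y k z y = 1.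
Hypothesis DI : forall z u, integ m (D z u).
Hypothesis Dlin : forall z (c : R) u v,
  {ae m, forall y, D z (c *: u + v) y = c * D z u y + D z v y}.
Hypothesis C0 : 0 <= C.
Hypothesis DC : forall z u, nrm m (D z u) <= C * `|u|.
Hypothesis kD : forall eps : R, 0 < eps -> exists2 del : R, 0 < del &
  forall z h, `|h| < del ->
    nrm m (fun y => k (z + h) y - k z y - D z h y) <= eps * `|h|.
Hypothesis Dcont : forall eps : R, 0 < eps -> exists2 del : R, 0 < del &
  forall z h u, `|h| < del -> `|u| <= 1 -> nrm m (fun y => D (z + h) u y - D z u y) <= eps.

Lemma L1_C1_kernel : L1_C1 m k D.
Proof.
split => //.
- move=> z; apply: cvg_ereal0 => [h|eps eps0].
    by apply: mule_ge0 (L1norm_ge0 _ _); rewrite lee_fin invr_ge0.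
  have [del del0 hdel] := kD eps0; near=> h.
  rewrite L1normE; last by apply: (@integB _ _ _ m) => //; exact: integB.
  have h0 : 0 < `|h| by rewrite normr_gt0; near: h; exact: nbhs_dnbhs_neq.
  rewrite -EFinM lee_fin mulrC ler_pdivrMr//; apply: hdel.
  by near: h; exact: dnbhs0_lt.
- move=> z; apply: (@cvg_ereal0 R _ (nbhs z) (nbhs_filter z)) => [z'|eps eps0].
    apply: le_trans (L1norm_ge0 m _) (ereal_sup_ubound _); exists 0 => //=.
    by rewrite normr0.
  have [del del0 hdel] := Dcont eps0; near=> z'.
  apply: ge_ereal_sup => _ [u /= u1 <-]; rewrite L1normE; last exact: (@integB _ _ _ m).
  rewrite lee_fin; have -> : z' = z + (z' - z) by rewrite addrC subrK.
  by apply: hdel => //; rewrite distrC; near: z'; exact: cvgr_dist_lt.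
Unshelve. all: by end_near. Qed.

Variables (X : set Rd) (eqv : Rd -> Rd -> Prop) (e0 : R) (alpha e1 : R).
Variables (f : int -> R -> Rd -> Rd) (fdot : int -> Rd -> Rd) (r : int -> R -> Rd -> Rd).
Variable K : set Rd.
Hypothesis uf : uniformly_differentiable m X eqv e0 f fdot r.
Hypothesis mX : {ae m, forall x, X x}.
Hypothesis keqv : forall z z', eqv z z' -> k z = k z'.
Hypothesis alpha0 : 0 < alpha.
Hypothesis ka : forall z, K z -> {ae m, forall y, alpha <= k z y}.
Hypothesis e10 : 0 < e1.
Hypothesis e1e0 : e1 <= e0.
Hypothesis fK : forall n e x, 0 <= e < e1 -> X x -> K (f n e x).
Hypothesis mk : forall n e, 0 <= e < e1 ->
  measurable_fun setT (fun p : Rd * Rd => k (f n e p.1) p.2).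
Hypothesis mD : forall n,
  measurable_fun setT (fun p : Rd * Rd => D (f n 0 p.1) (fdot n p.1) p.2).

(** Along the dynamics the increment of the centre of the kernel is
h = e fdot + r with |h| = O(e), which turns the derivative of z |-> k z into that
of e |-> k (f n e x), uniformly in n and x. *)
Lemma increment_bound : exists2 F : R, 0 <= F &
  (forall n, {ae m, forall x, `|fdot n x| <= F}) /\
  forall eta : R, 0 < eta -> eta <= 1 -> exists2 e2 : R, 0 < e2 & forall e n, 0 < e < e2 -> e < e1 ->
    {ae m, forall x, exists h : Rd, [/\ h = e *: fdot n x + r n e x,
      k (f n e x) = k (f n 0 x + h), `|fdot n x| <= F, `|r n e x| <= eta * e &
      `|h| <= (F + 1) * e]}.
Proof.
have [F F0 hF] := fdot_bound uf; exists F => //; split => // eta eta0 eta1.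
have [e2 e20 h2] := remainder_bound uf eta0; exists e2 => // e n ee2 ee1.
have [_ _ fE _ _] := uf; have /andP[e_gt0 _] := ee2.
apply: filterS3 (hF n) (h2 e n ee2) mX => x Fx rx Xx.
exists (e *: fdot n x + r n e x); split => //.
  by rewrite addrA; apply/keqv/fE => //; rewrite ltW//= (lt_le_trans ee1).
rewrite (le_trans (ler_normD _ _))// mulrDl mul1r; apply: lerD.
  by rewrite normrZ gtr0_norm// mulrC ler_wpM2r// ltW.
by apply: le_trans rx _; rewrite ler_piMl// ltW.
Qed.

(** e^-1 (k(z + h) - k z) - D z fdot splits into the Taylor remainder at h, of size
o(|h|) / e, and D z r / e, of size o(1). *)
Lemma response_of_differentiable_kernel : linear_response m k D f fdot e0.
Proof.
split; first exact: L1_C1_kernel.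
exists e1; split; first by rewrite e10.
have [F F0 [hF incr]] := increment_bound.
have F1 : 0 < F + 1 by rewrite ltr_wpDl.
have C1 : 0 < C + 1 by rewrite ltr_wpDl.
(* The lower bound is decreased below 1 because 1 minus it is a contraction rate, which
   has to be positive. *)
apply: (@linear_response_of_kernels _ _ m k D f fdot (Num.min alpha 2^-1) e1 (C * F)) => //.
- by rewrite lt_min alpha0 gt_min /=; apply/andP; split; [lra|apply/orP; right; lra].
- exact: mulr_ge0.
- move=> e n e01; split; first exact: mk.
  apply: filterS mX => x Xx; split => //.
  apply: filterS (ka (fK n e01 Xx)) => y; apply: le_trans.
  by rewrite ge_min lexx.
- move=> n; apply: filterS (hF n) => x Fx; split => //.
  by apply: le_trans (DC _ _) _; rewrite ler_wpM2l.
- move=> eps eps0; have [del del0 hdel] := kD ltr01.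
  have [e2 e20 h2] := incr 1 ltr01 (lexx _).
  exists (Num.min e2 (Num.min (del / (F + 1)) (eps / ((C + 1) * (F + 1))))).
    by rewrite !lt_min e20 !divr_gt0// mulr_gt0.
  move=> e n /andP[e_gt0]; rewrite !lt_min => /and3P[ee2 edel eeps] ee1.
  have ee : 0 < e < e2 by rewrite e_gt0.
  apply: filterS (h2 e n ee ee1) => x [h [_ -> _ _ hle]].
  have hd : `|h| < del by apply: le_lt_trans hle _; rewrite mulrC -ltr_pdivlMr.
  split; first exact: integB.
  have := nrm_tri (integB (kI (f n 0 x + h)) (kI (f n 0 x))) (DI (f n 0 x) h) (integ0 m).
  under [X in nrm m X <= _]funext do rewrite subr0.
  under [X in _ <= _ + nrm m X]funext do rewrite subr0.
  move=> /le_trans; apply; apply: le_trans (lerD (hdel _ _ hd) (DC _ _)) _.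
  rewrite -mulrDl addrC; apply: le_trans (ler_wpM2l (ltW C1) hle) _.
  rewrite mulrA mulrC -ler_pdivlMr; first exact: ltW.
  by rewrite mulr_gt0.
- move=> eps eps0.
  pose eta := Num.min 1 (eps / (2 * (C + 1))).
  have eta0 : 0 < eta by rewrite lt_min ltr01 divr_gt0// mulr_gt0.
  have eps10 : 0 < eps / (2 * (F + 1)) by rewrite divr_gt0// mulr_gt0.
  have [del del0 hdel] := kD eps10.
  have eta1 : eta <= 1 by rewrite ge_min lexx.
  have etaeps : eta <= eps / (2 * (C + 1)) by rewrite ge_min lexx orbT.
  have [e2 e20 h2] := incr eta eta0 eta1.
  exists (Num.min e2 (del / (F + 1))); first by rewrite lt_min e20 divr_gt0.
  move=> e n /andP[e_gt0]; rewrite lt_min => /andP[ee2 edel] ee1.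
  have ee : 0 < e < e2 by rewrite e_gt0.
  apply: filterS (h2 e n ee ee1) => x [h [hE -> _ rle hle]].
  have hd : `|h| < del by apply: le_lt_trans hle _; rewrite mulrC -ltr_pdivlMr.
  set z := f n 0 x in hE *.
  have I1 := integB (integB (kI (z + h)) (kI z)) (DI z h).
  have I0 : integ m (fun y => e^-1 * (k (z + h) y - k z y) - D z (fdot n x) y).
    by apply: integB => //; apply: integZ; exact: integB.
  split => //.
  have -> : nrm m (fun y => e^-1 * (k (z + h) y - k z y) - D z (fdot n x) y) =
      nrm m (fun y => e^-1 * ((k (z + h) y - k z y - D z h y) + D z (r n e x) y)).
    apply: ae_eq_nrm => //; first by apply: integZ; exact: integD.
    rewrite hE; apply: filterS (Dlin z e (fdot n x) (r n e x)) => y ->.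
    by field; rewrite gt_eqF.
  rewrite nrmZ ?gtr0_norm ?invr_gt0//; last exact: integD.
  rewrite mulrC ler_pdivrMr//; apply: le_trans (nrmD I1 (DI _ _)) _.
  apply: le_trans (lerD (hdel _ _ hd) (DC _ _)) _.
  apply: (@le_trans _ _ (eps / (2 * (F + 1)) * ((F + 1) * e) + (C + 1) * (eps / (2 * (C + 1)) * e))).
    apply: lerD; first by rewrite ler_wpM2l// ltW.
    apply: ler_pM => //; first by rewrite lerDl.
    by apply: le_trans rle _; rewrite ler_wpM2r// ltW.
  by rewrite le_eqVlt; apply/orP; left; apply/eqP; field; rewrite !gt_eqF.
Qed.

End response_of_differentiable_kernel.

(** * Translates of a Sobolev function as a differentiable kernel *)

Section translated_kernel.
Context (R : realType) (dim : nat).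
Local Notation Rd := 'rV[R]_dim.
Context (M : {measure set Rd -> \bar R}).
Variables (Lam : set Rd) (supp : (Rd -> R) -> Prop) (chi : nat -> Rd -> R).
Hypothesis setting : translation_setting M Lam supp chi.
Variables (q : Rd -> R) (dq : Rd -> Rd).
Hypothesis Iq : integ M q.
Hypothesis pq : @Lam_periodic _ _ Lam _ q.
Hypothesis Idq : forall i, integ M (fun x => dq x 0 i).
Hypothesis pdq : @Lam_periodic _ _ Lam _ dq.
Hypothesis dqP : forall phi, test_fun Lam supp phi -> forall i,
  \int[M]_x (q x * partial i phi x) = - \int[M]_x (dq x 0 i * phi x).

Definition grad_kernel (z u y : Rd) : R := - dot (dq (y - z)) u.

Let Idqt i (z : Rd) : integ M (fun y => dq (y - z) 0 i).
Proof.
apply: (translate_integ setting (f := fun y => dq y 0 i)) => // x w Lw.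
by rewrite pdq.
Qed.

Lemma translated_integ (z : Rd) : integ M (fun y => q (y - z)).
Proof. exact: (translate_integ setting). Qed.

Lemma translated_Rint (z : Rd) : \int[M]_y q (y - z) = \int[M]_y q y.
Proof. exact: (translate_Rint setting). Qed.

(** The translate of the deficit max 0 (alpha - q) has the same integral, namely 0. *)
Lemma translated_ae_ge (alpha : R) z : {ae M, forall y, alpha <= q y} ->
  {ae M, forall y, alpha <= q (y - z)}.
Proof.
move=> qa; pose g y : R := Num.max 0 (alpha - q y).
have mg : measurable_fun setT g.
  by apply: measurable_maxr => //; apply: measurable_funB => //; exact: integ_measurable Iq.
have g0 : {ae M, forall y, g y = 0}.
  by apply: filterS qa => y qy; rewrite /g max_l// subr_le0.
have Ig : integ M g := ae_integ mg (integ0 M) g0.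
have pg : @Lam_periodic _ _ Lam _ g by move=> x w Lw; rewrite /g pq.
have := translate_nrm setting (- z) mg pg.
rewrite (ae_eq_nrm Ig (integ0 M) g0) nrm0.
move=> /(nrm_eq0_ae (translate_integ setting _ Ig pg)).
by apply: filterS => y gy; rewrite -subr_le0 -gy /g le_max lexx orbT.
Qed.

Lemma grad_kernel_integ z u : integ M (grad_kernel z u).
Proof.
apply: (@integN _ _ _ M); apply: integ_sum => i.
under [X in _ \o X]funext do rewrite mulrC.
exact: integZ.
Qed.

Lemma grad_kernel_linear (z : Rd) (c : R) (u v y : Rd) :
  grad_kernel z (c *: u + v) y = c * grad_kernel z u y + grad_kernel z v y.
Proof.
rewrite /grad_kernel mulrN -opprD; congr (- _).
rewrite /dot mulr_sumr -big_split /=; apply: eq_bigr => i _.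
by rewrite !mxE; ring.
Qed.

Let nrm_dot (g : Rd -> Rd) u (B : 'I_dim -> R) : (forall i, integ M (fun y => g y 0 i)) ->
  (forall i, nrm M (fun y => g y 0 i) <= B i) ->
  nrm M (fun y => dot (g y) u) <= (\sum_i B i) * `|u|.
Proof.
move=> Ig gB; have Igu i : integ M (fun y => g y 0 i * u 0 i).
  by under [X in _ \o X]funext do rewrite mulrC; exact: integZ.
apply: le_trans (nrm_sum _ Igu) _; rewrite mulr_suml; apply: ler_sum => i _.
under [X in nrm M X]funext do rewrite mulrC.
rewrite nrmZ// mulrC; apply: ler_pM => //; [exact: nrm_ge0|exact: coord_norm_le].
Qed.

Lemma grad_kernel_nrm z u :
  nrm M (grad_kernel z u) <= (\sum_i nrm M (fun y => dq y 0 i)) * `|u|.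
Proof.
rewrite nrmN; apply: nrm_dot => // i.
have p : @Lam_periodic _ _ Lam _ (fun y => dq y 0 i) by move=> x w Lw; rewrite pdq.
by have <- := translate_nrm setting (- z) (integ_measurable (Idq i)) p.
Qed.

Lemma grad_kernel_continuous (eps : R) : 0 < eps -> exists2 del : R, 0 < del &
  forall z h u, `|h| < del -> `|u| <= 1 ->
    nrm M (fun y => grad_kernel (z + h) u y - grad_kernel z u y) <= eps.
Proof.
move=> eps0; have dim0 : 0 < dim%:R + 1 :> R by rewrite ltr_wpDl.
have [del del0 hdel] := weak_gradient_translation setting Idq pdq (divr_gt0 eps0 dim0).
exists del => // z h u hd u1.
pose g y := dq (y - h) - dq y.
have gE i : (fun y => g y 0 i) = (fun y => dq (y - h) 0 i - dq y 0 i).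
  by apply/funext => y; rewrite !mxE.
have Ig i : integ M (fun y => g y 0 i) by rewrite gE; exact: integB.
have pg : @Lam_periodic _ _ Lam _ (fun y => dot (g y) u).
  by move=> x w Lw; rewrite /g pdq// addrAC pdq.
have Igu : integ M (fun y => dot (g y) u).
  by apply: integ_sum => i; under [X in _ \o X]funext do rewrite mulrC; exact: integZ.
rewrite (_ : (fun y => _) = fun y => - dot (g (y - z)) u); last first.
  apply/funext => y; rewrite /grad_kernel /g opprD addrA /dot -!sumrN -big_split /=.
  by apply: eq_bigr => i _; rewrite !mxE; ring.
rewrite nrmN (translate_nrm setting (f := fun y => dot (g y) u) (- z))//; last first.
  exact: integ_measurable Igu.
apply: le_trans (@nrm_dot g u (fun=> eps / (dim%:R + 1)) Ig _) _.
  by move=> i; rewrite gE; exact: hdel.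
rewrite sumr_const card_ord -[_ *+ dim]mulr_natr; apply: le_trans (ler_wpM2l _ u1) _.
  by rewrite mulr_ge0// ltW// divr_gt0.
by rewrite mulr1 mulrAC ler_pdivrMr// ler_wpM2l ?ltW// ltrDl.
Qed.

Lemma translated_differentiable (eps : R) : 0 < eps -> exists2 del : R, 0 < del &
  forall z h, `|h| < del ->
    nrm M (fun y => q (y - (z + h)) - q (y - z) - grad_kernel z h y) <= eps * `|h|.
Proof.
move=> eps0; have [del del0 hdel] := first_order_remainder setting Iq pq Idq pdq dqP eps0.
exists del => // z h hd.
pose g y := q (y - h) - q y + \sum_i h 0 i * dq y 0 i.
have Iqt c : integ M (fun y => q (y - c)) by exact: translated_integ.
have Ig : integ M g.
  apply: (@integD _ _ _ M); first exact: integB.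
  by apply: integ_sum => i; exact: integZ.
rewrite (_ : (fun y => _) = fun y => g (y - z)); last first.
  apply/funext => y; rewrite /grad_kernel opprK /g opprD addrA; congr (_ + _).
  by apply: eq_bigr => i _; rewrite mulrC.
rewrite (translate_nrm setting (f := g) (- z))//; first exact: hdel.
  exact: integ_measurable Ig.
move=> x w Lw; rewrite /g (addrAC x) pq// pq//; congr (_ + _).
by apply: eq_bigr => i _; rewrite pdq.
Qed.

End translated_kernel.

(** * The periodic case *)

Section periodic_case.
Context (R : realType) (dim : nat).
Local Notation Rd := 'rV[R]_dim.
Local Notation M := (m_torus R dim).

Lemma measurable_increment (g : Rd -> Rd) : measurable_fun setT g ->
  measurable_fun setT (fun p : Rd * Rd => p.2 - g p.1).
Proof.
move=> mg; apply: measurable_rVP => i.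
rewrite (_ : (fun p => _) = fun p : Rd * Rd => p.2 0 i - (g p.1) 0 i); last first.
  by apply/funext => p; rewrite !mxE.
apply: measurable_funB.
  exact: measurableT_comp (measurable_coord i) measurable_snd.
apply: measurableT_comp (measurable_coord i) _.
exact: measurableT_comp mg measurable_fst.
Qed.

(** The kernel and its derivative are translates of q and of its gradient themselves. *)
Lemma periodic_response (q : Rd -> R) (dq : Rd -> Rd) (alpha e0 : R)
    (f : int -> R -> Rd -> Rd) (fdot : int -> Rd -> Rd) (r : int -> R -> Rd -> Rd) :
  W11_torus q dq ->
  \int[M]_x q x = 1 ->
  0 < alpha -> {ae M, forall x, alpha <= q x} ->
  0 < e0 ->
  (forall n (e : R), 0 <= e < e0 -> measurable_fun setT (f n e)) ->
  uniformly_differentiable M (unit_cell R dim) (@eqmodZ R dim) e0 f fdot r ->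
  linear_response M (fun z y => q (y - z)) (fun z u y => - dot (dq (y - z)) u) f fdot e0.
Proof.
move=> [[pq pdq] [mq Iq] mdq Idq dqP] q1 alpha0 qa e00 mf uf.
have testP phi : test_fun (@int_vec R dim) (fun=> True) phi -> forall i,
    \int[M]_x (q x * partial i phi x) = - \int[M]_x (dq x 0 i * phi x).
  by move=> [s p _]; apply: dqP; split => //; exact: bounded_smooth_smooth.
have kI := translated_integ (@torus_setting R dim) Iq pq.
have k1 z : \int[M]_y q (y - z) = 1 by rewrite (translated_Rint (@torus_setting R dim)).
have DI := grad_kernel_integ (@torus_setting R dim) Idq pdq.
have DC := grad_kernel_nrm (@torus_setting R dim) Idq pdq.
have kD := translated_differentiable (@torus_setting R dim) Iq pq Idq pdq testP.
have Dc := grad_kernel_continuous (@torus_setting R dim) Idq pdq.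
have ka z : setT z -> {ae M, forall y, alpha <= q (y - z)}.
  by move=> _; exact: (translated_ae_ge (@torus_setting R dim) Iq pq).
have mX := @m_torus_cell R dim.
have [mfdot _ _ _ _] := uf.
have e00' : (0 : R) <= 0 < e0 by rewrite lexx.
have mk n e : 0 <= e < e0 -> measurable_fun setT (fun p : Rd * Rd => q (p.2 - f n e p.1)).
  by move=> e01; apply: measurableT_comp mq _; exact: (measurable_increment (mf n e e01)).
have mD n : measurable_fun setT (fun p : Rd * Rd => - dot (dq (p.2 - f n 0 p.1)) (fdot n p.1)).
  apply: measurableT_comp => //; apply: measurable_sum => i.
  apply: measurable_funM.
    apply: measurableT_comp (measurable_coord i) _.
    by apply: measurableT_comp mdq _; exact: (measurable_increment (mf n 0 e00')).
  apply: measurableT_comp (measurable_coord i) _.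
  exact: measurableT_comp (mfdot n) measurable_fst.
(* Congruent centres give the same kernel, so lifts of the maps are immaterial. *)
have keqv z z' : eqmodZ z z' -> (fun y => q (y - z)) = (fun y => q (y - z')).
  move=> zz'; apply/funext => y; rewrite -(pq (y - z) _ zz'); congr q.
  by rewrite addrA subrK.
move: kI k1 DI DC kD Dc ka mX uf; rewrite -(probability_bundleE (m_torus_setT R dim)).
move=> kI k1 DI DC kD Dc ka mX uf.
have Dlin z (c : R) u v : {ae probability_bundle (m_torus_setT R dim), forall y,
    - dot (dq (y - z)) (c *: u + v) = c * - dot (dq (y - z)) u + - dot (dq (y - z)) v}.
  by apply/aeW => y; exact: (grad_kernel_linear dq).
have C0 : 0 <= \sum_i nrm (probability_bundle (m_torus_setT R dim)) (fun y => dq y 0 i).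
  by apply: sumr_ge0 => i _; exact: nrm_ge0.
exact: (response_of_differentiable_kernel kI k1 DI Dlin C0 DC kD Dc uf mX keqv alpha0 ka
  e00 (lexx _) (fun n e x _ _ => Logic.I) mk mD).
Qed.

End periodic_case.

(** * Densities of push-forward measures *)

Section pushforward_densities.
Context (R : realType) (dim : nat).
Local Notation Rd := 'rV[R]_dim.
Local Notation mu := (lebesgue_rV R dim).
Context (m : {measure set Rd -> \bar R}).
Variable rho : Rd -> Rd.
Hypothesis mrho : measurable_fun setT rho.
Implicit Types (h p : Rd -> R) (A : set Rd).

Lemma Rintegral_set_indic d (T : measurableType d) (n : {measure set T -> \bar R})
  (A : set T) (f : T -> R) : \int[n]_(x in A) f x = \int[n]_x (f x * \1_A x).
Proof.
rewrite Rintegral_mkcond; apply: eq_Rintegral => x _.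
by rewrite patchE indicE; case: ifP => _; rewrite ?mulr1// mulr0.
Qed.

Let integ_indic d (T : measurableType d) (n : {measure set T -> \bar R}) (A : set T)
  (f : T -> R) : integ n f -> measurable A -> integ n (fun x => f x * \1_A x).
Proof.
move=> If mA; apply: (integ_bounded If (B := 1)) => [|x].
  exact: measurable_indic.
by rewrite indicE ger0_norm// lern1 leq_b1.
Qed.

Let mpre A : measurable A -> measurable (rho @^-1` A).
Proof. by move=> mA; rewrite -[_ @^-1` _]setTI; exact: mrho. Qed.

Lemma pushforward_linear (c : R) h1 p1 h2 p2 : integ mu h1 -> integ mu h2 ->
  pushforward_density m rho h1 p1 -> pushforward_density m rho h2 p2 ->
  pushforward_density m rho (fun x => c * h1 x + h2 x) (fun y => c * p1 y + p2 y).
Proof.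
move=> I1 I2 [J1 e1] [J2 e2]; split.
  by apply: (@integD _ _ _ m) => //; exact: (@integZ _ _ _ m).
move=> A mA; have mA' := mpre mA.
have lin d (T : measurableType d) (n : {measure set T -> \bar R}) (B : set T) (f g : T -> R) :
    integ n f -> integ n g -> measurable B ->
    \int[n]_(x in B) (c * f x + g x) = c * \int[n]_(x in B) f x + \int[n]_(x in B) g x.
  move=> If Ig mB; have S := integrableS measurableT mB (@subsetT _ B).
  rewrite RintegralD//; [|exact/S/integZ|exact/S/Ig].
  by rewrite RintegralZl//; exact/S/If.
by rewrite !lin// e1// e2.
Qed.

Lemma pushforwardB h1 p1 h2 p2 : integ mu h1 -> integ mu h2 ->
  pushforward_density m rho h1 p1 -> pushforward_density m rho h2 p2 ->
  pushforward_density m rho (fun x => h1 x - h2 x) (fun y => p1 y - p2 y).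
Proof.
move=> I1 I2 d1 d2; have := pushforward_linear (-1) I2 I1 d2 d1.
by under eq_fun do rewrite mulN1r addrC; under [X in _ X -> _]eq_fun do rewrite mulN1r addrC.
Qed.

(** The sign of p splits the space into two sets on each of which the integral of |p|
is an integral of h over a preimage, and the two preimages are disjoint. *)
Lemma pushforward_nrm h p : integ mu h -> pushforward_density m rho h p ->
  nrm m p <= nrm mu h.
Proof.
move=> Ih [Ip ep]; pose A : set Rd := [set y | 0 <= p y].
have mp : measurable_fun setT p := integ_measurable Ip.
have mA : measurable A.
  rewrite (_ : A = setT `&` p @^-1` `[0, +oo[%classic); first exact: mp.
  by rewrite setTI; apply/seteqP; split => y; rewrite /A /= in_itv/= andbT.
have mA' := mpre mA.
have split1 d (T : measurableType d) (n : {measure set T -> \bar R}) (B : set T) (f : T -> R) :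
    integ n f -> measurable B ->
    \int[n]_x (f x * (\1_B x - \1_(~` B) x)) = \int[n]_(x in B) f x - \int[n]_(x in ~` B) f x.
  move=> If mB; rewrite (Rintegral_set_indic n B) (Rintegral_set_indic n (~` B)) -RintegralB//.
  - by apply: eq_Rintegral => x _; rewrite mulrBr.
  - exact: integ_indic.
  - by apply: integ_indic => //; exact: measurableC.
have indicBC (T : Type) (B : set T) (x : T) : (\1_B x - \1_(~` B) x : R) = if x \in B then 1 else -1.
  by rewrite !indicE in_setC; case: (x \in B); rewrite ?subr0// sub0r.
have -> : nrm m p = \int[mu]_x (h x * (\1_(rho @^-1` A) x - \1_(~` (rho @^-1` A)) x)).
  rewrite split1// -(ep _ mA) -(ep _ (measurableC mA)) -split1//.
  apply: eq_Rintegral => y _; rewrite indicBC; case: ifPn => yA.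
    by rewrite mulr1 ger0_norm//; move: yA; rewrite inE.
  rewrite mulrN1 ltr0_norm//; move: yA; rewrite notin_setE /A /= => /negP.
  by rewrite -ltNge.
have le1 x : `|\1_(rho @^-1` A) x - \1_(~` (rho @^-1` A)) x : R| <= 1.
  by rewrite indicBC; case: ifP; rewrite ?normrN normr1.
have mi : measurable_fun setT (fun x => \1_(rho @^-1` A) x - \1_(~` (rho @^-1` A)) x : R).
  by apply: measurable_funB; apply: measurable_indic => //; exact: measurableC.
apply: ae_le_Rint; [exact: (integ_bounded Ih mi le1)|exact: integ_abs|].
by apply/aeW => x; rewrite (le_trans (ler_norm _))// normrM ler_piMr.
Qed.

Lemma pushforward_Rint h p : pushforward_density m rho h p ->
  \int[m]_y p y = \int[mu]_x h x.
Proof. by move=> [_ ep]; exact: (ep _ measurableT). Qed.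

Lemma pushforward_unique h p1 p2 : integ mu h -> pushforward_density m rho h p1 ->
  pushforward_density m rho h p2 -> {ae m, forall y, p1 y = p2 y}.
Proof.
move=> Ih d1 d2; apply: ae_eq_nrm_le; [exact: d1.1|exact: d2.1|].
apply: le_trans (pushforward_nrm _ (pushforwardB Ih Ih d1 d2)) _; first exact: integB.
by under [X in nrm _ X]funext do rewrite subrr; rewrite nrm0.
Qed.

End pushforward_densities.

(** * The reflection of R^d onto a cube *)

Section reflection.
Context (R : realType) (dim : nat) (a b : R).
Local Notation Rd := 'rV[R]_dim.
Local Notation mu := (lebesgue_rV R dim).
Local Notation m := (m_cube dim a b).
Local Notation rho := (@reflection R dim a b).
Hypothesis ab : a < b.

Let l_gt0 : 0 < b - a. Proof. by rewrite subr_gt0. Qed.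

Lemma measurable_reflection : measurable_fun setT rho.
Proof.
have mfloor : measurable_fun setT (fun t : R => (Num.floor t)%:~R : R).
  apply: nondecreasing_measurable => // s t st.
  by rewrite ler_int; exact: le_floor.
apply: measurable_rVP => i.
rewrite (_ : (fun x => _) = reflect1 a b \o (fun x : Rd => x 0 i)); last first.
  by apply/funext => x; rewrite mxE.
apply: measurableT_comp (measurable_coord i).
rewrite /reflect1 /mod_real; apply: measurable_funD => //.
apply: measurableT_comp => //; apply: measurableT_comp => //.
apply: measurable_funB => //; apply: measurable_funB => //.
  exact: measurable_funB.
apply: measurable_funM => //; apply: (measurableT_comp mfloor).
by apply: measurable_funM => //; exact: measurable_funB.
Qed.

Lemma reflection_cube x : cube dim a b x -> rho x = x.
Proof.
move=> xc; apply/rowP => i; rewrite mxE.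
have := xc i; rewrite /= in_itv /=; move: (x 0 i) => s /andP[ax xb].
rewrite /reflect1 /mod_real.
have -> : Num.floor ((s - a) / (2 * (b - a))) = 0.
  have l2 : 0 < 2 * (b - a) by rewrite mulr_gt0.
  apply/floor_def/andP; split; first by rewrite divr_ge0 ?subr_ge0// ltW.
  by rewrite add0r mulr1z ltr_pdivrMr//; lra.
rewrite mulr0 subr0 ler0_norm; last by rewrite subr_le0 lerB.
by ring.
Qed.

Lemma lebesgue_cube : mu (cube dim a b) = ((b - a) ^+ dim)%:E.
Proof.
rewrite lebesgue_rV_rect => [|i]; last exact: measurable_itv.
under eq_bigr do rewrite lebesgue_measure_itv/= lte_fin ab -EFinB.
by rewrite prodEFin prodr_const card_ord.
Qed.

Lemma m_cubeE A : m A = (((b - a) ^+ dim)^-1%:E * mu (A `&` cube dim a b))%E.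
Proof. by rewrite /m_cube /= /mscale /= /mrestr exprVn gtr0_norm. Qed.

Lemma m_cube_setT : m setT = 1%E.
Proof.
by rewrite m_cubeE setTI lebesgue_cube -EFinM mulVf// gt_eqF// exprn_gt0.
Qed.

Lemma m_cube_ae : {ae m, forall x, cube dim a b x}.
Proof.
exists (~` cube dim a b); split.
- by apply: measurableC; exact: measurable_cube.
- by rewrite m_cubeE setICl measure0 mule0.
- by move=> x.
Qed.

Lemma ae_m_cube (P : Rd -> Prop) : {ae m, forall x, P x} ->
  {ae mu, forall x, cube dim a b x -> P x}.
Proof.
move=> [N [mN]]; rewrite m_cubeE => /eqP; rewrite mule_eq0 eqe invr_eq0.
rewrite gt_eqF ?exprn_gt0//= => /eqP N0 NP.
exists (N `&` cube dim a b); split => //.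
  by apply: measurableI => //; exact: measurable_cube.
by move=> x /= /not_implyP[cx nPx]; split => //; exact: NP.
Qed.

(** The reflection is the identity on the cube, so the density of the push-forward of
a positive measure dominates, up to normalization, its density on the cube. *)
Lemma pushforward_ge (c : R) h p : 0 <= c -> integ mu h -> {ae mu, forall x, 0 <= h x} ->
  {ae m, forall y, c <= h y} -> pushforward_density m rho h p ->
  {ae m, forall y, c * (b - a) ^+ dim <= p y}.
Proof.
move=> c0 Ih h0 hc [Ip ep]; pose c' := c * (b - a) ^+ dim.
have mp : measurable_fun setT p := integ_measurable Ip.
pose A : set Rd := [set y | p y < c'].
have mA : measurable A.
  rewrite (_ : A = setT `&` p @^-1` `]-oo, c'[%classic); first exact: mp.
  by rewrite setTI; apply/seteqP; split => y; rewrite /A /= in_itv.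
have mcube := @measurable_cube R dim a b.
have mAc : measurable (A `&` cube dim a b) by exact: measurableI.
have finAc : (mu (A `&` cube dim a b) < +oo)%E.
  apply: (@le_lt_trans _ _ (mu (cube dim a b))); last by rewrite lebesgue_cube ltry.
  by apply: le_measure; rewrite ?inE//; exact: subIsetr.
have mpre : measurable (rho @^-1` A).
  by rewrite -[_ @^-1` _]setTI; exact: measurable_reflection.
have Iind (n : {measure set Rd -> \bar R}) (B : set Rd) : measurable B ->
    (n B < +oo)%E -> integ n (\1_B : Rd -> R).
  move=> mB nB; apply/integrableP; split; first exact/measurable_EFinP/measurable_indic.
  by under eq_integral do rewrite /= ger0_norm//; rewrite integral_indic// setIT.
have Rind (n : {measure set Rd -> \bar R}) (B : set Rd) : measurable B ->
    \int[n]_x (\1_B x : R) = fine (n B).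
  by move=> mB; rewrite /Rintegral integral_indic// setIT.
have IA : integ m (\1_A : Rd -> R).
  by apply: Iind => //; rewrite m_cubeE lte_mul_pinfty// lee_fin invr_ge0 exprn_ge0// ltW.
have IpA : integ m (fun y => p y * \1_A y).
  apply: (integ_bounded Ip (B := 1)) => [|x]; first exact: measurable_indic.
  by rewrite indicE ger0_norm// lern1 leq_b1.
have IhA : integ mu (fun x => h x * \1_(rho @^-1` A) x).
  apply: (integ_bounded Ih (B := 1)) => [|x]; first exact: measurable_indic.
  by rewrite indicE ger0_norm// lern1 leq_b1.
(* On A the integral of p is that of h over the preimage of A, which contains the
   intersection of A with the cube, where h >= c. *)
have low : \int[m]_y (c' * \1_A y) <= \int[m]_y (p y * \1_A y).
  have -> : \int[m]_y (p y * \1_A y) = \int[mu]_x (h x * \1_(rho @^-1` A) x).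
    by rewrite -(Rintegral_set_indic m A p) ep// (Rintegral_set_indic mu).
  rewrite RintegralZl// Rind//.
  rewrite m_cubeE fineM//; last by rewrite ge0_fin_numE.
  rewrite /c' mulrA -[X in X * _]mulrA mulfV ?gt_eqF ?exprn_gt0// mulr1 -Rind//.
  rewrite -RintegralZl//; last exact: Iind.
  apply: ae_le_Rint => //; first by apply: (@integZ _ _ _ mu); exact: Iind.
  apply: filterS2 h0 (ae_m_cube hc) => x hx cx.
  rewrite !indicE; have [|_] := boolP (x \in A `&` cube dim a b); last first.
    by rewrite mulr0 mulr_ge0.
  rewrite inE => -[Ax xc]; have -> : x \in rho @^-1` A by rewrite inE /= reflection_cube.
  by rewrite !mulr1; exact: cx.
(* The integral of the deficit of p below c' is nonpositive by [low]. *)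
pose w y := (c' - p y) * \1_A y.
have wE y : w y = c' * \1_A y - p y * \1_A y by rewrite /w mulrBl.
have w0 y : 0 <= w y.
  rewrite /w indicE; have [|_] := boolP (y \in A); last by rewrite mulr0.
  by rewrite inE /A /= mulr1 subr_ge0 => /ltW.
have Iw : integ m w.
  rewrite (_ : w = fun y => c' * \1_A y - p y * \1_A y); last exact/funext.
  by apply: (@integB _ _ _ m) => //; exact: (@integZ _ _ _ m).
have /(nrm_eq0_ae Iw) : nrm m w = 0.
  apply/eqP; rewrite eq_le nrm_ge0 andbT /nrm.
  under eq_Rintegral do rewrite ger0_norm// wE.
  by rewrite RintegralB// ?subr_le0//; exact: integZ.
apply: filterS => y; rewrite /w indicE; have [_|] := boolP (y \in A).
  by rewrite mulr1 => /eqP; rewrite subr_eq0 /c' => /eqP ->.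
by rewrite notin_setE /A /= => /negP; rewrite -leNgt.
Qed.

Lemma reflected_alpha_bound (K : set Rd) (q : Rd -> R) : (0 < reflected_alpha a b K q)%E ->
  exists2 c : R, 0 < c & forall z, K z -> {ae m, forall y, c <= q (y - z)}.
Proof.
rewrite /reflected_alpha pmule_rgt0 ?lte_fin ?exprn_gt0//.
set S := ereal_inf _ => S0.
(* The infimum is infinite when K is empty; any constant is then a bound. *)
have [c c0 cS] : exists2 c : R, 0 < c & (c%:E <= S)%E.
  case: S S0 => [s s0|_|//]; first by exists s.
  by exists 1 => //; rewrite leey.
exists c => // z Kz.
have : (c%:E <= ess_inf m (fun y => (q (y - z))%:E))%E.
  by apply: le_trans cS _; apply: ereal_inf_lbound; exists z.
by move=> /ess_infP; apply: filterS => y; rewrite lee_fin.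
Qed.

End reflection.

(** * The reflected case *)

Section reflected_case.
Context (R : realType) (dim : nat).
Local Notation Rd := 'rV[R]_dim.
Local Notation mu := (lebesgue_rV R dim).

(** The remainder and the variation of D are themselves densities of push-forwards, of
the corresponding expressions in the translates of q and of its gradient. *)
Lemma reflected_response (a b : R) (q : Rd -> R) (dq : Rd -> Rd)
    (k : Rd -> Rd -> R) (D : Rd -> Rd -> Rd -> R) (e0 : R) (K : set Rd)
    (f : int -> R -> Rd -> Rd) (fdot : int -> Rd -> Rd) (r : int -> R -> Rd -> Rd) :
  a < b -> W11 q dq ->
  {ae mu, forall x, 0 <= q x} -> \int[mu]_x q x = 1 ->
  measurable_fun setT (fun p : Rd * Rd => k p.1 p.2) ->
  (forall z, pushforward_density (m_cube dim a b) (reflection a b)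
     (fun x => q (x - z)) (k z)) ->
  measurable_fun setT (fun p : Rd * Rd * Rd => D p.1.1 p.1.2 p.2) ->
  (forall z u, pushforward_density (m_cube dim a b) (reflection a b)
     (fun x => - dot (dq (x - z)) u) (D z u)) ->
  0 < e0 ->
  (forall n (e : R), 0 <= e < e0 -> measurable_fun setT (f n e)) ->
  (exists2 e2 : R, 0 < e2 & forall n (e : R) x, 0 <= e < e0 -> e < e2 ->
     cube dim a b x -> K (f n e x)) ->
  (0 < reflected_alpha a b K q)%E ->
  uniformly_differentiable (m_cube dim a b) (cube dim a b) eq e0 f fdot r ->
  linear_response (m_cube dim a b) k D f fdot e0.
Proof.
move=> ab [Iq mdq Idq dqP] q0 q1 mk kP mD DP e00 mf [e2 e20 fK] ra uf.
have S := @lebesgue_setting R dim.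
have per (T : Type) (g : Rd -> T) : Lam_periodic [set 0] g by move=> x z ->; rewrite addr0.
have testP phi : test_fun [set 0] (@bounded_support R dim) phi -> forall i,
    \int[mu]_x (q x * partial i phi x) = - \int[mu]_x (dq x 0 i * phi x).
  move=> [s _ c]; apply: dqP; split; first exact: bounded_smooth_smooth.
  exact: bounded_support_compact.
have mrho := @measurable_reflection R dim a b.
have Iqt := translated_integ S Iq (per _ q).
have Igt := grad_kernel_integ S Idq (per _ dq).
have push_nrm := pushforward_nrm mrho.
have kI z : integ (m_cube dim a b) (k z) by have [] := kP z.
have k1 z : \int[m_cube dim a b]_y k z y = 1.
  by rewrite (pushforward_Rint (kP z)) (translated_Rint S).
have DI z u : integ (m_cube dim a b) (D z u) by have [] := DP z u.
have Dlin z (c : R) u v :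
    {ae m_cube dim a b, forall y, D z (c *: u + v) y = c * D z u y + D z v y}.
  have := pushforward_linear mrho c (Igt z u) (Igt z v) (DP z u) (DP z v).
  rewrite (_ : (fun x => _) = grad_kernel dq z (c *: u + v)); last first.
    by apply/funext => x; rewrite grad_kernel_linear.
  exact: (pushforward_unique mrho (Igt z _) (DP z _)).
have C0 : 0 <= \sum_i nrm mu (fun y => dq y 0 i) by apply: sumr_ge0 => i _; exact: nrm_ge0.
have DC z u : nrm (m_cube dim a b) (D z u) <= (\sum_i nrm mu (fun y => dq y 0 i)) * `|u|.
  exact: le_trans (push_nrm _ _ _ (Igt z u) (DP z u)) (grad_kernel_nrm S Idq (per _ dq) z u).
have kD : forall eps : R, 0 < eps -> exists2 del : R, 0 < del & forall z h, `|h| < del ->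
    nrm (m_cube dim a b) (fun y => k (z + h) y - k z y - D z h y) <= eps * `|h|.
  move=> eps eps0.
  have [del del0 hdel] := translated_differentiable S Iq (per _ q) Idq (per _ dq) testP eps0.
  exists del => // z h hd; apply: le_trans (hdel z h hd).
  apply: push_nrm; first by apply: (@integB _ _ _ mu) => //; exact: (@integB _ _ _ mu).
  apply: (pushforwardB mrho _ (Igt _ _) _ (DP z h)) => //; first exact: (@integB _ _ _ mu).
  exact: (pushforwardB mrho (Iqt _) (Iqt _)).
have Dc : forall eps : R, 0 < eps -> exists2 del : R, 0 < del & forall z h u,
    `|h| < del -> `|u| <= 1 -> nrm (m_cube dim a b) (fun y => D (z + h) u y - D z u y) <= eps.
  move=> eps eps0; have [del del0 hdel] := grad_kernel_continuous S Idq (per _ dq) eps0.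
  exists del => // z h u hd u1; apply: le_trans (hdel z h u hd u1).
  apply: push_nrm; first exact: (@integB _ _ _ mu).
  exact: (pushforwardB mrho (Igt _ _) (Igt _ _) (DP _ _) (DP _ _)).
have [c c0 hc] := reflected_alpha_bound ab ra.
have alpha0 : 0 < c * (b - a) ^+ dim by rewrite mulr_gt0// exprn_gt0// subr_gt0.
have ka z : K z -> {ae m_cube dim a b, forall y, c * (b - a) ^+ dim <= k z y}.
  move=> Kz; apply: (pushforward_ge ab (ltW c0) (Iqt z) _ (hc z Kz) (kP z)).
  exact: (translated_ae_ge S Iq (per _ q)).
have mX := m_cube_ae dim ab.
pose e1 := Num.min e0 e2.
have e10 : 0 < e1 by rewrite lt_min e00.
have e1e0 : e1 <= e0 by rewrite ge_min lexx.
have below e : 0 <= e < e1 -> 0 <= e < e0 /\ e < e2.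
  by move=> /andP[-> ]; rewrite lt_min => /andP[-> ->].
have fK1 n e x : 0 <= e < e1 -> cube dim a b x -> K (f n e x).
  by move=> /below[? ?]; exact: fK.
have mk1 n e : 0 <= e < e1 -> measurable_fun setT (fun p : Rd * Rd => k (f n e p.1) p.2).
  move=> /below[e01 _]; apply: (measurableT_comp mk (g := fun p : Rd * Rd => (f n e p.1, p.2))).
  apply: measurable_fun_pair => //.
  exact: measurableT_comp (mf n e e01) measurable_fst.
have [mfdot _ _ _ _] := uf.
have mD1 n : measurable_fun setT (fun p : Rd * Rd => D (f n 0 p.1) (fdot n p.1) p.2).
  apply: (measurableT_comp mD (g := fun p : Rd * Rd => (f n 0 p.1, fdot n p.1, p.2))).
  apply: measurable_fun_pair => //; apply: measurable_fun_pair.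
    by apply: measurableT_comp (mf n 0 _) measurable_fst; rewrite lexx.
  exact: measurableT_comp (mfdot n) measurable_fst.
have keqv z z' : z = z' -> k z = k z' by move=> ->.
move: kI k1 DI Dlin DC kD Dc ka mX uf; rewrite -(probability_bundleE (m_cube_setT dim ab)).
move=> kI k1 DI Dlin DC kD Dc ka mX uf.
exact: (response_of_differentiable_kernel kI k1 DI Dlin C0 DC kD Dc uf mX keqv alpha0 ka
  e10 e1e0 fK1 mk1 mD1).
Qed.

End reflected_case.

Theorem theorem20 (R : realType) (d : nat) :
  (* periodic case, X = T^d *)
  (forall (q : 'rV[R]_d -> R) (dq : 'rV[R]_d -> 'rV[R]_d) (alpha e0 : R)
     (f : int -> R -> 'rV[R]_d -> 'rV[R]_d) (fdot : int -> 'rV[R]_d -> 'rV[R]_d)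
     (r : int -> R -> 'rV[R]_d -> 'rV[R]_d),
     W11_torus q dq ->
     {ae m_torus R d, forall x, 0 <= q x} ->
     \int[m_torus R d]_x q x = 1 ->
     0 < alpha ->
     {ae m_torus R d, forall x, alpha <= q x} ->
     0 < e0 ->
     (forall n (e : R), 0 <= e < e0 -> measurable_fun setT (f n e)) ->
     uniformly_differentiable (m_torus R d) (unit_cell R d) (@eqmodZ R d)
       e0 f fdot r ->
     linear_response (m_torus R d)
       (fun z y => q (y - z)) (fun z u y => - dot (dq (y - z)) u)
       f fdot e0)
  /\
  (* reflected case, X = [a, b]^d *)
  (forall (a b : R) (q : 'rV[R]_d -> R) (dq : 'rV[R]_d -> 'rV[R]_d)
     (k : 'rV[R]_d -> 'rV[R]_d -> R) (D : 'rV[R]_d -> 'rV[R]_d -> 'rV[R]_d -> R)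
     (e0 : R) (K : set 'rV[R]_d)
     (f : int -> R -> 'rV[R]_d -> 'rV[R]_d) (fdot : int -> 'rV[R]_d -> 'rV[R]_d)
     (r : int -> R -> 'rV[R]_d -> 'rV[R]_d),
     a < b ->
     W11 q dq ->
     {ae lebesgue_rV R d, forall x, 0 <= q x} ->
     \int[lebesgue_rV R d]_x q x = 1 ->
     (* k and D are jointly measurable versions of the densities *)
     measurable_fun setT
       (fun p : 'rV[R]_d * 'rV[R]_d => k p.1 p.2) ->
     (forall z, pushforward_density (m_cube d a b) (reflection a b)
        (fun x => q (x - z)) (k z)) ->
     measurable_fun setT
       (fun p : 'rV[R]_d * 'rV[R]_d * 'rV[R]_d => D p.1.1 p.1.2 p.2) ->
     (forall z u, pushforward_density (m_cube d a b) (reflection a b)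
        (fun x => - dot (dq (x - z)) u) (D z u)) ->
     0 < e0 ->
     (forall n (e : R), 0 <= e < e0 -> measurable_fun setT (f n e)) ->
     compact K ->
     (exists2 e2 : R, 0 < e2 & forall n (e : R) x, 0 <= e < e0 -> e < e2 ->
        cube d a b x -> K (f n e x)) ->
     (0 < reflected_alpha a b K q)%E ->
     uniformly_differentiable (m_cube d a b) (cube d a b) eq e0 f fdot r ->
     linear_response (m_cube d a b) k D f fdot e0).
Proof.
split=> [q dq alpha e0 f fdot r Wq _ q1 alpha0 qa e00 mf uf|].
  exact: (periodic_response Wq q1 alpha0 qa e00 mf uf).
move=> a b q dq k D e0 K f fdot r ab Wq q0 q1 mk kP mD DP e00 mf _ fK ra uf.
exact: (reflected_response ab Wq q0 q1 mk kP mD DP e00 mf fK ra uf).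
Qed.
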